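(* Let $\nu\ge 1$, $\rho_1>\rho>0$, and let $F$ be a $\mathbb{C}^\nu$-valued function of $(\varepsilon,z,f)$, holomorphic in (a neighbourhood of) the closed polydisc $\bar D_\rho\times\bar D_{\rho_1}\times\bar D_\rho^{\,\nu}$, with $F(\varepsilon,0,0)=0$ for all $\varepsilon\in\bar D_\rho$. Assume that the matrix $A_{0,1}(0)=F_f(0,0,0)$ is invertible and that, for some $\theta\in\mathbb R$ and $\gamma>0$, its eigenvalues $\lambda_1,\dots,\lambda_\nu$ satisfy $|\arg\lambda_j-\theta|>\gamma/2$ for $j=1,\dots,\nu$. Suppose the formal power series $$\hat f(\varepsilon,z)=\sum_{i=0}^\infty a_i(z)\,\varepsilon^i,$$ with $\mathbb{C}^\nu$-valued coefficients $a_i$ holomorphic near $z=0$ and $a_0(0)=0$, satisfies formally the equation $\varepsilon z\hat f'=F(\varepsilon,z,\hat f)$ (where $'=\partial/\partial z$). Then there exist $0<\sigma<\kappa<\rho$ such that all the coefficients $a_i$, $i\ge 0$, are analytic functions of $z$ in the open disc $D_\kappa$, and there exist positive constants $C$ and $\mu$ such that $$\|a_i(z)\|\le C\,i!\,\mu^i$$ holds for all $i\ge0$ and all $z\in\bar D_\sigma$. In other words, the formal power series $\hat f$ is of Gevrey order $1$, i.e. $\hat f(\varepsilon,z)\in\mathcal{O}(\sigma)[[\varepsilon]]_1$.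
   Context: Notation: $D_r=\{z\in\mathbb{C}:|z|<r\}$, $\bar D_r$ is its closure, $F_f$ is the Jacobian matrix of $F$ with respect to $f\in\mathbb{C}^\nu$, and $\|\cdot\|$ is the Euclidean norm on $\mathbb{C}^\nu$. In the eigenvalue condition, $\arg\lambda_j$ is taken modulo $2\pi$, in $(\theta-\pi,\theta+\pi]$. That $\hat f$ satisfies the equation formally means: after expanding $F(\varepsilon,z,\hat f(\varepsilon,z))$ in powers of $\varepsilon$, the coefficients of $\varepsilon^i$ on the two sides of $\varepsilon z\hat f'=F(\varepsilon,z,\hat f)$ agree, as functions of $z$ near $0$, for each $i\ge0$. $\mathcal{O}(\sigma)$ is the ring of functions holomorphic on $D_\sigma$ and continuous on $\bar D_\sigma$, and $\mathcal{O}(\sigma)[[\varepsilon]]_1$ is the set of formal power series $\sum_i a_i(z)\varepsilon^i$ with coefficients (here, components) in $\mathcal{O}(\sigma)$ such that $\max_{|z|\le\sigma}\|a_i(z)\|\le C\mu^i i!$ for all $i\ge 0$ and some constants $C,\mu>0$. *)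

(* Defs.v *)
From HB Require Import structures.
From mathcomp Require Export all_boot all_order all_algebra complex.
From mathcomp Require Export all_classical all_reals all_analysis.
Import Order.TTheory GRing.Theory Num.Theory numFieldNormedType.Exports.

Set Implicit Arguments.
Unset Strict Implicit.
Unset Printing Implicit Defensive.

Local Open Scope classical_set_scope.
Local Open Scope ring_scope.

(* R[i] packed as a numClosedFieldType: on a bare R[i] the topology and
   normed-module structures of a numFieldType are not inferred. *)
Definition Cx (R : realType) : numClosedFieldType :=
  Num.ClosedField.clone R[i] _.

Definition rc (R : realType) (x : R) : Cx R := x%:C%C.

(* Norms of complex numbers are themselves elements of Cx R, with zero
   imaginary part; the order of Cx R compares only numbers that have the same
   imaginary part, so the inequalities below are inequalities of reals. *)
Definition disc (R : realType) (r : R) : set (Cx R) :=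
  [set z | `|z| < rc r].

Definition closed_disc (R : realType) (r : R) : set (Cx R) :=
  [set z | `|z| <= rc r].

(* The norm that MathComp-Analysis puts on row vectors is the sup norm. *)
Definition eucl_norm (R : realType) (n : nat) (v : 'rV[Cx R]_n) : Cx R :=
  sqrtC (\sum_(j < n) `|v ord0 j| ^+ 2).

Definition closed_polydisc (R : realType) (n : nat) (r r1 : R) :
    set (Cx R * Cx R * 'rV[Cx R]_n) :=
  [set p : Cx R * Cx R * 'rV[Cx R]_n |
   [/\ closed_disc r p.1.1, closed_disc r1 p.1.2
      & forall j, closed_disc r (p.2 ord0 j)]].

(* The scalar field of V and W is Cx R, so this is complex (Frechet)
   differentiability. *)
Definition holomorphic_on (R : realType) (V W : normedModType (Cx R))
    (U : set V) (f : V -> W) : Prop :=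
  open U /\ forall x, U x -> differentiable f x.

Definition holomorphic_near (R : realType) (V W : normedModType (Cx R))
    (K : set V) (f : V -> W) : Prop :=
  exists U : set V, K `<=` U /\ holomorphic_on U f.

(* phi is the argument of lambda (nonzero) that lies in ]theta-pi, theta+pi]. *)
Definition is_arg_around (R : realType) (theta : R) (lambda : Cx R) (phi : R)
    : Prop :=
  [/\ theta - pi < phi, phi <= theta + pi
    & lambda = `|lambda| * ((cos phi +i* sin phi)%C : Cx R)].

(* 'd f p acts on row vectors by v |-> v *m jacobian f p, so this is the
   transpose of the matrix whose (i, j) entry is the derivative of F_i with
   respect to f_j; `eigenvalue` is likewise about row vectors v with
   v *m J = lambda *: v, i.e. 'd f p v = lambda *: v. *)
Definition jacobian_f (R : realType) (n : nat)
    (F : Cx R * Cx R * 'rV[Cx R]_n -> 'rV[Cx R]_n)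
    (e z : Cx R) (f : 'rV[Cx R]_n) : 'M[Cx R]_n :=
  jacobian (fun g => F (e, z, g)) f.

(* Coefficient of e^i in the expansion of F (e, z, \sum_k e^k a_k(z)) in powers
   of e. The terms with k > i contribute only O(e^(i+1)), so the formal series
   may be truncated after e^i; the function of e that remains is holomorphic
   near 0 as soon as (0, z, a_0(z)) is inside the domain of F, and its i-th
   Taylor coefficient is taken. *)
Definition coef_comp (R : realType) (n : nat)
    (F : Cx R * Cx R * 'rV[Cx R]_n -> 'rV[Cx R]_n)
    (a : nat -> Cx R -> 'rV[Cx R]_n) (i : nat) (z : Cx R) : 'rV[Cx R]_n :=
  (i`!%:R)^-1 *:
    derive1n i (fun e : Cx R => F (e, z, \sum_(k < i.+1) e ^+ k *: a k z)) 0.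

(* Coefficient of e^i in e z (d/dz) \sum_k e^k a_k(z). *)
Definition coef_lhs (R : realType) (n : nat)
    (a : nat -> Cx R -> 'rV[Cx R]_n) (i : nat) (z : Cx R) : 'rV[Cx R]_n :=
  if i is k.+1 then z *: derive1 (a k) z else 0.

(* The neighbourhood of z = 0 on which the coefficients agree may depend on i. *)
Definition formal_solution (R : realType) (n : nat)
    (F : Cx R * Cx R * 'rV[Cx R]_n -> 'rV[Cx R]_n)
    (a : nat -> Cx R -> 'rV[Cx R]_n) : Prop :=
  forall i : nat, \forall z \near (0 : Cx R), coef_lhs a i z = coef_comp F a i z.

Definition gevrey1_bound (R : realType) (n : nat) (sigma : R)
    (a : nat -> Cx R -> 'rV[Cx R]_n) : Prop :=
  exists C mu : R, [/\ 0 < C, 0 < mu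
    & forall (i : nat) (z : Cx R), closed_disc sigma z ->
        eucl_norm (a i z) <= rc (C * i`!%:R * mu ^+ i)].

(* (O(sigma)[[e]]_1)^n *)
Definition gevrey1_series (R : realType) (n : nat) (sigma : R)
    (a : nat -> Cx R -> 'rV[Cx R]_n) : Prop :=
  (forall i, holomorphic_on (disc sigma) (a i) /\
             {within closed_disc sigma, continuous (a i)}) /\
  gevrey1_bound sigma a.

(* Main.v *)
Require Import Defs.
From mathcomp Require Import ring lra zify.
Import Order.TTheory GRing.Theory Num.Theory numFieldNormedType.Exports.
Local Open Scope classical_set_scope.
Local Open Scope ring_scope.
Set Implicit Arguments.
Unset Strict Implicit.
Unset Printing Implicit Defensive.

(** Write [F(e,z,f) = f A + G(e,z,f)], where every term of [G] has weight at
    least 2 when [e] and [z] have weight 2 and [f] has weight 1, and let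
    [a_(i,m)] be the coefficient of [e^i z^m] in the formal solution.  The
    equation reads [m a_(i-1,m) = a_(i,m) A + G_(i,m)], where [G_(i,m)] involves
    only coefficients of smaller total degree.  On double series consider the
    l^1 norm with weights [lam^m (cc / max(m,1))^i].  It is submultiplicative and
    [e z d/dz] is bounded by [cc] for it, so for small [lam] and [cc] an
    induction on the total degree bounds the norms of all truncations of the
    solution.  Hence [|a_(i,m)| <= C lam^-m (max(m,1) / cc)^i], and
    [m^i <= i! 2^(i+m)] turns this into convergence in [z] on a disc independent
    of [i], with the Gevrey bound.

    Taylor expansions are derived from mere complex differentiability.  Goursat's
    bisection is carried out on dyadic midpoint sums, and a contour integral is
    an ultralimit of such sums: it is defined, linear and bounded on all bounded
    functions, so that integrals can be iterated without any regularity. *)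

(** * Complex absolute value as a real number *)

(** The factor [m] in [m a_(i-1,m)] is what can make the series diverge: each passage from [e^(i-1)]
    to [e^i] may multiply the coefficient of [z^m] by a multiple of [m]. No disc in [z] is available
    beforehand either, since the neighbourhoods on which the [a_i] and the equations live may shrink
    with [i]. So the functions are replaced by their double sequence of Taylor coefficients, which
    is estimated and then summed again; the sums are the continuations of the [a_i].

    The weights 2, 2, 1 reflect the scaling [e, z ~ r s^2] and [f ~ r s]: a monomial of weight [w]
    then has size about [s^w]. Hence [G] is [O(s^2)], which for small [s] is below the size [r s]
    claimed for the solution, and the induction closes. No infinite double series is formed: bounds
    are proved on square truncations, uniformly in their size.

    Moduli are taken in [R], where the order is total. *)

Definition cabs (R : realType) (z : Cx R) : R := complex.Re (`|z| : R[i]).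

Section cabs.
Variable R : realType.
Implicit Types z w : Cx R.

Lemma normE z : `|z| = rc (cabs z).
Proof. by rewrite /cabs normc_def. Qed.

Lemma rc_le (x y : R) : (rc x <= rc y) = (x <= y).
Proof. by rewrite /rc lecR. Qed.

Lemma rc_lt (x y : R) : (rc x < rc y) = (x < y).
Proof. by rewrite /rc ltcR. Qed.

Lemma rcD (x y : R) : rc (x + y) = rc x + rc y.
Proof. exact: (rmorphD (real_complex R)). Qed.
Lemma rcM (x y : R) : rc (x * y) = rc x * rc y.
Proof. exact: (rmorphM (real_complex R)). Qed.
Lemma rc_inj : injective (@rc R).
Proof. exact: complexI. Qed.
Lemma rc0 : rc (0:R) = 0. Proof. by []. Qed.
Lemma rc1 : rc (1:R) = 1. Proof. by []. Qed.
Lemma rcn n : rc (n%:R : R) = n%:R.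
Proof. exact: (rmorph_nat (real_complex R)). Qed.
Lemma rcV (x : R) : rc (x^-1) = (rc x)^-1.
Proof. exact: (fmorphV (real_complex R)). Qed.

Lemma cabs_le z x : (`|z| <= rc x) = (cabs z <= x).
Proof. by rewrite normE rc_le. Qed.
Lemma cabs_ge0 z : 0 <= cabs z.
Proof. by rewrite -rc_le -normE rc0. Qed.
Lemma cabsD z w : cabs (z + w) <= cabs z + cabs w.
Proof. by rewrite -cabs_le rcD -!normE ler_normD. Qed.
Lemma cabsM z w : cabs (z * w) = cabs z * cabs w.
Proof. by apply: rc_inj; rewrite rcM -!normE normrM. Qed.
Lemma cabsN z : cabs (- z) = cabs z.
Proof. by apply: rc_inj; rewrite -!normE normrN. Qed.
Lemma cabsC z w : cabs (z - w) = cabs (w - z).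
Proof. by rewrite -cabsN opprB. Qed.
Lemma cabsV z : cabs (z^-1) = (cabs z)^-1.
Proof. by apply: rc_inj; rewrite rcV -!normE normfV. Qed.
Lemma cabs0 : cabs (0 : Cx R) = 0.
Proof. by apply: rc_inj; rewrite -normE normr0. Qed.
Lemma cabs1 : cabs (1 : Cx R) = 1.
Proof. by apply: rc_inj; rewrite -normE normr1. Qed.
Lemma cabsX z n : cabs (z ^+ n) = cabs z ^+ n.
Proof. by elim: n => [|n IH]; rewrite ?expr0 ?cabs1 // !exprS cabsM IH. Qed.
Lemma cabs_eq0 z : (cabs z == 0) = (z == 0).
Proof. by rewrite -(inj_eq rc_inj) -normE normr_eq0. Qed.
Lemma cabs_gt0 z : (0 < cabs z) = (z != 0).
Proof. by rewrite lt_neqAle cabs_ge0 andbT eq_sym cabs_eq0. Qed.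
Lemma cabs_rc (x : R) : cabs (rc x) = `|x|.
Proof.
by apply: rc_inj; rewrite -normE /rc normc_def /= expr0n addr0 sqrtr_sqr.
Qed.
Lemma cabsn n : cabs (n%:R : Cx R) = n%:R.
Proof. by rewrite -rcn cabs_rc ger0_norm. Qed.
Lemma cabs_sum (I : Type) (r : seq I) (P : pred I) (F : I -> Cx R) :
  cabs (\sum_(i <- r | P i) F i) <= \sum_(i <- r | P i) cabs (F i).
Proof.
elim/big_rec2: _ => [|i x y _ h]; first by rewrite cabs0.
by apply: le_trans (cabsD _ _) _; rewrite lerD2l.
Qed.
Lemma cabs_prod (I : Type) (r : seq I) (P : pred I) (F : I -> Cx R) :
  cabs (\prod_(i <- r | P i) F i) = \prod_(i <- r | P i) cabs (F i).
Proof. exact: (big_morph _ cabsM cabs1). Qed.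
Lemma cabs_Re z : `|complex.Re (z : R[i])| <= cabs z.
Proof.
rewrite -rc_le -normE; case: z => x y.
by rewrite /rc normc_def lecR /= -sqrtr_sqr ler_wsqrtr // lerDl sqr_ge0.
Qed.
Lemma cabs_Im z : `|complex.Im (z : R[i])| <= cabs z.
Proof.
rewrite -rc_le -normE; case: z => x y.
by rewrite /rc normc_def lecR /= -sqrtr_sqr ler_wsqrtr // lerDr sqr_ge0.
Qed.
Definition imag_unit : Cx R := (0 +i* 1)%C.
Lemma cabs_imag_unit : cabs imag_unit = 1.
Proof.
by apply: rc_inj; rewrite -normE normc_def /= expr0n add0r expr1n sqrtr1.
Qed.
Lemma cxE z : z = rc (complex.Re (z:R[i])) + imag_unit * rc (complex.Im (z:R[i])).
Proof. by case: z => x y; apply/eqP; rewrite eq_complex /=; apply/andP; split; apply/eqP; lra. Qed.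
Lemma cabs_ReIm z : cabs z <= `|complex.Re (z : R[i])| + `|complex.Im (z : R[i])|.
Proof.
rewrite {1}(cxE z); apply: le_trans (cabsD _ _) _. by rewrite cabsM cabs_imag_unit mul1r !cabs_rc.
Qed.
End cabs.

(** * Limits along an ultrafilter *)

Lemma ultra_exists : exists U : set_system nat, UltraFilter U /\ \oo `<=` U.
Proof. exact: ultraFilterLemma. Qed.

(** Chosen once and for all, so that [ulim] is a function, linear on bounded sequences, which
    extends the usual limit. *)
Definition ultra : set_system nat := projT1 (cid ultra_exists).

#[global] Instance ultra_ultra : UltraFilter ultra.
Proof. by case: (projT2 (cid ultra_exists)). Qed.

Lemma ultra_eventually (P : nat -> Prop) n0 :
  (forall n, (n0 <= n)%N -> P n) -> ultra P.
Proof.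
move=> h; case: (projT2 (cid ultra_exists)) => _; apply.
by exists n0.
Qed.

Section ulim.
Variable R : realType.
Local Notation C := (Cx R).
Implicit Types u v : nat -> C.

(** The limit is the supremum of the [t] that lie below [u n] for almost all [n]; just above it the
    defining set fails, and its complement then belongs to the ultrafilter. *)
Lemma ultra_limR (u : nat -> R) B : (forall n, `|u n| <= B) ->
  exists l, forall e, 0 < e -> ultra [set n | `|u n - l| <= e].
Proof.
move=> uB; pose A := [set t : R | ultra [set n | t <= u n]].
have AB : A (- B).
  by apply: filterE => n /=; have := uB n; rewrite ler_norml => /andP[].
have Aub : ubound A B.
  move=> t /filter_ex[n /= tn]; apply: le_trans tn _.
  by have := uB n; rewrite ler_norml => /andP[].
have hA : has_sup A by split; [exists (- B)|exists B].
exists (sup A) => e e0.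
have h1 : ultra [set n | sup A - e <= u n].
  have [t At lt] := sup_adherent e0 hA.
  by apply: filterS At => n /= tn; apply: le_trans tn; exact: ltW.
have h2 : ultra [set n | u n <= sup A + e].
  have [//|h] := in_ultra_setVsetC [set n | u n <= sup A + e] ultra_ultra.
  have : A (sup A + e).
    by apply: filterS h => n /= /negP; rewrite -ltNge => /ltW.
  by move=> /(ub_le_sup (proj2 hA)); lra.
by apply: filterS (filterI h1 h2) => n /= [] ? ?; rewrite ler_norml; lra.
Qed.

Definition is_ulim u l := forall e : R, 0 < e -> ultra [set n | cabs (u n - l) <= e].

Definition bseq u := exists B, forall n, cabs (u n) <= B.

Lemma ulim_ex u : bseq u -> exists l, is_ulim u l.
Proof.
move=> [B uB].
have [n|a ha] := @ultra_limR (fun n => complex.Re (u n : R[i])) B.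
  exact: le_trans (cabs_Re _) (uB n).
have [n|b hb] := @ultra_limR (fun n => complex.Im (u n : R[i])) B.
  exact: le_trans (cabs_Im _) (uB n).
exists (a +i* b)%C => e e0.
have e2 : 0 < e / 2 by lra.
apply: filterS (filterI (ha _ e2) (hb _ e2)) => n /= [h1 h2].
apply: le_trans (cabs_ReIm _) _.
case: (u n) h1 h2 => x y /= h1 h2; lra.
Qed.

(** The default 0 concerns only unbounded sequences, by [ulim_ex]. *)
Definition ulim u : C := xget 0 [set l | is_ulim u l].

Lemma ulimP u : bseq u -> is_ulim u (ulim u).
Proof. by move=> /ulim_ex[l ul]; exact: (@xgetPex _ 0 [set l | is_ulim u l] (ex_intro _ l ul)). Qed.

Lemma is_ulim_unique u l l' : is_ulim u l -> is_ulim u l' -> l = l'.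
Proof.
move=> h h'; apply/eqP; rewrite -subr_eq0 -cabs_eq0 eq_le cabs_ge0 andbT.
apply/ler_addgt0Pl => e e0; rewrite addr0.
have e2 : 0 < e / 2 by lra.
have [n /= [h1 h2]] := filter_ex (filterI (h _ e2) (h' _ e2)).
have -> : l - l' = (l - u n) + (u n - l') by ring.
apply: le_trans (cabsD _ _) _; rewrite (cabsC l); lra.
Qed.

Lemma is_ulimE u l : is_ulim u l -> ulim u = l.
Proof.
move=> h; have : is_ulim u (ulim u) by exact: (@xgetPex _ 0 [set l | is_ulim u l] (ex_intro _ l h)).
by move=> h'; exact: is_ulim_unique h' h.
Qed.

Lemma bseqD u v : bseq u -> bseq v -> bseq (fun n => u n + v n).
Proof.
move=> [B h] [B' h']; exists (B + B') => n.
by apply: le_trans (cabsD _ _) _; rewrite lerD.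
Qed.

Lemma bseqZ k u : bseq u -> bseq (fun n => k * u n).
Proof.
by move=> [B h]; exists (cabs k * B) => n; rewrite cabsM ler_wpM2l ?cabs_ge0.
Qed.

Lemma ulimD u v : bseq u -> bseq v ->
  ulim (fun n => u n + v n) = ulim u + ulim v.
Proof.
move=> /ulimP hu /ulimP hv; apply: is_ulimE => e e0.
have e2 : 0 < e / 2 by lra.
apply: filterS (filterI (hu _ e2) (hv _ e2)) => n /= [h1 h2].
rewrite opprD addrACA; apply: le_trans (cabsD _ _) _; lra.
Qed.

Lemma ulimZ k u : bseq u -> ulim (fun n => k * u n) = k * ulim u.
Proof.
move=> /ulimP hu; apply: is_ulimE => e e0.
have k0 : 0 < cabs k + 1 by have := cabs_ge0 k; lra.
have e2 : 0 < e / (cabs k + 1) by rewrite divr_gt0.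
apply: filterS (hu _ e2) => n /= h.
rewrite -mulrBr cabsM.
have h' : (cabs k + 1) * cabs (u n - ulim u) <= e by rewrite mulrC -ler_pdivlMr.
apply: le_trans h'; rewrite ler_wpM2r ?cabs_ge0 //; lra.
Qed.

Lemma ulim_bound u B : (forall n, cabs (u n) <= B) -> cabs (ulim u) <= B.
Proof.
move=> uB; have /ulimP hu : bseq u by exists B.
apply/ler_addgt0Pl => e e0.
have [n /= h] := filter_ex (hu _ e0).
have -> : ulim u = u n - (u n - ulim u) by ring.
by apply: le_trans (cabsD _ _) _; rewrite cabsN; have := uB n; lra.
Qed.

Lemma ulim_cvg u l : (forall e, 0 < e -> exists n0, forall n, (n0 <= n)%N ->
  cabs (u n - l) <= e) -> ulim u = l.
Proof.
move=> h; apply: is_ulimE => e e0; have [n0 hn0] := h e e0.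
exact: (@ultra_eventually _ n0).
Qed.
End ulim.

(** * Goursat's lemma for midpoint sums *)

Section goursat.
Variable R : realType.
Local Notation C := (Cx R).
Implicit Types (phi psi : C -> C) (a b z w : C).

Lemma half_pow_lt (s d : R) : 0 < d -> exists k, s / 2 ^+ k < d.
Proof.
move=> d0; have [k hk] : exists k : nat, s / d < k%:R.
  by exists (Num.truncn (s / d)).+1; exact: Num.Theory.truncnS_gt.
exists k; rewrite ltr_pdivrMr ?exprn_gt0 // mulrC -ltr_pdivrMr //.
apply: lt_le_trans hk _; rewrite -natrX ler_nat; apply: ltnW; exact: ltn_expl.
Qed.

Definition mid a b : C := (a + b) / 2%:R.

(** The midpoint Riemann sum over [2^n] equal pieces. Recursion by bisection makes additivity under
    subdivision hold by definition, at each finite level. *)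
Fixpoint seg n phi a b : C :=
  if n is n'.+1 then seg n' phi a (mid a b) + seg n' phi (mid a b) b
  else (b - a) * phi (mid a b).

Lemma midC a b : mid a b = mid b a.
Proof. by rewrite /mid addrC. Qed.

Lemma segD n phi psi a b :
  seg n (fun z => phi z + psi z) a b = seg n phi a b + seg n psi a b.
Proof. by elim: n a b => [|n IH] a b /=; rewrite ?IH; ring. Qed.

Lemma segZ n k phi a b : seg n (fun z => k * phi z) a b = k * seg n phi a b.
Proof. by elim: n a b => [|n IH] a b /=; rewrite ?IH; ring. Qed.

Lemma segN n phi a b : seg n phi b a = - seg n phi a b.
Proof.
elim: n a b => [|n IH] a b /=; first by rewrite midC; ring.
by rewrite (midC b a) (IH a (mid a b)) (IH (mid a b) b); ring.
Qed.

(** The midpoint rule is exact on affine functions, so their sums around a closed contour vanish at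
    every level, not just in the limit. *)
Lemma seg_affine n (k l : C) a b :
  seg n (fun z => k + l * z) a b = k * (b - a) + l * (b ^+ 2 - a ^+ 2) / 2%:R.
Proof. by elim: n a b => [|n IH] a b /=; rewrite ?IH /mid; field. Qed.

(** Closure of [D] under midpoints is enough, because every sample point is an iterated midpoint of
    the ends. *)
Lemma seg_bound (D : set C) n phi a b (B : R) :
  (forall z w, D z -> D w -> D (mid z w)) -> D a -> D b ->
  (forall z, D z -> cabs (phi z) <= B) -> cabs (seg n phi a b) <= cabs (b - a) * B.
Proof.
move=> Dm + + hB; elim: n a b => [|n IH] a b Da Db /=.
  by rewrite cabsM ler_wpM2l ?cabs_ge0 // hB //; exact: Dm.
apply: le_trans (cabsD _ _) _.
have Dab := Dm _ _ Da Db.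
apply: le_trans (lerD (IH _ _ Da Dab) (IH _ _ Dab Db)) _.
have -> : mid a b - a = (b - a) / 2%:R by rewrite /mid; field.
have -> : b - mid a b = (b - a) / 2%:R by rewrite /mid; field.
rewrite cabsM cabsV cabsn -mulrDl; set c := cabs _.
by have -> : c / 2 + c / 2 = c by field.
Qed.

Definition pt (x y : R) : C := (x +i* y)%C.

Lemma pt_mid x y x' y' : mid (pt x y) (pt x' y') = pt ((x + x') / 2) ((y + y') / 2).
Proof.
rewrite /mid; apply: (@mulIf _ (2%:R : C)); first by rewrite pnatr_eq0.
rewrite divfK ?pnatr_eq0 //.
rewrite -rcn /rc /pt; apply/eqP; rewrite eq_complex /=; apply/andP; split; apply/eqP; by field.
Qed.

(** The sum over the boundary, counterclockwise, of the square with lower left corner [(x, y)] and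
    side [s]. *)
Definition sq n phi (x y s : R) : C :=
  seg n phi (pt x y) (pt (x + s) y) + seg n phi (pt (x + s) y) (pt (x + s) (y + s))
  + seg n phi (pt (x + s) (y + s)) (pt x (y + s)) + seg n phi (pt x (y + s)) (pt x y).

Lemma sqD n phi psi x y s :
  sq n (fun z => phi z + psi z) x y s = sq n phi x y s + sq n psi x y s.
Proof. by rewrite /sq !segD; ring. Qed.

Lemma sqZ n k phi x y s : sq n (fun z => k * phi z) x y s = k * sq n phi x y s.
Proof. by rewrite /sq !segZ; ring. Qed.

Lemma sq_affine n (k l : C) x y s : sq n (fun z => k + l * z) x y s = 0.
Proof. by rewrite /sq !seg_affine; field. Qed.

(** Each inner edge is shared by two quarters and run through in opposite directions, so only the
    outer edges, bisected, remain. *)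
Lemma sq_split n phi x y s : sq n.+1 phi x y s =
  sq n phi x y (s / 2) + sq n phi (x + s / 2) y (s / 2)
  + sq n phi x (y + s / 2) (s / 2) + sq n phi (x + s / 2) (y + s / 2) (s / 2).
Proof.
have e1 (u : R) : (u + s + u) / 2 = u + s / 2 by field.
have e2 (u : R) : (u + (u + s)) / 2 = u + s / 2 by field.
have e3 (u : R) : u + s / 2 + s / 2 = u + s by field.
have e4 (u : R) : (u + u) / 2 = u by field.
rewrite /sq /= !pt_mid !(e1, e2, e3, e4).
rewrite (@segN n phi (pt (x + s / 2) y) (pt (x + s / 2) (y + s / 2))).
rewrite (@segN n phi (pt x (y + s / 2)) (pt (x + s / 2) (y + s / 2))).
rewrite (@segN n phi (pt (x + s / 2) (y + s / 2)) (pt (x + s / 2) (y + s))).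
rewrite (@segN n phi (pt (x + s / 2) (y + s / 2)) (pt (x + s) (y + s / 2))).
ring.
Qed.

Definition insq (x y s : R) z :=
  [/\ x <= complex.Re (z : R[i]), complex.Re (z : R[i]) <= x + s,
      y <= complex.Im (z : R[i]) & complex.Im (z : R[i]) <= y + s].

Lemma insq_mid x y s z w : insq x y s z -> insq x y s w -> insq x y s (mid z w).
Proof.
case: z w => a b [c d] [/= ? ? ? ?] [/= ? ? ? ?].
by rewrite -!/(pt _ _) pt_mid /pt; split => /=; lra.
Qed.

Lemma cabs_pt x y : cabs (pt x y) <= `|x| + `|y|.
Proof. exact: cabs_ReIm. Qed.

Lemma ptB x y x' y' : pt x y - pt x' y' = pt (x - x') (y - y').
Proof. by []. Qed.

Lemma sq_bound n phi x y s B : 0 <= s ->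
  (forall z, insq x y s z -> cabs (phi z) <= B) ->
  cabs (sq n phi x y s) <= 4 * s * B.
Proof.
move=> s0 hB.
have B0 : 0 <= B.
  by apply: le_trans (cabs_ge0 _) (hB (pt x y) _); split => /=; lra.
have hs z w : insq x y s z -> insq x y s w -> cabs (w - z) <= s ->
    cabs (seg n phi z w) <= s * B.
  move=> hz hw hd.
  apply: le_trans (@seg_bound (insq x y s) _ _ _ _ _ (@insq_mid x y s) hz hw hB) _.
  by rewrite ler_wpM2r.
have -> : 4 * s * B = s * B + s * B + s * B + s * B by ring.
have au (u v : R) : u = s \/ u = - s -> v = 0 -> `|u| + `|v| <= s.
  by move=> h ->; rewrite normr0 addr0; case: h => ->; rewrite ?normrN ger0_norm.
rewrite /sq; do 3?[apply: le_trans (cabsD _ _) _; apply: lerD];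
  apply: hs; try (by split => /=; lra); rewrite ptB;
  apply: le_trans (cabs_pt _ _) _; try (by apply: au; [left; ring|ring]);
  try (by apply: au; [right; ring|ring]); rewrite addrC;
  try (by apply: au; [left; ring|ring]); by apply: au; [right; ring|ring].
Qed.
End goursat.

(** * Goursat's bisection with one exceptional point *)

Section bisection.
Variable R : realType.
Local Notation C := (Cx R).
Implicit Types (phi psi : C -> C) (a b z w : C).

(** Complex differentiability with real epsilon and delta, the form in which the estimates below use
    and produce it. *)
Definition cderiv phi z d := forall e : R, 0 < e -> exists2 del : R, 0 < del &
  forall w, cabs (w - z) < del -> cabs (phi w - phi z - d * (w - z)) <= e * cabs (w - z).

Definition cdiff phi z := exists d, cderiv phi z d.

Lemma nested_intervals (lo hi : nat -> R) :
  (forall n, lo n <= lo n.+1) -> (forall n, hi n.+1 <= hi n) ->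
  (forall n, lo n <= hi n) -> exists X, forall n, lo n <= X <= hi n.
Proof.
move=> hlo hhi hlh.
have mlo m n : (m <= n)%N -> lo m <= lo n.
  by move=> /subnK <-; elim: (n - m)%N => // k IH; rewrite addSn; exact: le_trans IH _.
have mhi m n : (m <= n)%N -> hi n <= hi m.
  by move=> /subnK <-; elim: (n - m)%N => // k IH; rewrite addSn; exact: le_trans IH.
have lohi m n : lo m <= hi n.
  have := hlh (maxn m n); have := mlo _ _ (leq_maxl m n); have := mhi _ _ (leq_maxr m n).
  lra.
have hs : has_sup (range lo).
  split; first by exists (lo 0%N), 0%N.
  by exists (hi 0%N) => _ [n _ <-].
exists (sup (range lo)) => n; apply/andP; split.
  by apply: (ub_le_sup (proj2 hs)); exists n.
by apply: ge_sup => [|_ [m _ <-] //]; exact: (proj1 hs).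
Qed.

(* Additive under subdivision of intervals, and positive as soon as the closed
   interval contains x: it counts the two one-sided germs at x. *)
Definition germs (x a b : R) : R := (a <= x < b)%R%:R + (a < x <= b)%R%:R.

Lemma germs_split (x a m b : R) : a <= m -> m <= b -> germs x a b = germs x a m + germs x m b.
Proof.
rewrite /germs => am mb.
case: (ltrgtP x a) => xa; case: (ltrgtP x m) => xm; case: (ltrgtP x b) => xb //=; try lra.
all: by rewrite ?addr0 ?add0r.
Qed.

Lemma germs_ge0 (x a b : R) : 0 <= germs x a b.
Proof. by rewrite addr_ge0. Qed.

Lemma germs_ge1 (x a b : R) : a < b -> a <= x <= b -> 1 <= germs x a b.
Proof.
rewrite /germs => ab.
case: (ltrgtP x a) => xa; case: (ltrgtP x b) => xb //=; try lra.
Qed.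

Section fixed.
Variables (phi : C -> C) (p : C) (B e : R).
Hypothesis e0 : 0 < e.

(* The exceptional point p contributes a term that does not shrink with the
   square, which absorbs the crude bound available near p. *)
Definition mu (x y s : R) : R := s ^+ 2 +
  germs (complex.Re (p : R[i])) x (x + s) * germs (complex.Im (p : R[i])) y (y + s).

(** A state is a corner and a side. The bound is asked from some level on, since different squares
    may need different levels. *)
Definition good (st : R * R * R) := let: (x, y, s) := st in
  exists n0, forall n, (n0 <= n)%N -> cabs (sq n phi x y s) <= e * mu x y s.

(** The area is additive, and so is the product of two quantities that are additive each in its own
    variable. *)
Lemma mu_split x y s : 0 < s -> mu x y s =
  mu x y (s / 2) + mu (x + s / 2) y (s / 2) + mu x (y + s / 2) (s / 2)
  + mu (x + s / 2) (y + s / 2) (s / 2).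
Proof.
move=> s0; rewrite /mu.
have h u : u + s = u + s / 2 + s / 2 by field.
rewrite (@germs_split _ x (x + s / 2) (x + s)) ?(@germs_split _ y (y + s / 2) (y + s)); try lra.
rewrite (h x) (h y); set a := germs _ _ _; set b := germs _ _ _;
set c := germs _ _ _; set d := germs _ _ _. by field.
Qed.

Definition child (st st' : R * R * R) :=
  [/\ st.1.1 <= st'.1.1, st'.1.1 + st'.2 <= st.1.1 + st.2,
      st.1.2 <= st'.1.2, st'.1.2 + st'.2 <= st.1.2 + st.2 & st'.2 = st.2 / 2].

Lemma bad_child st : 0 < st.2 -> ~ good st -> exists2 st', child st st' & ~ good st'.
Proof.
case: st => [[x y] s] /= s0 bad; apply: contrapT => h; apply: bad.
have gd st' : child (x, y, s) st' -> good st'.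
  by move=> hc; apply: contrapT => hb; apply: h; exists st'.
have [n1 h1] : good (x, y, s / 2) by apply: gd; split => /=; lra.
have [n2 h2] : good (x + s / 2, y, s / 2) by apply: gd; split => /=; lra.
have [n3 h3] : good (x, y + s / 2, s / 2) by apply: gd; split => /=; lra.
have [n4 h4] : good (x + s / 2, y + s / 2, s / 2) by apply: gd; split => /=; lra.
(* One level more than the four quarters need, since [sq_split] lowers the level by one. *)
exists (maxn (maxn n1 n2) (maxn n3 n4)).+1 => -[//|n].
rewrite ltnS !geq_max => /andP[/andP[m1 m2] /andP[m3 m4]].
rewrite sq_split mu_split // 3!(mulrDr e).
apply: le_trans (cabsD _ _) _; apply: lerD (h4 _ m4).
apply: le_trans (cabsD _ _) _; apply: lerD (h3 _ m3).
by apply: le_trans (cabsD _ _) _; apply: lerD (h1 _ m1) (h2 _ m2).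
Qed.

Definition next st := xget st [set st' | child st st' /\ ~ good st'].

Lemma nextP st : 0 < st.2 -> ~ good st -> child st (next st) /\ ~ good (next st).
Proof.
move=> s0 /(bad_child s0)[st' h1 h2].
exact: (@xgetPex _ st [set st' | child st st' /\ ~ good st'] (ex_intro _ st' (conj h1 h2))).
Qed.

(** Bad squares would be nested and shrink to a point [q]; at [q], either differentiability or, if
    [q = p], the positive mass of [p] in [mu] makes a small square good. *)
Lemma goursat_mu x0 y0 s0 : 0 < s0 ->
  (forall z, insq x0 y0 s0 z -> z <> p -> cdiff phi z) ->
  (forall z, insq x0 y0 s0 z -> cabs (phi z) <= B) -> good (x0, y0, s0).
Proof.
move=> s0gt0 hd hB; apply: contrapT => bad.
pose st n := iter n next (x0, y0, s0).
have inv n : [/\ 0 < (st n).2, (st n).2 = s0 / 2 ^+ n & ~ good (st n)].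
  elim: n => [|n [IH1 IH2 IH3]]; first by split => //=; rewrite expr0 divr1.
  have [[_ _ _ _ h] hb] := nextP IH1 IH3.
  rewrite /st iterS -/(st n) h; split => //; first lra.
  by rewrite IH2 exprSr invfM mulrA.
have ch n : child (st n) (st n.+1).
  by have [h1 h2 h3] := inv n; have [] := nextP h1 h3.
have [X hX] : exists X, forall n, (st n).1.1 <= X <= (st n).1.1 + (st n).2.
  apply: nested_intervals => n; [by have [] := ch n| by have [] := ch n|].
  by have [] := inv n; lra.
have [Y hY] : exists X, forall n, (st n).1.2 <= X <= (st n).1.2 + (st n).2.
  apply: nested_intervals => n; [by have [] := ch n| by have [] := ch n|].
  by have [] := inv n; lra.
have sub n z : insq (st n).1.1 (st n).1.2 (st n).2 z -> insq x0 y0 s0 z.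
  elim: n => [//|n IH] [*]; apply: IH; have [*] := ch n; split; lra.
pose q := pt X Y.
have inq n : insq (st n).1.1 (st n).1.2 (st n).2 q.
  by have /andP[*] := hX n; have /andP[*] := hY n; split.
have diam n z : insq (st n).1.1 (st n).1.2 (st n).2 z -> cabs (z - q) <= 2 * (st n).2.
  have [q1 q2 q3 q4] := inq n; case: z => u v [z1 z2 z3 z4].
  rewrite /= in q1 q2 q3 q4 z1 z2 z3 z4.
  apply: le_trans (cabs_pt _ _) _.
  have : `|u - X| <= (st n).2 by rewrite ler_norml; lra.
  have : `|v - Y| <= (st n).2 by rewrite ler_norml; lra.
  by rewrite /=; lra.
have [qp|qp] := pselect (q = p).
  have B0 : 0 <= B by apply: le_trans (cabs_ge0 _) (hB q (inq 0%N)).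
  (* At [p] the crude bound [4 s B] is used; a side below [e / (4 (B + 1))] makes it at most [e],
     and [mu] is at least 1. *)
  have [|k hk] := @half_pow_lt R s0 (e / (4 * (B + 1))).
    by rewrite divr_gt0 // mulr_gt0 //; lra.
  have [s1 s2 hb] := inv k; move: hk; rewrite -s2 ltr_pdivlMr; last lra.
  move=> hk; apply: hb; have := inq k; have := @sub k; move: s1 hk.
  case: (st k) => [[x y] s] /= s1 hk hsub [i1 i2 i3 i4]; exists 0%N => n _.
  apply: (@le_trans _ _ (4 * s * B)).
    by apply: sq_bound => [|z hz]; [lra|apply: hB; exact: hsub].
  apply: (@le_trans _ _ e); first by nra.
  rewrite ler_peMr ?(ltW e0) // /mu -qp /=.
  rewrite /= in i1 i2 i3 i4.
  have g1 : 1 <= germs X x (x + s) by apply: germs_ge1; lra.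
  have g2 : 1 <= germs Y y (y + s) by apply: germs_ge1; lra.
  nra.
have [d hdq] := hd q (inq 0%N) qp.
(* The 8 absorbs the perimeter [4 s] and the bound [2 s] for the distance to [q], leaving
   [e s^2]. *)
have e8 : 0 < e / 8 by rewrite divr_gt0.
have [del del0 hdel] := hdq _ e8.
have [|k hk] := @half_pow_lt R s0 (del / 2); first lra.
have [s1 s2 hb] := inv k; move: hk; rewrite -s2 => hk; apply: hb.
move: (@diam k) s1 hk; case: (st k) => [[x y] s] /= hdiam s1 hk; exists 0%N => n _.
(* Subtracting the affine part at [q] changes no sum, by [sq_affine], and leaves a remainder that is
   small against the side. *)
pose err z := phi z + (- (phi q - d * q) + - d * z).
have -> : sq n phi x y s = sq n err x y s.
  by rewrite /err sqD sq_affine addr0.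
apply: (@le_trans _ _ (4 * s * (e / 8 * (2 * s)))).
  apply: sq_bound => [|z hz]; first lra.
  have -> : err z = phi z - phi q - d * (z - q) by rewrite /err; ring.
  have hz2 := hdiam z hz.
  apply: le_trans (hdel z _) _; first lra.
  by rewrite ler_wpM2l //; lra.
have -> : 4 * s * (e / 8 * (2 * s)) = e * s ^+ 2 by field.
rewrite ler_wpM2l ?(ltW e0) // /mu lerDl mulr_ge0 ?germs_ge0 //.
Qed.
End fixed.

Lemma goursat phi p B x y s : 0 < s ->
  (forall z, insq x y s z -> z <> p -> cdiff phi z) ->
  (forall z, insq x y s z -> cabs (phi z) <= B) ->
  forall e, 0 < e -> exists n0, forall n, (n0 <= n)%N -> cabs (sq n phi x y s) <= e.
Proof.
move=> s0 hd hB e e0.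
have m0 : 0 < mu p x y s by rewrite ltr_pwDl ?exprn_gt0 // mulr_ge0 ?germs_ge0.
have em : 0 < e / mu p x y s by rewrite divr_gt0.
have [n0 hn] := goursat_mu em s0 hd hB.
by exists n0 => n /hn; rewrite divfK ?gt_eqF.
Qed.
End bisection.

(** * Contour integrals and Cauchy's formula *)

Section contour.
Variable R : realType.
Local Notation C := (Cx R).
Implicit Types (phi psi g : C -> C) (a b z w x y : C).

Lemma pos_rc (e : C) : 0 < e -> e = rc (cabs e).
Proof. by move=> e0; rewrite -normE gtr0_norm. Qed.

Lemma nbhs_cabs (z : C) (P : C -> Prop) :
  (\forall w \near z, P w) <-> exists2 del : R, 0 < del & forall w, cabs (w - z) < del -> P w.
Proof.
split.
  move=> /nbhs_ballP[d /= d0 dP]; exists (cabs d); first by rewrite cabs_gt0 gt_eqF.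
  move=> w; rewrite -rc_lt -normE -pos_rc // => wd; apply: dP.
  by rewrite -ball_normE /= distrC.
move=> [d d0 dP]; apply/nbhs_ballP; exists (rc d) => /=; first by rewrite -rc0 rc_lt.
by move=> w; rewrite -ball_normE /= distrC normE rc_lt => /dP.
Qed.

Lemma diff_cderiv phi z : differentiable phi z -> cderiv phi z (derive1 phi z).
Proof.
move=> /derivable1_diffP /derivable_nbhs /eqaddoP h e e0.
have e0' : 0 < rc e by rewrite -(rc0 R) rc_lt.
have /nbhs_cabs[del del0 hdel] := h _ e0'.
exists del => // w wz; have := hdel (w - z); rewrite subr0 => /(_ wz).
rewrite -rc_le rcM -!normE derive1E /=.
rewrite -![(_ + _ : _ -> _) _]/(_ + _) -![(- _ : _ -> _) _]/(- _) /=.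
by rewrite /cst opprD addrA [_%:A]mulr1 subrK [_ *: _]mulrC.
Qed.

Lemma cderiv_derive phi z d : cderiv phi z d -> is_derive z 1 phi d.
Proof.
move=> h.
have H : (fun h : C => h^-1 *: ((phi \o shift z) (h *: (1 : C)) - phi z)) @ (0 : C)^' --> d.
  apply/cvgrPdist_le => e e0; rewrite (pos_rc e0).
  have e0' : 0 < cabs e by rewrite cabs_gt0 gt_eqF.
  have [del del0 hdel] := h _ e0'.
  rewrite /dnbhs near_withinE; apply/nbhs_cabs; exists del => // w; rewrite subr0 => wd w0.
  rewrite normE rc_le /= [_%:A]mulr1 [_ *: _]mulrC.
  have := hdel (w + z); rewrite addrK => /(_ wd).
  rewrite -ler_pdivrMr ?cabs_gt0 // -cabsV -cabsM mulrBl mulfK //.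
  by rewrite cabsC.
split; first by apply/cvg_ex; exists d.
exact: cvg_lim.
Qed.

Lemma cderiv_diff phi z d : cderiv phi z d -> differentiable phi z.
Proof. by move=> /cderiv_derive[? _]; apply/derivable1_diffP. Qed.

Lemma cderiv_derive1 phi z d : cderiv phi z d -> derive1 phi z = d.
Proof. by move=> /cderiv_derive[_ h]; rewrite derive1E. Qed.

(* A second order estimate is a convenient way to produce derivatives, as it
   survives the passage to (ultra)limits. *)
Lemma quad_cderiv phi z d (r K : R) : 0 < r ->
  (forall w, cabs (w - z) < r -> cabs (phi w - phi z - d * (w - z)) <= K * cabs (w - z) ^+ 2) ->
  cderiv phi z d.
Proof.
move=> r0 h e e0.
have K0 : 0 < `|K| + 1 by rewrite ltr_pwDr.
exists (Num.min r (e / (`|K| + 1))); first by rewrite lt_min r0 divr_gt0.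
move=> w; rewrite lt_min => /andP[wr]; rewrite ltr_pdivlMr // => we.
apply: le_trans (h w wr) _; rewrite expr2 mulrA ler_wpM2r ?cabs_ge0 //.
apply: le_trans (ltW we); rewrite mulrC ler_wpM2l ?cabs_ge0 //.
by have := ler_norm K; lra.
Qed.

(** An annulus that contains the boundary of the square of half side [s] centred at 0, so that
    integrands need to be controlled only there. *)
Definition ann (s : R) z := s <= cabs z <= 2 * s.
Definition bd (s : R) phi := exists B, forall z, ann s z -> cabs (phi z) <= B.

Definition cint_approx (s : R) phi n := sq n phi (- s) (- s) (s + s).
Definition cint (s : R) phi : C := ulim (cint_approx s phi).

Lemma ann_side (s u v : R) : 0 < s -> `|u| <= s -> `|v| <= s -> `|u| = s \/ `|v| = s ->
  ann s (pt u v).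
Proof.
move=> s0 hu hv h; apply/andP; split; last by apply: le_trans (cabs_pt _ _) _; lra.
case: h => <-; [exact: (cabs_Re (pt u v))|exact: (cabs_Im (pt u v))].
Qed.

Lemma cint_approx_bound s phi n B : 0 < s -> (forall z, ann s z -> cabs (phi z) <= B) ->
  cabs (cint_approx s phi n) <= 8 * s * B.
Proof.
move=> s0 hB; rewrite /cint_approx /sq addrA.
have -> : - s + s = 0 by ring. rewrite add0r.
(* [D] describes one side of the square in real coordinates; each side has length [2 s], whence the
   total [8 s]. *)
have hs (D : R -> R -> Prop) u v u' v' : D u v -> D u' v' ->
  (forall u v u' v', D u v -> D u' v' -> D ((u + u') / 2) ((v + v') / 2)) ->
  (forall u v, D u v -> [/\ `|u| <= s, `|v| <= s & `|u| = s \/ `|v| = s]) ->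
  `|u' - u| + `|v' - v| <= 2 * s ->
  cabs (seg n phi (pt u v) (pt u' v')) <= 2 * s * B.
  move=> h1 h2 hm hD hu.
  have B0 : 0 <= B.
    apply: le_trans (cabs_ge0 _) (hB (pt u v) _); have [] := hD _ _ h1.
    by move=> *; apply: ann_side.
  apply: le_trans (@seg_bound _ (fun z => exists2 p, D p.1 p.2 & z = pt p.1 p.2) _ _ _ _ B _ _ _ _) _.
  - move=> _ _ [p hp ->] [q hq ->]; rewrite pt_mid.
    by exists ((p.1 + q.1) / 2, (p.2 + q.2) / 2) => //=; apply: hm.
  - by exists (u, v).
  - by exists (u', v').
  - by move=> _ [p hp ->]; apply: hB; have [*] := hD _ _ hp; apply: ann_side.
  rewrite ler_wpM2r // ptB; exact: le_trans (cabs_pt _ _) hu.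
have ns : `|s| = s by rewrite ger0_norm // ltW.
have nns : `|- s| = s by rewrite normrN.
have n2 : `|s - - s| = 2 * s by rewrite opprK ger0_norm; lra.
have n2' : `|- s - s| = 2 * s by rewrite -opprD normrN ger0_norm; lra.
have mm u v : - s <= u <= s -> - s <= v <= s -> - s <= (u + v) / 2 <= s by lra.
have -> : 8 * s * B = 2 * s * B + 2 * s * B + 2 * s * B + 2 * s * B by ring.
apply: le_trans (cabsD _ _) _; apply: lerD.
apply: le_trans (cabsD _ _) _; apply: lerD.
apply: le_trans (cabsD _ _) _; apply: lerD.
- apply: (hs (fun u v => - s <= u <= s /\ v = - s)).
  + by split=> //; lra.
  + by split=> //; lra.
  + by move=> u v u' v' [? ->] [? ->]; split; [exact: mm|field].
  + by move=> u v [? ->]; rewrite nns ler_norml; split => //; right.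
  + by rewrite n2 subrr normr0 addr0.
- apply: (hs (fun v u => - s <= u <= s /\ v = s)).
  + by split=> //; lra.
  + by split=> //; lra.
  + by move=> u v u' v' [? ->] [? ->]; split; [exact: mm|field].
  + by move=> u v [? ->]; rewrite ns ler_norml; split => //; left.
  + by rewrite n2 subrr normr0 add0r.
- apply: (hs (fun u v => - s <= u <= s /\ v = s)).
  + by split=> //; lra.
  + by split=> //; lra.
  + by move=> u v u' v' [? ->] [? ->]; split; [exact: mm|field].
  + by move=> u v [? ->]; rewrite ns ler_norml; split => //; right.
  + by rewrite n2' subrr normr0 addr0.
- apply: (hs (fun v u => - s <= u <= s /\ v = - s)).
  + by split=> //; lra.
  + by split=> //; lra.
  + by move=> u v u' v' [? ->] [? ->]; split; [exact: mm|field].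
  + by move=> u v [? ->]; rewrite nns ler_norml; split => //; left.
  + by rewrite n2' subrr normr0 add0r.
Qed.

Lemma bseq_cint_approx s phi : 0 < s -> bd s phi -> bseq (cint_approx s phi).
Proof. by move=> s0 [B hB]; exists (8 * s * B) => n; exact: cint_approx_bound. Qed.

Lemma cint_bound s phi B : 0 < s -> (forall z, ann s z -> cabs (phi z) <= B) ->
  cabs (cint s phi) <= 8 * s * B.
Proof. by move=> s0 hB; apply: ulim_bound => n; exact: cint_approx_bound. Qed.

Lemma cintD s phi psi : 0 < s -> bd s phi -> bd s psi ->
  cint s (fun z => phi z + psi z) = cint s phi + cint s psi.
Proof.
move=> s0 h1 h2; rewrite /cint -ulimD; try exact: bseq_cint_approx.
by congr ulim; apply: funext => n; rewrite /cint_approx sqD.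
Qed.

Lemma cintZ s k phi : 0 < s -> bd s phi -> cint s (fun z => k * phi z) = k * cint s phi.
Proof.
move=> s0 h1; rewrite /cint -ulimZ; try exact: bseq_cint_approx.
by congr ulim; apply: funext => n; rewrite /cint_approx sqZ.
Qed.

Lemma bdD s phi psi : bd s phi -> bd s psi -> bd s (fun z => phi z + psi z).
Proof.
move=> [B h] [B' h']; exists (B + B') => z hz.
by apply: le_trans (cabsD _ _) _; rewrite lerD ?h ?h'.
Qed.

Lemma bdM s phi psi : bd s phi -> bd s psi -> bd s (fun z => phi z * psi z).
Proof.
move=> [B h] [B' h']; exists (B * B') => z hz; rewrite cabsM.
by apply: ler_pM; rewrite ?cabs_ge0 ?h ?h'.
Qed.

Lemma bd_cst s k : bd s (fun=> k).
Proof. by exists (cabs k). Qed.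

Lemma bd_opp s phi : bd s phi -> bd s (fun z => - phi z).
Proof. by move=> [B h]; exists B => z hz; rewrite cabsN h. Qed.

Lemma bdX s phi n : bd s phi -> bd s (fun z => phi z ^+ n).
Proof.
move=> h; elim: n => [|n IH]; first by exists 1 => z _; rewrite expr0 cabs1.
have [B hB] := bdM h IH; exists B => z hz; rewrite exprS; exact: hB.
Qed.

Lemma bd_id s : bd s id.
Proof. by exists (2 * s) => z /andP[]. Qed.

Lemma bd_kernel s x : 0 < s -> cabs x <= s / 2 -> bd s (fun z => (z - x)^-1).
Proof.
move=> s0 xs; exists (2 / s) => z /andP[z1 z2]; rewrite cabsV -[leRHS]invrK invf_div.
have h : s / 2 <= cabs (z - x).
  have : cabs z <= cabs (z - x) + cabs x by rewrite -{1}(subrK x z) cabsD.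
  lra.
by rewrite lef_pV2 ?posrE //; lra.
Qed.

Lemma bd_inv s : 0 < s -> bd s (fun z => z^-1).
Proof.
move=> s0; have [|B hB] := @bd_kernel s 0 s0; first by rewrite cabs0; lra.
by exists B => z hz; have := hB z hz; rewrite subr0.
Qed.

(** The difference is bounded by 0 on the annulus, hence so is its integral. *)
Lemma cint_ext s phi psi : 0 < s -> bd s psi -> (forall z, ann s z -> phi z = psi z) ->
  cint s phi = cint s psi.
Proof.
move=> s0 hb h.
have h0 z : ann s z -> cabs (phi z + - psi z) <= 0 by move=> /h ->; rewrite subrr cabs0.
have -> : phi = (fun z => psi z + (phi z + - psi z)).
  by apply: funext => z; rewrite addrC subrK.
rewrite cintD //; last by exists 0.
have /eqP : cabs (cint s (fun z => phi z + - psi z)) == 0.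
  rewrite eq_le cabs_ge0 andbT; have := cint_bound s0 h0; by rewrite mulr0.
by move=> /eqP; rewrite cabs_eq0 => /eqP ->; rewrite addr0.
Qed.

Lemma cintB s phi psi : 0 < s -> bd s phi -> bd s psi ->
  cint s (fun z => phi z - psi z) = cint s phi - cint s psi.
Proof.
move=> s0 h1 h2; rewrite cintD //; last exact: bd_opp.
congr (_ + _); rewrite -mulN1r -cintZ //; congr (cint s _).
by apply: funext => z; rewrite mulN1r.
Qed.

Lemma bd_sum s (I : Type) (r : seq I) (P : pred I) (F : I -> C -> C) :
  (forall i, bd s (F i)) -> bd s (fun z => \sum_(i <- r | P i) F i z).
Proof.
move=> h; elim: r => [|i r IH].
  by exists 0 => z _; rewrite big_nil cabs0.
have [B hB] := IH; have [B' hB'] := h i; exists (`|B'| + B) => z hz.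
rewrite big_cons; have h1 := hB z hz; have h2 := hB' z hz; case: ifP => _.
  by apply: le_trans (cabsD _ _) _; have := ler_norm B'; lra.
by apply: le_trans h1 _; rewrite lerDr.
Qed.

Lemma cint_sum s (I : Type) (r : seq I) (P : pred I) (F : I -> C -> C) : 0 < s ->
  (forall i, bd s (F i)) ->
  cint s (fun z => \sum_(i <- r | P i) F i z) = \sum_(i <- r | P i) cint s (F i).
Proof.
move=> s0 h; elim: r => [|i r IH].
  have -> : (fun z => \sum_(i <- [::] | P i) F i z) = (fun z => 0 * 0).
    by apply: funext => z; rewrite big_nil mul0r.
  by rewrite cintZ ?mul0r ?big_nil //; exact: bd_cst.
rewrite big_cons; case: ifP => Pi; last first.
  by rewrite -IH; congr (cint s _); apply: funext => z; rewrite big_cons Pi.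
rewrite -IH -cintD //; last exact: bd_sum.
by congr (cint s _); apply: funext => z; rewrite big_cons Pi.
Qed.
End contour.

(** * The kernels [1/z] and [1/(z - x)^2], and the difference quotient *)

Section cauchy.
Variable R : realType.
Local Notation C := (Cx R).
Implicit Types (phi psi g : C -> C) (a b z w x y : C).

(** Invariance of [dz / z] under rotation by a right angle, which reduces the four sides of the
    square to one. *)
Lemma seg_inv_rot n a b : seg n GRing.inv (imag_unit R * a) (imag_unit R * b) = seg n (GRing.inv : C -> C) a b.
Proof.
have I0 : imag_unit R != 0 by rewrite -cabs_gt0 cabs_imag_unit.
elim: n a b => [|n IH] a b /=.
  have -> : mid (imag_unit R * a) (imag_unit R * b) = imag_unit R * mid a b by rewrite /mid mulrA -mulrDr.
  by rewrite -mulrBr invfM mulrACA mulfV // mul1r.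
have -> : mid (imag_unit R * a) (imag_unit R * b) = imag_unit R * mid a b by rewrite /mid mulrA -mulrDr.
by rewrite !IH.
Qed.

Lemma imag_unit_pt (u v : R) : imag_unit R * pt u v = pt (- v) u.
Proof. by apply/eqP; rewrite eq_complex /=; apply/andP; split; apply/eqP; ring. Qed.

(** At [z = t - i s] with [|t| <= s], the imaginary part of [1/z] is [s / (t^2 + s^2)], which is at
    least [1 / (2 s)]. *)
Lemma seg_inv_Im n (s u v : R) : 0 < s -> - s <= u -> u <= v -> v <= s ->
  (v - u) / (2 * s) <= complex.Im (seg n GRing.inv (pt u (- s)) (pt v (- s)) : R[i]).
Proof.
move=> s0; elim: n u v => [|n IH] u v us uv vs; rewrite [seg _ _ _ _]/= pt_mid.
  have -> : (- s + - s) / 2 = - s by field.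
  set m := (u + v) / 2; rewrite ptB /=.
  have ms : m ^+ 2 <= s ^+ 2 by rewrite /m; nra.
  have -> : (- s - - s) = 0 by ring.
  rewrite mul0r addr0 sqrrN mulNr opprK ler_wpM2l //; first lra.
  rewrite ler_pdivlMr; last by nra.
  rewrite mulrC ler_pdivrMr; last by lra.
  nra.
have -> : (- s + - s) / 2 = - s by field.
set m := (u + v) / 2.
rewrite -/m. have h1 := IH u m; have h2 := IH m v.
rewrite raddfD /=.
have -> : (v - u) / (2 * s) = (m - u) / (2 * s) + (v - m) / (2 * s) by rewrite -mulrDl; congr (_ / _); ring.
by rewrite lerD ?h1 ?h2 // /m; lra.
Qed.

Lemma cint_approx_inv_Im s n : 0 < s -> 4 <= complex.Im (cint_approx s GRing.inv n : R[i]).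
Proof.
move=> s0; rewrite /cint_approx /sq.
have -> : - s + (s + s) = s by ring.
set S := seg n _ (pt (- s) (- s)) _.
have rot (u v u' v' : R) : seg n GRing.inv (pt (- v) u) (pt (- v') u') = seg n GRing.inv (pt u v) (pt u' v').
  by rewrite -(seg_inv_rot n (pt u v)) !imag_unit_pt.
have e2 : seg n GRing.inv (pt s (- s)) (pt s s) = S.
  by have := rot (- s) (- s) s (- s); rewrite opprK.
have e3 : seg n GRing.inv (pt s s) (pt (- s) s) = S.
  by rewrite -e2; have := rot s (- s) s s; rewrite opprK.
have e4 : seg n GRing.inv (pt (- s) s) (pt (- s) (- s)) = S.
  by rewrite -e3; exact: (rot s s (- s) s).
rewrite e2 e3 e4 !raddfD /=.
have : 1 <= complex.Im (S : R[i]).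
  apply: le_trans (@seg_inv_Im n s (- s) s s0 _ _ _); try lra.
  by rewrite opprK ler_pdivlMr; lra.
lra.
Qed.

(** Plays the part of [2 pi i]. Its value is never computed: a lower bound on its modulus serves to
    divide by it. *)
Definition winding s : C := cint s GRing.inv.

Lemma winding_ge4 s : 0 < s -> 4 <= cabs (winding s).
Proof.
move=> s0; apply/ler_addgt0Pl => e e0.
have [n /= h] := filter_ex (ulimP (bseq_cint_approx s0 (bd_inv s0)) e0).
apply: le_trans (cint_approx_inv_Im n s0) _.
apply: le_trans (ler_norm _) _; apply: le_trans (cabs_Im _) _.
rewrite -(subrK (winding s) (cint_approx s _ n)); apply: le_trans (cabsD _ _) _.
by rewrite lerD2r.
Qed.

Lemma winding_neq0 s : 0 < s -> winding s != 0.
Proof. by move=> /winding_ge4 h; rewrite -cabs_gt0; lra. Qed.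

Lemma insq_disc s z : 0 < s -> insq (- s) (- s) (s + s) z -> cabs z <= 2 * s.
Proof.
move=> s0 [h1 h2 h3 h4]; apply: le_trans (cabs_ReIm z) _.
set u := complex.Re _ in h1 h2 *; set v := complex.Im _ in h3 h4 *.
have : `|u| <= s by rewrite ler_norml; lra.
have : `|v| <= s by rewrite ler_norml; lra.
lra.
Qed.

Lemma cint_goursat s phi p B : 0 < s ->
  (forall z, cabs z <= 2 * s -> z <> p -> differentiable phi z) ->
  (forall z, cabs z <= 2 * s -> cabs (phi z) <= B) -> cint s phi = 0.
Proof.
move=> s0 hd hB; apply: ulim_cvg => e e0.
have s2 : 0 < s + s by lra.
have h1 z : insq (- s) (- s) (s + s) z -> z <> p -> cdiff phi z.
  move=> /(insq_disc s0) hz zp; exists (derive1 phi z); apply: diff_cderiv; exact: hd.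
have h2 z : insq (- s) (- s) (s + s) z -> cabs (phi z) <= B.
  by move=> /(insq_disc s0); exact: hB.
have [n0 hn] := goursat s2 h1 h2 e0.
by exists n0 => n /hn; rewrite subr0.
Qed.

Lemma differentiable_kernel x z : z <> x -> differentiable (fun z : C => (z - x)^-1) z.
Proof.
move=> zx; apply: (@differentiableV _ _ (fun z : C => z - x)).
  by apply: differentiableB.
by rewrite subr_eq0; apply/eqP.
Qed.

(** The difference quotient is bounded, and differentiable except at [x]: this is why [goursat]
    admits an exceptional point. *)
Lemma cauchy_quotient s g x B : 0 < s -> cabs x <= 2 * s ->
  (forall z, cabs z <= 2 * s -> differentiable g z) ->
  (forall z, cabs z <= 2 * s -> cabs (g z) <= B) ->
  cint s (fun z => (g z - g x) * (z - x)^-1) = 0.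
Proof.
move=> s0 xs hd hB.
have [del del0 hdel] := diff_cderiv (hd x xs) ltr01.
have B0 : 0 <= B by apply: le_trans (cabs_ge0 _) (hB x xs).
(* [|g'(x)| + 1] bounds the quotient within [del] of [x], and [2 B / del] bounds it farther away; at
   [x] the numerator vanishes. *)
apply: (@cint_goursat _ _ x (2 * B / del + (cabs (derive1 g x) + 1)) s0).
  move=> z zs zx; apply: differentiableM; last exact: differentiable_kernel.
  by apply: differentiableB => //; exact: hd.
move=> z zs; rewrite cabsM cabsV.
have [->|zx] := eqVneq z x.
  by rewrite subrr cabs0 mul0r addr_ge0 ?addr_ge0 ?cabs_ge0 // divr_ge0 ?mulr_ge0 // ltW.
have zx0 : 0 < cabs (z - x) by rewrite cabs_gt0 subr_eq0.
rewrite ler_pdivrMr //.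
have [zd|zd] := ltP (cabs (z - x)) del.
  have := hdel z zd; set d := derive1 g x; rewrite mul1r => h.
  have h2 : cabs (g z - g x) <= cabs d * cabs (z - x) + cabs (z - x).
    rewrite -(subrK (d * (z - x)) (g z - g x)); apply: le_trans (cabsD _ _) _.
    rewrite cabsM; lra.
  apply: le_trans h2 _; rewrite mulrDl (mulrDl (cabs d)) mul1r lerDr mulr_ge0 ?(ltW zx0) //.
  by rewrite divr_ge0 ?mulr_ge0 // ltW.
have h1 : cabs (g z - g x) <= 2 * B.
  by apply: le_trans (cabsD _ _) _; rewrite cabsN; have := hB z zs; have := hB x xs; lra.
apply: le_trans h1 _; rewrite (mulrDl (2 * B / del)) -[leLHS]addr0 lerD //; last first.
  by rewrite mulr_ge0 ?addr_ge0 ?cabs_ge0.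
by rewrite -mulrA ler_peMr ?mulr_ge0 // mulrC ler_pdivlMr // mul1r.
Qed.

(** The midpoint sum of [(z - x)^-2] against its primitive [- (z - x)^-1]. The error of one piece is
    cubic in its length; bisection divides the cube by 8 and doubles the number of pieces, hence the
    factor [4^-n]. *)
Lemma seg_prim n x a b (D : set C) (r : R) : 0 < r ->
  (forall z w, D z -> D w -> D (mid z w)) -> D a -> D b ->
  (forall z, D z -> r <= cabs (z - x)) ->
  cabs (seg n (fun z => (z - x)^-1 ^+ 2) a b - ((a - x)^-1 - (b - x)^-1))
    <= cabs (b - a) ^+ 3 / (4 * r ^+ 4) / 4 ^+ n.
Proof.
move=> r0 Dm + + hr; elim: n a b => [|n IH] a b Da Db /=.
  have Dab := Dm _ _ Da Db; set m := mid a b in Dab *.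
  have nz z : D z -> z - x != 0 by move=> /hr h; rewrite -cabs_gt0; lra.
  (* The exact error: with [p = m - x] and [h = (b - a) / 2] it is
     [- 2 h^3 / (p^2 (p - h) (p + h))]. *)
  have -> : (b - a) * (m - x)^-1 ^+ 2 - ((a - x)^-1 - (b - x)^-1) =
     - (b - a) ^+ 3 / 4%:R * ((m - x)^-1 ^+ 2 * (a - x)^-1 * (b - x)^-1).
    have hp : m - x - (b - a) / 2%:R = a - x by rewrite /m /mid; field.
    have hq : m - x + (b - a) / 2%:R = b - x by rewrite /m /mid; field.
    have := nz _ Dab; have := nz _ Da; have := nz _ Db.
    rewrite -hp -hq; have -> : b - a = 2%:R * ((b - a) / 2%:R) by field.
    set p := m - x; set h := (b - a) / 2%:R.
    have -> : 2%:R * h / 2%:R = h by field.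
    by move=> n1 n2 n3; field; rewrite n1 n2 n3.
  have iv z : D z -> cabs (z - x)^-1 <= r^-1.
    move=> /hr h; rewrite cabsV lef_pV2 ?posrE //; lra.
  rewrite expr0 divr1 cabsM cabsM cabsN cabsV cabsn cabsX -mulrA invfM.
  rewrite ler_wpM2l ?exprn_ge0 ?cabs_ge0 // ler_wpM2l ?invr_ge0 //.
  have -> : (r ^+ 4)^-1 = r^-1 ^+ 2 * r^-1 * r^-1 by rewrite exprVn; field; lra.
  by rewrite !cabsM !ler_pM ?mulr_ge0 ?cabs_ge0 ?iv.
have Dab := Dm _ _ Da Db; set m := mid a b in Dab *.
have h1 : m - a = (b - a) / 2%:R by rewrite /m /mid; field.
have h2 : b - m = (b - a) / 2%:R by rewrite /m /mid; field.
have := lerD (IH _ _ Da Dab) (IH _ _ Dab Db); rewrite h1 h2 => h.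
rewrite [X in cabs X](_ : _ = (seg n (fun z => (z - x)^-1 ^+ 2) a m - ((a - x)^-1 - (m - x)^-1)) +
  (seg n (fun z => (z - x)^-1 ^+ 2) m b - ((m - x)^-1 - (b - x)^-1))); last by ring.
apply: le_trans (cabsD _ _) _; apply: le_trans h _.
rewrite cabsM cabsV cabsn (exprS 4); set c := cabs _.
rewrite le_eqVlt; apply/orP; left; apply/eqP; field.
by rewrite expf_neq0 /= gt_eqF.
Qed.

Lemma cint_kernel_sqr s x : 0 < s -> cabs x <= s / 2 -> cint s (fun z => (z - x)^-1 ^+ 2) = 0.
Proof.
move=> s0 xs; apply: ulim_cvg => e e0.
pose r := s / 2; have r0 : 0 < r by rewrite divr_gt0.
pose K := (2 * s) ^+ 3 / (4 * r ^+ 4).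
have K0 : 0 < K by rewrite divr_gt0 ?mulr_gt0 ?exprn_gt0 //; lra.
have [n0 hn0] := @half_pow_lt R (4 * K) _ e0.
exists n0 => n hn; rewrite subr0.
have bnd (D : R -> R -> Prop) (u v u' v' : R) : D u v -> D u' v' ->
  (forall u v u' v', D u v -> D u' v' -> D ((u + u') / 2) ((v + v') / 2)) ->
  (forall u v, D u v -> [/\ `|u| <= s, `|v| <= s & `|u| = s \/ `|v| = s]) ->
  cabs (pt u' v' - pt u v) <= 2 * s ->
  cabs (seg n (fun z => (z - x)^-1 ^+ 2) (pt u v) (pt u' v') -
     ((pt u v - x)^-1 - (pt u' v' - x)^-1)) <= K / 4 ^+ n.
  move=> h1 h2 hm hD hu.
  apply: le_trans (@seg_prim n x (pt u v) (pt u' v') (fun z => exists2 p, D p.1 p.2 & z = pt p.1 p.2) r r0 _ _ _ _) _.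
  - move=> _ _ [p hp ->] [q hq ->]; rewrite pt_mid.
    by exists ((p.1 + q.1) / 2, (p.2 + q.2) / 2) => //=; apply: hm.
  - by exists (u, v).
  - by exists (u', v').
  - move=> _ [p hp ->]; have [h3 h4 h5] := hD _ _ hp; have /andP[h6 _] := ann_side s0 h3 h4 h5.
    have : cabs (pt p.1 p.2) <= cabs (pt p.1 p.2 - x) + cabs x by rewrite -{1}(subrK x (pt _ _)) cabsD.
    rewrite /r; lra.
  rewrite /K ler_wpM2r ?invr_ge0 ?exprn_ge0 // ler_wpM2r ?invr_ge0 ?mulr_ge0 ?exprn_ge0 ?(ltW r0) ?(ltW s0) //.
  by rewrite lerXn2r ?nnegrE ?cabs_ge0 //; lra.
have ns : `|s| = s by rewrite ger0_norm // ltW.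
have nns : `|- s| = s by rewrite normrN.
have mm (u v : R) : - s <= u <= s -> - s <= v <= s -> - s <= (u + v) / 2 <= s by lra.
have b1 (u u' v : R) : v = s \/ v = - s -> - s <= u <= s -> - s <= u' <= s ->
  cabs (seg n (fun z => (z - x)^-1 ^+ 2) (pt u v) (pt u' v) -
     ((pt u v - x)^-1 - (pt u' v - x)^-1)) <= K / 4 ^+ n.
  move=> hv hu hu'; apply: (bnd (fun u t : R => - s <= u <= s /\ t = v)) => //.
  - by move=> ? ? ? ? [? ->] [? ->]; split; [exact: mm|field].
  - by move=> ? ? [? ->]; case: hv => ->; rewrite ?nns ?ns ler_norml; split => //; right.
  - by rewrite ptB subrr; apply: le_trans (cabs_pt _ _) _; rewrite normr0 addr0 ler_norml; lra.
have b2 (u v v' : R) : u = s \/ u = - s -> - s <= v <= s -> - s <= v' <= s ->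
  cabs (seg n (fun z => (z - x)^-1 ^+ 2) (pt u v) (pt u v') -
     ((pt u v - x)^-1 - (pt u v' - x)^-1)) <= K / 4 ^+ n.
  move=> hv hu hu'; apply: (bnd (fun t v : R => - s <= v <= s /\ t = u)) => //.
  - by move=> ? ? ? ? [? ->] [? ->]; split; [exact: mm|field].
  - by move=> ? ? [? ->]; case: hv => ->; rewrite ?nns ?ns ler_norml; split => //; left.
  - by rewrite ptB subrr; apply: le_trans (cabs_pt _ _) _; rewrite normr0 add0r ler_norml; lra.
rewrite /cint_approx /sq (_ : - s + (s + s) = s); last by ring.
set f := fun z : C => _.
(* The increments of the primitive cancel around the closed contour, so they may be subtracted side
   by side. *)
have -> (p q p' q' : C) : seg n f p q + seg n f q p' + seg n f p' q' + seg n f q' p =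
  (seg n f p q - ((p - x)^-1 - (q - x)^-1)) + (seg n f q p' - ((q - x)^-1 - (p' - x)^-1)) +
  (seg n f p' q' - ((p' - x)^-1 - (q' - x)^-1)) + (seg n f q' p - ((q' - x)^-1 - (p - x)^-1)).
  by ring.
have i1 : - s <= s <= s by lra.
have i2 : - s <= - s <= s by lra.
apply: (@le_trans _ _ (K / 4 ^+ n + K / 4 ^+ n + K / 4 ^+ n + K / 4 ^+ n)).
  apply: le_trans (cabsD _ _) _; apply: lerD; last by apply: b2 => //; right.
  apply: le_trans (cabsD _ _) _; apply: lerD; last by apply: b1 => //; left.
  apply: le_trans (cabsD _ _) _; apply: lerD; last by apply: b2 => //; left.
  by apply: b1 => //; right.
apply: le_trans (ltW hn0).
have -> : K / 4 ^+ n + K / 4 ^+ n + K / 4 ^+ n + K / 4 ^+ n = 4 * K / 4 ^+ n by field; rewrite expf_neq0.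
have K4 : 0 <= 4 * K by rewrite mulr_ge0 // ltW.
rewrite ler_wpM2l // lef_pV2 ?posrE ?exprn_gt0 //.
apply: (@le_trans _ _ (2 ^+ n)); first by rewrite ler_weXn2l // ler1n.
by rewrite lerXn2r ?nnegrE // ler_nat.
Qed.
End cauchy.

(** * Cauchy's formula for a function and its derivatives *)

Section cauchy_formula.
Variable R : realType.
Local Notation C := (Cx R).
Implicit Types (phi psi g : C -> C) (a b z w x y : C).

Lemma kernel_bound (s : R) x z : 0 < s -> cabs x <= s / 2 -> ann s z ->
  (z - x != 0) /\ cabs (z - x)^-1 <= 2 / s.
Proof.
move=> s0 xs /andP[z1 z2].
have h : s / 2 <= cabs (z - x).
  have : cabs z <= cabs (z - x) + cabs x by rewrite -{1}(subrK x z) cabsD.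
  lra.
split; first by rewrite -cabs_gt0; lra.
by rewrite cabsV -[leRHS]invrK invf_div lef_pV2 ?posrE //; lra.
Qed.

(* The increments of the integral are quadratic in those of x, because
   (z - x)^-2 has a primitive; hence it does not depend on x. *)
Lemma cint_kernel s x : 0 < s -> cabs x <= s / 2 -> cint s (fun z => (z - x)^-1) = winding s.
Proof.
move=> s0 xs; pose V y := cint s (fun z => (z - y)^-1).
pose K := 8 * s * (2 / s) ^+ 3.
have q0 : 0 <= 2 / s by rewrite divr_ge0 // ltW.
have K0 : 0 <= K by apply: mulr_ge0; [lra|exact: exprn_ge0].
have step a b : cabs a <= s / 2 -> cabs b <= s / 2 -> cabs (V a - V b) <= K * cabs (a - b) ^+ 2.
  move=> ha hb.
  have -> : V a - V b = cint s (fun z => (z - a)^-1 - (z - b)^-1 - (a - b) * (z - a)^-1 ^+ 2).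
    have k2 := bdX 2 (bd_kernel s0 ha).
    rewrite cintB //; last by apply: bdM => //; exact: bd_cst.
      by rewrite cintZ // cint_kernel_sqr // mulr0 subr0 cintB //; exact: bd_kernel.
    by apply: bdD; [|apply: bd_opp]; exact: bd_kernel.
  rewrite /K -mulrA; apply: cint_bound => // z hz.
  have [na ka] := kernel_bound s0 ha hz; have [nb kb] := kernel_bound s0 hb hz.
  have -> : (z - a)^-1 - (z - b)^-1 - (a - b) * (z - a)^-1 ^+ 2 =
     - (a - b) ^+ 2 * ((z - a)^-1 ^+ 2 * (z - b)^-1) by field; rewrite na nb.
  rewrite cabsM cabsN cabsX mulrC ler_wpM2r ?exprn_ge0 ?cabs_ge0 //.
  rewrite cabsM cabsX (exprSr (2 / s)) ler_pM ?exprn_ge0 ?cabs_ge0 //.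
  by rewrite lerXn2r ?nnegrE ?cabs_ge0.
suff -> : winding s = V 0.
  apply/eqP; rewrite -subr_eq0 -cabs_eq0 eq_le cabs_ge0 andbT -/(V x).
  apply/ler_addgt0Pl => e e0; rewrite addr0.
  (* The segment from 0 to [x] is cut into [m] steps; the total increment is at most
     [m K (|x|/m)^2 = K |x|^2 / m], which is below [e]. *)
  pose m := (Num.truncn (K * cabs x ^+ 2 / e)).+1.
  have hm : K * cabs x ^+ 2 / e < m%:R by exact: Num.Theory.truncnS_gt.
  have m0 : m%:R != 0 :> C by rewrite pnatr_eq0.
  have m0R : 0 < m%:R :> R by rewrite ltr0n.
  have tel k : (k <= m)%N -> cabs (V (k%:R / m%:R * x) - V 0) <= k%:R * (K * (cabs x / m%:R) ^+ 2).
    elim: k => [|k IH] hk; first by rewrite !mul0r subrr cabs0.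
    rewrite -(subrK (V (k%:R / m%:R * x)) (V _)) -addrA; apply: le_trans (cabsD _ _) _.
    rewrite [leRHS](_ : _ = K * (cabs x / m%:R) ^+ 2 + k%:R * (K * (cabs x / m%:R) ^+ 2)); last first.
      by rewrite -natr1; ring.
    apply: lerD; last by apply: IH; exact: ltnW.
    have bnd j : (j <= m)%N -> cabs (j%:R / m%:R * x) <= s / 2.
      move=> hj; rewrite !cabsM cabsV !cabsn; apply: le_trans xs.
      by rewrite ler_piMl ?cabs_ge0 // ler_pdivrMr // mul1r ler_nat.
    apply: le_trans (step _ _ (bnd _ hk) (bnd _ (ltnW hk))) _.
    have -> : k.+1%:R / m%:R * x - k%:R / m%:R * x = x / m%:R.
      by rewrite -natr1; field; exact: m0.
    by rewrite cabsM cabsV cabsn.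
  have := tel m (leqnn m); rewrite mulfV // mul1r => h; apply: le_trans h _.
  have fe (t : R) : t != 0 -> t * (K * (cabs x / t) ^+ 2) = K * cabs x ^+ 2 / t.
    by move=> t0; field.
  rewrite fe ?gt_eqF //.
  by rewrite ler_pdivrMr // (mulrC e) -ler_pdivrMr // ltW.
by rewrite /V /winding; congr (cint s _); apply: funext => z; rewrite subr0.
Qed.

Lemma cauchy_formula s g x B : 0 < s -> cabs x <= s / 2 ->
  (forall z, cabs z <= 2 * s -> differentiable g z) ->
  (forall z, cabs z <= 2 * s -> cabs (g z) <= B) ->
  g x = (winding s)^-1 * cint s (fun z => g z * (z - x)^-1).
Proof.
move=> s0 xs hd hB.
have x2 : cabs x <= 2 * s by lra.
have bg : bd s g by exists B => z /andP[_ /hB].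
have bk := bd_kernel s0 xs.
have h := cauchy_quotient s0 x2 hd hB.
have e : (fun z => (g z - g x) * (z - x)^-1) = (fun z => g z * (z - x)^-1 - g x * (z - x)^-1).
  by apply: funext => z; rewrite mulrBl.
move: h; rewrite e cintB //; [|exact: bdM|by apply: bdM => //; exact: bd_cst].
rewrite cintZ // cint_kernel // => /eqP; rewrite subr_eq0 => /eqP ->.
by rewrite mulrC mulfK // winding_neq0.
Qed.

(** Meant for [U = 1/(z - x)], [V = 1/(z - w)] and [h = w - x]: a second order expansion of [V^p]
    with a constant uniform on the contour. The hypothesis [V - U = h U V] is the resolvent
    identity. *)
Lemma kernel_quad (p : nat) (q : R) : 0 <= q -> exists2 K, 0 <= K & forall U V h : C,
  cabs U <= q -> cabs V <= q -> V - U = h * U * V ->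
  cabs (V ^+ p - U ^+ p - p%:R * h * U ^+ p.+1) <= K * cabs h ^+ 2.
Proof.
move=> q0; elim: p => [|p [K K0 IH]].
  by exists 0 => // U V h _ _ _; rewrite !expr0 subrr !mul0r subr0 cabs0.
exists (q * K + p.+1%:R * (q ^+ p.+2 * q)).
  by apply: addr_ge0; apply: mulr_ge0 => //; apply: mulr_ge0 => //; exact: exprn_ge0.
move=> U V h Uq Vq e.
have -> : V ^+ p.+1 - U ^+ p.+1 - p.+1%:R * h * U ^+ p.+2 =
  V * (V ^+ p - U ^+ p - p%:R * h * U ^+ p.+1) + p.+1%:R * h ^+ 2 * (U ^+ p.+2 * V).
  have E0 : V - U - h * U * V = 0 by rewrite e subrr.
  apply/eqP; rewrite -subr_eq0; apply/eqP.
  rewrite [LHS](_ : _ = (U ^+ p + p.+1%:R * h * U ^+ p.+1) * (V - U - h * U * V)); last first.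
    by rewrite -natr1 !exprS; ring.
  by rewrite E0 mulr0.
apply: le_trans (cabsD _ _) _; rewrite mulrDl; apply: lerD.
  rewrite cabsM -(mulrA q); apply: ler_pM; rewrite ?cabs_ge0 //; exact: IH.
rewrite cabsM (cabsM p.+1%:R) cabsn (cabsX h) (cabsM (_ ^+ _) V) (cabsX U).
rewrite -[leRHS]mulrA -mulrA.
rewrite ler_wpM2l // mulrC ler_wpM2r ?exprn_ge0 ?cabs_ge0 //.
by rewrite ler_pM ?exprn_ge0 ?cabs_ge0 // lerXn2r ?nnegrE ?cabs_ge0.
Qed.

(** Differentiation under the integral sign: the quadratic error of [kernel_quad] is uniform on the
    contour, so it survives integration against any bounded [psi]. *)
Lemma cint_kernel_cderiv s psi k x : 0 < s -> bd s psi -> cabs x < s / 2 ->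
  cderiv (fun x => cint s (fun z => psi z * (z - x)^-1 ^+ k)) x
    (k%:R * cint s (fun z => psi z * (z - x)^-1 ^+ k.+1)).
Proof.
move=> s0 bp xs; have [Bp hBp] := bp.
have q0 : 0 <= 2 / s by rewrite divr_ge0 // ltW.
have [K K0 hK] := kernel_quad k q0.
have r0 : 0 < s / 2 - cabs x by lra.
apply: (@quad_cderiv R _ _ _ _ (8 * s * (Bp * K)) r0) => w hw.
have ws : cabs w <= s / 2.
  by have := cabsD (w - x) x; rewrite subrK; lra.
have xs' := ltW xs.
have bk (y : C) j : cabs y <= s / 2 -> bd s (fun z => psi z * (z - y)^-1 ^+ j).
  by move=> hy; apply: bdM => //; apply: bdX; exact: bd_kernel.
rewrite -cintB; [|by []|exact: bk|exact: bk].
rewrite [X in _ - X](_ : _ = cint s (fun z => k%:R * (w - x) * (psi z * (z - x)^-1 ^+ k.+1))); last first.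
  by rewrite cintZ //; [ring|exact: bk].
rewrite -cintB //; last 2 first.
- by apply: bdD; [|apply: bd_opp]; exact: bk.
- by apply: bdM; [exact: bd_cst|exact: bk].
rewrite -[leRHS]mulrA; apply: cint_bound => // z hz.
have [nx kx] := kernel_bound s0 xs' hz; have [nw kw] := kernel_bound s0 ws hz.
have -> : psi z * (z - w)^-1 ^+ k - psi z * (z - x)^-1 ^+ k - k%:R * (w - x) * (psi z * (z - x)^-1 ^+ k.+1) =
  psi z * ((z - w)^-1 ^+ k - (z - x)^-1 ^+ k - k%:R * (w - x) * (z - x)^-1 ^+ k.+1) by ring.
rewrite cabsM -[leRHS]mulrA; apply: ler_pM; rewrite ?cabs_ge0 ?hBp //.
by apply: hK => //; field; rewrite nx nw.
Qed.

Lemma derive1n_cauchy s g B : 0 < s ->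
  (forall z, cabs z <= 2 * s -> differentiable g z) ->
  (forall z, cabs z <= 2 * s -> cabs (g z) <= B) ->
  forall k x, cabs x < s / 2 -> derive1n k g x =
    k`!%:R * (winding s)^-1 * cint s (fun z => g z * (z - x)^-1 ^+ k.+1).
Proof.
move=> s0 hd hB; elim=> [|k IH] x xs.
  rewrite derive1n0 mul1r (cauchy_formula s0 (ltW xs) hd hB).
  by under [in RHS]eq_fun do rewrite expr1.
have bg : bd s g by exists B => z /andP[_ /hB].
rewrite derive1nS.
have c := cint_kernel_cderiv k.+1 s0 bg xs.
have r0 : 0 < s / 2 - cabs x by lra.
apply: cderiv_derive1 => e e0.
(* Exceeds the modulus of the factor [k! / winding s], as [winding s] has modulus at least 4. *)
pose M : R := k`!%:R / 4 + 1.
have M0 : 0 < M by rewrite ltr_pwDr // divr_ge0.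
have [del del0 hdel] := c (e / M) (divr_gt0 e0 M0).
exists (Num.min del (s / 2 - cabs x)); first by rewrite lt_min del0 r0.
move=> w; rewrite lt_min => /andP[wd wr].
have ws : cabs w < s / 2 by have := cabsD (w - x) x; rewrite subrK; lra.
rewrite !IH // -mulrBr.
have -> : k.+1`!%:R * (winding s)^-1 * cint s (fun z => g z * (z - x)^-1 ^+ k.+2) * (w - x) =
  k`!%:R * (winding s)^-1 * (k.+1%:R * cint s (fun z => g z * (z - x)^-1 ^+ k.+2) * (w - x)).
  by rewrite factS natrM; ring.
rewrite -mulrBr cabsM; apply: le_trans (ler_wpM2l (cabs_ge0 _) (hdel w wd)) _.
rewrite mulrA ler_wpM2r ?cabs_ge0 // mulrCA ler_piMr ?(ltW e0) //.
rewrite ler_pdivrMr // mul1r cabsM cabsV cabsn /M.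
have : (cabs (winding s))^-1 <= 4^-1 by rewrite lef_pV2 ?posrE //; have := winding_ge4 s0; lra.
move=> h; apply: le_trans (ler_wpM2l _ h) _ => //; lra.
Qed.

Lemma differentiable_derive1n s g B : 0 < s ->
  (forall z, cabs z <= 2 * s -> differentiable g z) ->
  (forall z, cabs z <= 2 * s -> cabs (g z) <= B) ->
  forall k x, cabs x < s / 2 -> differentiable (derive1n k g) x.
Proof.
move=> s0 hd hB k x xs.
have bg : bd s g by exists B => z /andP[_ /hB].
have c := cint_kernel_cderiv k.+1 s0 bg xs.
have r0 : 0 < s / 2 - cabs x by lra.
pose f := (k`!%:R * (winding s)^-1) *: (fun x => cint s (fun z => g z * (z - x)^-1 ^+ k.+1)).
have df : differentiable f x by apply: differentiableZ; exact: cderiv_diff c.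
apply/derivable1_diffP.
apply: (@near_eq_derivable _ _ _ f); last exact/derivable1_diffP.
apply/nbhs_cabs; exists (s / 2 - cabs x) => // w wr.
have ws : cabs w < s / 2 by have := cabsD (w - x) x; rewrite subrK; lra.
by rewrite (derive1n_cauchy s0 hd hB).
Qed.
End cauchy_formula.

(** * Taylor coefficients and remainders in one variable *)

Section taylor.
Variable R : realType.
Local Notation C := (Cx R).
Implicit Types (phi psi g : C -> C) (a b z w x y : C).

Definition tcoef g k : C := (k`!%:R)^-1 * derive1n k g 0.

Lemma derive1n_cst k (c : C) : derive1n k.+1 (cst c : C -> C) = cst 0.
Proof.
have h d : derive1 (cst d : C -> C) = cst 0 by apply: funext => x; rewrite derive1_cst.
by rewrite derive1Sn h; elim: k => // k IH; rewrite derive1Sn h.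
Qed.

Lemma ann_neq0 (s : R) z : 0 < s -> ann s z -> z != 0.
Proof. by move=> s0 /andP[h _]; rewrite -cabs_gt0; lra. Qed.

(** For [k > j] the integrand extends to a polynomial and Goursat applies. For [k < j] it is a power
    of [1/z] of exponent at least 2, and its integral is read off from Cauchy's formula for a
    derivative of the constant 1. *)
Lemma cint_monomial s k j : 0 < s ->
  cint s (fun z => z ^+ k * z^-1 ^+ j.+1) = if k == j then winding s else 0.
Proof.
move=> s0.
have bi : bd s (fun z : C => z^-1) by exact: bd_inv.
have [kj|kj|<-] := ltngtP k j.
- have -> : cint s (fun z => z ^+ k * z^-1 ^+ j.+1) = cint s (fun z => z^-1 ^+ (j - k).+1).
    apply: cint_ext => //; first exact: bdX.
    move=> z /(ann_neq0 s0) z0; rewrite -subSn ?(ltnW kj) // -{1}(subnK (ltnW (ltn_trans kj (leqnn _)))).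
    by rewrite exprD mulrC -mulrA -exprMn mulVf // expr1n mulr1.
  rewrite -(subnK kj) addnC addSnnS addKn. set m := (j - k.+1)%N.
  have hd z : cabs z <= 2 * s -> differentiable (cst 1 : C -> C) z by [].
  have hB z : cabs z <= 2 * s -> cabs ((cst 1 : C -> C) z) <= 1 by rewrite cabs1.
  have h0 : cabs (0 : C) < s / 2 by rewrite cabs0 divr_gt0.
  have := derive1n_cauchy s0 hd hB m.+1 h0; rewrite derive1n_cst /=.
  move=> /esym/eqP; rewrite !mulf_eq0 invr_eq0 (negbTE (winding_neq0 s0)) orbF.
  rewrite pnatr_eq0 -leqn0 leqNgt fact_gt0 /= => /eqP <-.
  by congr (cint s _); apply: funext => z; rewrite mul1r subr0.
- have -> : cint s (fun z => z ^+ k * z^-1 ^+ j.+1) = cint s (fun z => z ^+ (k - j.+1)).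
    apply: cint_ext => //; first by apply: bdX; exact: bd_id.
    move=> z /(ann_neq0 s0) z0; rewrite -{1}(subnK kj).
    by rewrite exprD -mulrA -exprMn mulfV // expr1n mulr1.
  apply: (@cint_goursat _ _ _ 0 ((2 * s) ^+ (k - j.+1))) => //.
  + by move=> z _ _; apply/derivable1_diffP; exact: exprn_derivable.
  + by move=> z hz; rewrite cabsX lerXn2r ?nnegrE ?cabs_ge0 //; lra.
- apply: cint_ext => // z /(ann_neq0 s0) z0.
  by rewrite exprS mulrCA -exprMn mulfV // expr1n mulr1.
Qed.

Lemma winding_inv_le (s : R) : 0 < s -> cabs (winding s)^-1 <= 4^-1.
Proof. by move=> s0; rewrite cabsV lef_pV2 ?posrE //; have := winding_ge4 s0; lra. Qed.

Lemma ann_inv (s : R) z : 0 < s -> ann s z -> cabs z^-1 <= s^-1.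
Proof.
by move=> s0 hz; have /andP[h _] := hz; rewrite cabsV lef_pV2 ?posrE //; lra.
Qed.

Section fixed.
Variables (s B : R) (g : C -> C).
Hypothesis s0 : 0 < s.
Hypothesis hd : forall z, cabs z <= 2 * s -> differentiable g z.
Hypothesis hB : forall z, cabs z <= 2 * s -> cabs (g z) <= B.

Let bg : bd s g. Proof. by exists B => z /andP[_ /hB]. Qed.

Lemma tcoefE k : tcoef g k = (winding s)^-1 * cint s (fun z => g z * z^-1 ^+ k.+1).
Proof.
have h0 : cabs (0 : C) < s / 2 by rewrite cabs0 divr_gt0.
rewrite /tcoef (derive1n_cauchy s0 hd hB k h0) !mulrA mulVf ?mul1r; last first.
  by rewrite pnatr_eq0 -lt0n fact_gt0.
by congr (_ * cint s _); apply: funext => z; rewrite subr0.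
Qed.

(** The constant is [8 s] from [cint_bound], divided by the lower bound 4 for the modulus of
    [winding]. *)
Lemma cint_normalized_bound phi K : (forall z, ann s z -> cabs (phi z) <= K) ->
  cabs ((winding s)^-1 * cint s phi) <= 2 * s * K.
Proof.
move=> h; rewrite cabsM.
have h1 := cint_bound s0 h; have h2 := winding_inv_le s0.
apply: le_trans (ler_pM (cabs_ge0 _) (cabs_ge0 _) h2 h1) _.
by rewrite le_eqVlt; apply/orP; left; apply/eqP; field.
Qed.

(** Cauchy's estimate for [g - p]. Closeness is asked on the contour only, and the degree of [p]
    does not enter the bound. *)
Lemma tcoef_poly (p : {poly C}) i (E : R) :
  (forall z, ann s z -> cabs (g z - p.[z]) <= E) ->
  cabs (tcoef g i - p`_i) <= 2 * E / s ^+ i.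
Proof.
move=> hE.
have bi : bd s (fun z : C => z^-1 ^+ i.+1) by apply: bdX; exact: bd_inv.
have bm k : bd s (fun z : C => z ^+ k * z^-1 ^+ i.+1).
  by apply: bdM => //; apply: bdX; exact: bd_id.
have bmp k : bd s (fun z : C => p`_k * (z ^+ k * z^-1 ^+ i.+1)).
  by apply: bdM => //; exact: bd_cst.
have pE : p`_i = (winding s)^-1 * cint s (fun z => \sum_(k < size p) p`_k * (z ^+ k * z^-1 ^+ i.+1)).
  rewrite cint_sum //.
  under eq_bigr do rewrite cintZ // cint_monomial //.
  case: (ltnP i (size p)) => hi.
    rewrite (bigD1 (Ordinal hi)) //= eqxx big1 ?addr0; last first.
      by move=> k; rewrite -val_eqE /= => /negbTE ->; rewrite mulr0.
    by rewrite mulrC mulfK // winding_neq0.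
  rewrite big1 ?mulr0 ?nth_default // => k _.
  by rewrite ltn_eqF ?mulr0 // (leq_trans _ hi).
rewrite tcoefE pE -mulrBr -cintB //; [|exact: bdM|exact: bd_sum].
have -> : 2 * E / s ^+ i = 2 * s * (E * s^-1 ^+ i.+1).
  by rewrite exprSr exprVn; field; rewrite expf_neq0 ?gt_eqF // andbT gt_eqF.
apply: cint_normalized_bound => z hz.
have -> : \sum_(k < size p) p`_k * (z ^+ k * z^-1 ^+ i.+1) = p.[z] * z^-1 ^+ i.+1.
  by rewrite horner_coef mulr_suml; apply: eq_bigr => k _; rewrite mulrA.
rewrite -mulrBl cabsM cabsX; apply: ler_pM; rewrite ?exprn_ge0 ?cabs_ge0 ?hE //.
by rewrite lerXn2r ?nnegrE ?cabs_ge0 ?invr_ge0 ?(ltW s0) ?(ann_inv s0).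
Qed.

(** The truncated geometric expansion of the kernel leaves exactly [(z - x)^-1 (x / z)^(n+1)]. *)
Lemma taylor_bound n x : cabs x <= s / 2 ->
  cabs (g x - \sum_(k < n.+1) tcoef g k * x ^+ k) <= 4 * B * (cabs x / s) ^+ n.+1.
Proof.
move=> xs.
have bi k : bd s (fun z : C => z^-1 ^+ k) by apply: bdX; exact: bd_inv.
have bgi k : bd s (fun z : C => g z * z^-1 ^+ k) by apply: bdM.
rewrite (cauchy_formula s0 xs hd hB).
have -> : \sum_(k < n.+1) tcoef g k * x ^+ k =
   (winding s)^-1 * cint s (fun z => \sum_(k < n.+1) x ^+ k * (g z * z^-1 ^+ k.+1)).
  rewrite cint_sum //; last by move=> k; apply: bdM => //; exact: bd_cst.
  rewrite mulr_sumr; apply: eq_bigr => k _; rewrite cintZ // tcoefE; ring.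
rewrite -mulrBr -cintB //; last 2 first.
- by apply: bdM => //; exact: bd_kernel.
- by apply: bd_sum => k; apply: bdM => //; exact: bd_cst.
have -> : 4 * B * (cabs x / s) ^+ n.+1 = 2 * s * (B * ((2 / s) * (cabs x / s) ^+ n.+1)).
  by field; rewrite gt_eqF.
apply: cint_normalized_bound => z hz; have /andP[_ z2] := hz.
have z0 := ann_neq0 s0 hz; have [nx kx] := kernel_bound s0 xs hz.
have -> : g z * (z - x)^-1 - \sum_(k < n.+1) x ^+ k * (g z * z^-1 ^+ k.+1) =
   g z * ((z - x)^-1 * (x / z) ^+ n.+1).
  have -> : \sum_(k < n.+1) x ^+ k * (g z * z^-1 ^+ k.+1) = g z * (z - x)^-1 * (1 - (x / z) ^+ n.+1).
    rewrite -[1 - _]opprB subrX1.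
    have -> : \sum_(k < n.+1) x ^+ k * (g z * z^-1 ^+ k.+1) = g z / z * \sum_(k < n.+1) (x / z) ^+ k.
      by rewrite mulr_sumr; apply: eq_bigr => k _; rewrite exprMn exprS; ring.
    by set S := \sum_(_ < _) _; field; rewrite z0 nx.
  by ring.
rewrite cabsM; apply: ler_pM; rewrite ?cabs_ge0 ?hB //.
rewrite cabsM cabsX; apply: ler_pM; rewrite ?exprn_ge0 ?cabs_ge0 //.
rewrite lerXn2r ?nnegrE ?cabs_ge0 ?divr_ge0 ?cabs_ge0 ?(ltW s0) //.
by rewrite cabsM ler_wpM2l ?cabs_ge0 ?(ann_inv s0).
Qed.
End fixed.
End taylor.

(** * Several variables *)

Section several.
Variable R : realType.
Local Notation C := (Cx R).
Local Notation env := (nat -> C).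
Implicit Types (Phi Psi : env -> C) (e x : env).

(** A point of [C^N] is an infinite sequence of which only the first [N] entries count, so that
    induction on [N] needs no casts. *)
Definition econs (z : C) e : env := fun n => if n is n'.+1 then e n' else z.

Definition upd e (j : nat) (t : C) : env := fun n => if n == j then t else e n.

Definition annN N (s : R) e := forall j, (j < N)%N -> ann s (e j).
Definition boxN N (s : R) e := forall j, (j < N)%N -> cabs (e j) <= s.
Definition bdN N (s : R) Psi := exists B, forall e, annN N s e -> cabs (Psi e) <= B.

Fixpoint mcint N (s : R) (Psi : env -> C) : C :=
  if N is N'.+1 then (winding s)^-1 * cint s (fun z => mcint N' s (fun e => Psi (econs z e)))
  else Psi (fun=> 0).

Lemma annN_cons N s z e : ann s z -> annN N s e -> annN N.+1 s (econs z e).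
Proof. by move=> hz he [|j] //= jN; exact: he. Qed.

Lemma mcint_bound N (s : R) Psi B : 0 < s -> (forall e, annN N s e -> cabs (Psi e) <= B) ->
  cabs (mcint N s Psi) <= (2 * s) ^+ N * B.
Proof.
move=> s0; elim: N Psi => [|N IH] Psi h /=; first by rewrite expr0 mul1r; exact: h.
rewrite exprS -mulrA; apply: cint_normalized_bound => // z hz; apply: IH => e he.
by apply: h; exact: annN_cons.
Qed.

Lemma bdN_cons N s Psi z : ann s z -> bdN N.+1 s Psi -> bdN N s (fun e => Psi (econs z e)).
Proof. by move=> hz [B hB]; exists B => e he; apply: hB; exact: annN_cons. Qed.

Lemma bd_mcint N (s : R) Psi : 0 < s -> bdN N.+1 s Psi ->
  bd s (fun z => mcint N s (fun e => Psi (econs z e))).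
Proof.
move=> s0 [B hB]; exists ((2 * s) ^+ N * B) => z hz; apply: mcint_bound => // e he.
by apply: hB; exact: annN_cons.
Qed.

Lemma mcintD N (s : R) Psi Psi' : 0 < s -> bdN N s Psi -> bdN N s Psi' ->
  mcint N s (fun e => Psi e + Psi' e) = mcint N s Psi + mcint N s Psi'.
Proof.
move=> s0; elim: N Psi Psi' => [|N IH] Psi Psi' h h' //=.
rewrite -mulrDr -cintD //; try exact: bd_mcint.
congr (_ * _); apply: cint_ext => //; first by apply: bdD; exact: bd_mcint.
by move=> z hz; apply: IH; exact: bdN_cons.
Qed.

Lemma mcintZ N (s : R) k Psi : 0 < s -> bdN N s Psi ->
  mcint N s (fun e => k * Psi e) = k * mcint N s Psi.
Proof.
move=> s0; elim: N Psi => [|N IH] Psi h //=.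
rewrite mulrCA -(cintZ k) //; last exact: (bd_mcint s0 h).
congr (_ * _); apply: cint_ext => //; first by apply: bdM; [exact: bd_cst|exact: (bd_mcint s0 h)].
by move=> z hz; apply: IH; exact: bdN_cons.
Qed.

Lemma bdN_M N s Psi Psi' : bdN N s Psi -> bdN N s Psi' -> bdN N s (fun e => Psi e * Psi' e).
Proof.
move=> [B h] [B' h']; exists (B * B') => z hz; rewrite cabsM.
by apply: ler_pM; rewrite ?cabs_ge0 ?h ?h'.
Qed.

Lemma bdN_cst N s k : bdN N s (fun=> k).
Proof. by exists (cabs k). Qed.

Lemma bdN_coord N s (f : C -> C) (j : nat) : (j < N)%N -> bd s f -> bdN N s (fun e => f (e j)).
Proof. by move=> jN [B hB]; exists B => e he; apply: hB; exact: he. Qed.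

Lemma bdN_sum N s (I : Type) (r : seq I) (P : pred I) (F : I -> env -> C) :
  (forall i, bdN N s (F i)) -> bdN N s (fun e => \sum_(i <- r | P i) F i e).
Proof.
move=> h; elim: r => [|i r [B hB]].
  by exists 0 => e _; rewrite big_nil cabs0.
have [B' hB'] := h i; exists (`|B'| + B) => e he.
have h1 := hB e he; have h2 := hB' e he; rewrite big_cons; case: ifP => _.
  by apply: le_trans (cabsD _ _) _; rewrite lerD // (le_trans h2) // ler_norm.
by apply: le_trans h1 _; rewrite lerDr.
Qed.

Lemma bdN_prod N s (I : Type) (r : seq I) (P : pred I) (F : I -> env -> C) :
  (forall i, bdN N s (F i)) -> bdN N s (fun e => \prod_(i <- r | P i) F i e).
Proof.
move=> h; elim: r => [|i r IH].
  by exists 1 => e _; rewrite big_nil cabs1.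
have [B hB] := IH; have [B' hB'] := bdN_M (h i) IH.
by case Pi: (P i); [exists B'|exists B] => e he; rewrite big_cons Pi; [exact: hB'|exact: hB].
Qed.

Lemma mcint_sum N (s : R) (I : Type) (r : seq I) (P : pred I) (F : I -> env -> C) : 0 < s ->
  (forall i, bdN N s (F i)) ->
  mcint N s (fun e => \sum_(i <- r | P i) F i e) = \sum_(i <- r | P i) mcint N s (F i).
Proof.
move=> s0 h; elim: r => [|i r IH].
  have -> : (fun e => \sum_(i <- [::] | P i) F i e) = (fun e => 0 * 0).
    by apply: funext => z; rewrite big_nil mul0r.
  by rewrite (mcintZ _ s0) ?mul0r ?big_nil //; exact: bdN_cst.
rewrite big_cons; case: ifP => Pi; last first.
  by rewrite -IH; congr (mcint _ s _); apply: funext => z; rewrite big_cons Pi.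
rewrite -IH -mcintD //; last exact: bdN_sum.
by congr (mcint _ s _); apply: funext => z; rewrite big_cons Pi.
Qed.

(** Only separate differentiability and a bound are asked, which is all that the iterated
    one-variable formula uses. *)
Definition sep_holo N (s B : R) Phi :=
  [/\ forall e e', (forall j, (j < N)%N -> e j = e' j) -> Phi e = Phi e',
      forall e, boxN N (2 * s) e -> cabs (Phi e) <= B
    & forall e j, boxN N (2 * s) e -> (j < N)%N ->
        differentiable (fun t : C => Phi (upd e j t)) (e j)].

Lemma ann_le (s : R) z : ann s z -> cabs z <= 2 * s.
Proof. by case/andP. Qed.

Lemma sep_holo_cons N (s B : R) Phi z : cabs z <= 2 * s -> sep_holo N.+1 s B Phi ->
  sep_holo N s B (fun e => Phi (econs z e)).
Proof.
move=> hz [h1 h2 h3].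
have bc e : boxN N (2 * s) e -> boxN N.+1 (2 * s) (econs z e) by move=> he [|j] //=; exact: he.
split.
- by move=> e e' h; apply: h1 => -[|j] //=; exact: h.
- by move=> e he; apply: h2; exact: bc.
- move=> e j he jN; have := h3 (econs z e) j.+1 (bc _ he) jN.
  have -> // : (fun t : C => Phi (upd (econs z e) j.+1 t)) = (fun t => Phi (econs z (upd e j t))).
  by apply: funext => t; congr Phi; apply: funext => -[|n].
Qed.

(** Cauchy's formula in entry 0, then the induction hypothesis in the other entries for each fixed
    value of entry 0 on the contour. *)
Lemma cauchy_several N (s B : R) Phi x : 0 < s -> sep_holo N s B Phi -> boxN N (s / 2) x ->
  Phi x = mcint N s (fun e => Phi e * \prod_(j < N) (e j - x j)^-1).
Proof.
move=> s0; elim: N Phi x => [|N IH] Phi x hPhi hx.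
  by rewrite /= big_ord0 mulr1; case: hPhi => h _ _; apply: h.
have [h1 h2 h3] := hPhi.
pose x' : env := fun n => x n.+1.
have xE : x = econs (x 0%N) x' by apply: funext => -[].
have hx' : boxN N (s / 2) x' by move=> j jN; exact: hx.
have s2 : s / 2 <= 2 * s by lra.
have bx z : cabs z <= 2 * s -> boxN N.+1 (2 * s) (econs z x').
  by move=> hz [|j] //= jN; apply: le_trans (hx' j jN) s2.
rewrite {1}xE (@cauchy_formula R s (fun z => Phi (econs z x')) _ B s0) /=; last 3 first.
- exact: hx.
- move=> z hz; have := h3 _ 0%N (bx z hz) isT.
  have -> // : (fun t : C => Phi (upd (econs z x') 0 t)) = (fun t => Phi (econs t x')).
  by apply: funext => t; congr Phi; apply: funext => -[].
- by move=> z hz; apply: h2; exact: bx.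
have hb : bdN N.+1 s (fun e => Phi e * \prod_(j < N.+1) (e j - x j)^-1).
  apply: bdN_M; first by exists B => e he; apply: h2 => j jN; exact/ann_le/he.
  apply: bdN_prod => j; apply: (@bdN_coord _ s (fun z => (z - x j)^-1)) => //.
  by apply: bd_kernel => //; exact: hx.
congr (_ * _); apply: cint_ext => //; first exact: (bd_mcint s0 hb).
move=> z hz; rewrite (IH (fun e => Phi (econs z e)) x' (sep_holo_cons (ann_le hz) hPhi) hx').
rewrite mulrC -mcintZ //.
  congr (mcint _ s _); apply: funext => e; rewrite big_ord_recl /=; rewrite [RHS]mulrCA.
  by congr (_ * (_ * _)).
apply: bdN_M; first by exists B => e he; apply: h2 => -[|j] jN /=; [exact: ann_le|exact/ann_le/he].
apply: bdN_prod => j; apply: (@bdN_coord _ s (fun z => (z - x' j)^-1)) => //.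
by apply: bd_kernel => //; exact: hx'.
Qed.
End several.

Section several_taylor.
Variable R : realType.
Local Notation C := (Cx R).
Local Notation env := (nat -> C).
Implicit Types (Phi Psi : env -> C) (e x : env).

(** The factors are exchanged one at a time; [1 <= Q] allows all the powers of [Q] to be rounded up
    to [Q^N]. *)
Lemma prod_diff_bound N (a b : nat -> C) (Q eta : R) : 1 <= Q -> 0 <= eta ->
  (forall j, (j < N)%N -> cabs (a j) <= Q) -> (forall j, (j < N)%N -> cabs (b j) <= Q) ->
  (forall j, (j < N)%N -> cabs (a j - b j) <= eta) ->
  cabs (\prod_(j < N) a j - \prod_(j < N) b j) <= N%:R * Q ^+ N * eta.
Proof.
move=> Q1 eta0; elim: N => [|N IH] ha hb hab; first by rewrite !big_ord0 subrr cabs0 !mul0r.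
have Q0 : 0 <= Q by apply: le_trans Q1.
rewrite !big_ord_recr /=.
set A := \prod_(_ < _) _; set B := \prod_(_ < _) _.
have -> : A * a N - B * b N = (A - B) * a N + B * (a N - b N) by ring.
apply: le_trans (cabsD _ _) _; rewrite !cabsM.
have hAB : cabs (A - B) <= N%:R * Q ^+ N * eta.
  by apply: IH => j jN; [apply: ha|apply: hb|apply: hab]; exact: ltnW.
have hB : cabs B <= Q ^+ N.
  rewrite cabs_prod -[N in leRHS]card_ord -prodr_const.
  by apply: ler_prod => j _; rewrite cabs_ge0 hb // ltnS ltnW.
have -> : N.+1%:R * Q ^+ N.+1 * eta = N%:R * Q ^+ N * eta * Q + Q ^+ N * (Q * eta).
  by rewrite -natr1 exprSr; ring.
apply: lerD; apply: ler_pM; rewrite ?cabs_ge0 ?ha //.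
by apply: le_trans (hab _ _) _ => //; rewrite ler_peMl.
Qed.

(** The product of the kernels is replaced by the product of their truncated geometric series, which
    expands into the sum over all exponents at most [n] in each variable. As [c] takes arbitrary
    natural exponents, the same coefficients serve every [n]. *)
Lemma taylor_several N (s B : R) Phi : 0 < s -> sep_holo N s B Phi ->
  exists c : ('I_N -> nat) -> C,
    (forall a, cabs (c a) <= 2 ^+ N * B * \prod_j s^-1 ^+ a j) /\
    forall n, exists K, forall x t, t <= s / 2 -> boxN N t x -> 0 <= t ->
      cabs (Phi x - \sum_(a : {ffun 'I_N -> 'I_n.+1}) c (fun j => a j) * \prod_(j < N) x j ^+ a j)
        <= K * t ^+ n.+1.
Proof.
move=> s0 hPhi; have [h1 h2 h3] := hPhi.
have B0 : 0 <= B.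
  apply: le_trans (cabs_ge0 _) (h2 (fun=> 0) _) => j _; rewrite cabs0; lra.
have bPhi : bdN N s Phi by exists B => e he; apply: h2 => j jN; exact/ann_le/he.
have bk (a : 'I_N -> nat) : bdN N s (fun e => \prod_(j < N) (e j)^-1 ^+ (a j).+1).
  apply: bdN_prod => j; apply: (@bdN_coord _ _ s (fun z => z^-1 ^+ (a j).+1)) => //.
  by apply: bdX; exact: bd_inv.
pose c (a : 'I_N -> nat) := mcint N s (fun e => Phi e * \prod_(j < N) (e j)^-1 ^+ (a j).+1).
exists c; split.
  move=> a.
  have -> : 2 ^+ N * B * \prod_j s^-1 ^+ a j = (2 * s) ^+ N * (B * \prod_(j < N) s^-1 ^+ (a j).+1).
    under [in RHS]eq_bigr do rewrite exprS.
    rewrite big_split /= prodr_const card_ord exprMn exprVn.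
    by set p := \prod_(_ < _) _; field; rewrite expf_neq0 // gt_eqF.
  apply: mcint_bound => // e he; rewrite cabsM cabs_prod; apply: ler_pM; first exact: cabs_ge0.
  - by apply: prodr_ge0 => j _; exact: cabs_ge0.
  - by apply: h2 => j jN; exact/ann_le/he.
  apply: ler_prod => j _; rewrite cabs_ge0 cabsX lerXn2r ?nnegrE ?cabs_ge0 ?invr_ge0 ?(ltW s0) //.
  by apply: ann_inv => //; exact: he.
move=> n.
(* The kernel is at most [2 / s] and differs from its truncation by at most [2 / s]; the 1 ensures
   [1 <= Q]. *)
pose Q := 4 / s + 1.
have Q1 : 1 <= Q by rewrite lerDr divr_ge0 // ltW.
exists ((2 * s) ^+ N * (B * (N%:R * Q ^+ N * ((2 / s) * s^-1 ^+ n.+1)))) => x t ts hx t0.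
have hxs : boxN N (s / 2) x by move=> j jN; apply: le_trans (hx j jN) ts.
pose Tk (u z : C) := \sum_(k < n.+1) u ^+ k * z^-1 ^+ k.+1.
have bc (a : 'I_N -> nat) : bdN N s (fun e => (\prod_(j < N) x j ^+ a j) * (Phi e * \prod_(j < N) (e j)^-1 ^+ (a j).+1)).
  by apply: (@bdN_M _ _ _ (fun=> _)); [exact: bdN_cst|exact: bdN_M].
have -> : \sum_(a : {ffun 'I_N -> 'I_n.+1}) c (fun j => a j) * \prod_(j < N) x j ^+ a j =
  mcint N s (fun e => Phi e * \prod_(j < N) Tk (x j) (e j)).
  have bP (a : 'I_N -> nat) : bdN N s (fun e => Phi e * \prod_(j < N) (e j)^-1 ^+ (a j).+1) by exact: bdN_M.
  transitivity (mcint N s (fun e => \sum_(a : {ffun 'I_N -> 'I_n.+1})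
     (\prod_(j < N) x j ^+ a j) * (Phi e * \prod_(j < N) (e j)^-1 ^+ (a j).+1))).
    rewrite mcint_sum //; apply: eq_bigr => a _.
    by rewrite mcintZ // mulrC.
  congr (mcint N s _); apply: funext => e; rewrite /Tk bigA_distr_bigA /= mulr_sumr.
  by apply: eq_bigr => a _; rewrite big_split /=; ring.
rewrite (cauchy_several s0 hPhi hxs).
have bK : bdN N s (fun e => Phi e * \prod_(j < N) (e j - x j)^-1).
  apply: bdN_M => //; apply: bdN_prod => j; apply: (@bdN_coord _ _ s (fun z => (z - x j)^-1)) => //.
  by apply: bd_kernel => //; exact: hxs.
have bT : bdN N s (fun e => Phi e * \prod_(j < N) Tk (x j) (e j)).
  apply: bdN_M => //; apply: bdN_prod => j; apply: (@bdN_coord _ _ s (fun z => Tk (x j) z)) => //.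
  apply: bd_sum => k; apply: (@bdM _ _ (fun=> _)); first exact: bd_cst.
  by apply: bdX; exact: bd_inv.
rewrite -[X in _ - X]mul1r -mulNr -mcintZ // -mcintD //; last by apply: (@bdN_M _ _ _ (fun=> _)) => //; exact: bdN_cst.
rewrite -!mulrA; apply: mcint_bound => // e he.
rewrite mulN1r -mulrBr cabsM; apply: ler_pM; rewrite ?cabs_ge0 //.
  by apply: h2 => j jN; exact/ann_le/he.
pose eta := 2 / s * (t / s) ^+ n.+1.
have eta0 : 0 <= eta by rewrite mulr_ge0 ?exprn_ge0 // divr_ge0 // ltW.
have dif j : (j < N)%N -> cabs ((e j - x j)^-1 - Tk (x j) (e j)) <= eta.
  move=> jN; have z0 := ann_neq0 s0 (he j jN); have [nx kx] := kernel_bound s0 (hxs j jN) (he j jN).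
  set z := e j in z0 nx kx *; set y := x j in nx kx *.
  have -> : Tk y z = (z - y)^-1 * (1 - (y / z) ^+ n.+1).
    rewrite -[1 - _]opprB subrX1 /Tk.
    have -> : \sum_(k < n.+1) y ^+ k * z^-1 ^+ k.+1 = z^-1 * \sum_(k < n.+1) (y / z) ^+ k.
      by rewrite mulr_sumr; apply: eq_bigr => k _; rewrite exprMn exprS; ring.
    by set S := \sum_(_ < _) _; field; rewrite z0 nx.
  have -> : (z - y)^-1 - (z - y)^-1 * (1 - (y / z) ^+ n.+1) = (z - y)^-1 * (y / z) ^+ n.+1 by ring.
  rewrite cabsM cabsX; apply: ler_pM; rewrite ?exprn_ge0 ?cabs_ge0 //.
  rewrite lerXn2r ?nnegrE ?cabs_ge0 ?divr_ge0 ?(ltW s0) // cabsM.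
  by apply: ler_pM; rewrite ?cabs_ge0 ?hx //; exact: ann_inv (he j jN).
have eta1 : eta <= 2 / s.
  rewrite /eta ler_piMr ?divr_ge0 ?(ltW s0) // exprn_ile1 ?divr_ge0 ?(ltW s0) //.
  by rewrite ler_pdivrMr // mul1r; lra.
have k1 j : (j < N)%N -> cabs (e j - x j)^-1 <= 2 / s.
  by move=> jN; have [] := kernel_bound s0 (hxs j jN) (he j jN).
rewrite [leRHS](_ : _ = N%:R * Q ^+ N * eta); last by rewrite /eta exprMn; ring.
apply: (@prod_diff_bound N (fun j => (e j - x j)^-1) (fun j => Tk (x j) (e j))) => // j jN.
  by apply: le_trans (k1 j jN) _; rewrite /Q; lra.
have -> : Tk (x j) (e j) = (e j - x j)^-1 - ((e j - x j)^-1 - Tk (x j) (e j)) by ring.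
apply: le_trans (cabsD _ _) _; rewrite cabsN /Q; have := k1 j jN; have := dif j jN; lra.
Qed.
End several_taylor.

(** * Weighted norms on polynomials in e and z *)

Section norms.
Variable R : realType.
Local Notation C := (Cx R).
Local Notation P := {poly {poly Cx R}}.
Implicit Types (p q : P).

(* The z-exponent m makes the radius of convergence in e shrink like cc/m: this
   is what makes e z d/dz bounded, by cc, for the weighted l1 norm. *)
Definition wt (lam cc : R) (i m : nat) : R := lam ^+ m * (cc / (maxn m 1)%:R) ^+ i.

(** The outer variable is [e], the inner one [z]. Exponents are cut at [D] to keep the sum finite;
    no bound below depends on [D]. *)
Definition wnorm (lam cc : R) D p : R :=
  \sum_(i < D) \sum_(m < D) cabs (p`_i`_m) * wt lam cc i m.

(** The pairs occurring in the first [D] coefficients of a Cauchy product form a triangle inside the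
    square of side [D]. *)
Lemma sum_triangle D (g : nat -> nat -> R) : (forall i j, 0 <= g i j) ->
  \sum_(i < D) \sum_(j < i.+1) g j (i - j)%N <= \sum_(j < D) \sum_(k < D) g j k.
Proof.
move=> g0.
have -> : \sum_(i < D) \sum_(j < i.+1) g j (i - j)%N = \sum_(i < D) \sum_(j < D | (j <= i)%N) g j (i - j)%N.
  apply: eq_bigr => i _.
  by rewrite (big_ord_widen_cond D (fun=> true) (fun j => g j (i - j)%N)).
rewrite (exchange_big_dep xpredT) //=; apply: ler_sum => j _.
rewrite -(big_mkord (fun i => (j <= i)%N) (fun i => g j (i - j)%N)).
have -> : \sum_(0 <= i < D | (j <= i)%N) g j (i - j)%N = \sum_(j <= i < D) g j (i - j)%N.
  rewrite (big_cat_nat _ (n := j)) //=; last exact: ltnW.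
  rewrite [X in X + _]big_nat_cond [X in X + _]big1 ?add0r; last first.
    by move=> i /andP[/andP[_ h]]; rewrite leqNgt h.
  rewrite big_nat_cond [RHS]big_nat_cond; apply: eq_bigl => i.
  by case: (j <= i)%N; rewrite ?andbT.
rewrite -{1}[X in \sum_(X <= i < D) _]add0n big_addn big_mkord.
rewrite [leRHS](bigID (fun k : 'I_D => (k < D - j)%N)) /=.
rewrite -[leLHS]addr0; apply: lerD; last by apply: sumr_ge0.
rewrite (big_ord_widen_cond D xpredT (fun k => g j (k + j - j)%N)) ?leq_subr //=.
by apply: ler_sum => k _; rewrite addnK.
Qed.

Lemma wt_ge0 (lam cc : R) i m : 0 <= lam -> 0 <= cc -> 0 <= wt lam cc i m.
Proof. by move=> l0 c0; rewrite mulr_ge0 ?exprn_ge0 // divr_ge0. Qed.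

(** The radius [cc / max(m, 1)] decreases with [m], so passing to [m1 + m2] only shrinks the two
    factors in [e]. *)
Lemma wt_submul (lam cc : R) i1 i2 m1 m2 : 0 <= lam -> 0 <= cc ->
  wt lam cc (i1 + i2) (m1 + m2) <= wt lam cc i1 m1 * wt lam cc i2 m2.
Proof.
move=> l0 c0; rewrite /wt !exprD [leRHS]mulrACA ler_wpM2l ?mulr_ge0 ?exprn_ge0 //.
have h a b : (1 <= a)%N -> (a <= b)%N -> cc / b%:R <= cc / a%:R.
  move=> a1 ab; rewrite ler_wpM2l // lef_pV2 ?posrE ?ltr0n ?ler_nat //.
  exact: leq_trans ab.
apply: ler_pM; rewrite ?exprn_ge0 ?divr_ge0 // lerXn2r ?nnegrE ?divr_ge0 //; apply: h;
  by rewrite ?leq_maxr // geq_max leq_max ?leq_addr ?leq_addl //= leq_maxr.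
Qed.

Section fixed.
Variables (lam cc : R).
Hypotheses (l0 : 0 <= lam) (c0 : 0 <= cc).
Variable D : nat.

Lemma wnorm_ge0 p : 0 <= wnorm lam cc D p.
Proof.
by apply: sumr_ge0 => i _; apply: sumr_ge0 => m _; rewrite mulr_ge0 ?cabs_ge0 ?wt_ge0.
Qed.

Lemma wnormD p q : wnorm lam cc D (p + q) <= wnorm lam cc D p + wnorm lam cc D q.
Proof.
rewrite /wnorm -big_split; apply: ler_sum => i _ /=.
rewrite -big_split; apply: ler_sum => m _ /=.
by rewrite !coefD -mulrDl ler_wpM2r ?wt_ge0 ?cabsD.
Qed.

Lemma wnorm0 : wnorm lam cc D 0 = 0.
Proof.
by apply: big1 => i _; apply: big1 => m _; rewrite !coef0 cabs0 mul0r.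
Qed.

Lemma wnorm_sum (I : Type) (r : seq I) (Q : pred I) (F : I -> P) :
  wnorm lam cc D (\sum_(i <- r | Q i) F i) <= \sum_(i <- r | Q i) wnorm lam cc D (F i).
Proof.
elim/big_rec2: _ => [|i x y _ h]; first by rewrite wnorm0.
by apply: le_trans (wnormD _ _) _; rewrite lerD2l.
Qed.

(** [wt_submul] termwise, then [sum_triangle] once for each of the two exponents. *)
Lemma wnormM p q : wnorm lam cc D (p * q) <= wnorm lam cc D p * wnorm lam cc D q.
Proof.
pose G i1 m1 i2 m2 := (cabs (p`_i1`_m1) * wt lam cc i1 m1) * (cabs (q`_i2`_m2) * wt lam cc i2 m2).
have G0 i1 m1 i2 m2 : 0 <= G i1 m1 i2 m2 by rewrite /G; apply: mulr_ge0; apply: mulr_ge0; rewrite ?cabs_ge0 ?wt_ge0.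
apply: (@le_trans _ _ (\sum_(i < D) \sum_(i1 < i.+1) \sum_(m < D) \sum_(m1 < m.+1) G i1 m1 (i - i1)%N (m - m1)%N)).
  apply: ler_sum => i _; rewrite exchange_big; apply: ler_sum => m _ /=.
  rewrite coefM coef_sum.
  apply: (@le_trans _ _ ((\sum_(i1 < i.+1) \sum_(m1 < m.+1) cabs (p`_i1`_m1) * cabs (q`_(i - i1)`_(m - m1))) * wt lam cc i m)).
    rewrite ler_wpM2r ?wt_ge0 //; apply: le_trans (cabs_sum _ _ _) _; apply: ler_sum => i1 _.
    rewrite coefM; apply: le_trans (cabs_sum _ _ _) _; apply: ler_sum => m1 _.
    by rewrite cabsM.
  rewrite mulr_suml; apply: ler_sum => i1 _; rewrite mulr_suml; apply: ler_sum => m1 _.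
  have hi : (i1 <= i)%N by rewrite -ltnS. have hm : (m1 <= m)%N by rewrite -ltnS.
  have := @wt_submul lam cc i1 (i - i1) m1 (m - m1) l0 c0; rewrite !subnKC // => h.
  rewrite /G [leRHS]mulrACA ler_wpM2l ?mulr_ge0 ?cabs_ge0 //.
apply: (@le_trans _ _ (\sum_(i < D) \sum_(i1 < i.+1) \sum_(m1 < D) \sum_(m2 < D) G i1 m1 (i - i1)%N m2)).
  apply: ler_sum => i _; apply: ler_sum => i1 _.
  exact: (@sum_triangle D (fun m1 m2 => G i1 m1 (i - i1)%N m2)).
apply: le_trans (@sum_triangle D (fun i1 i2 => \sum_(m1 < D) \sum_(m2 < D) G i1 m1 i2 m2) _) _.
  by move=> i j; apply: sumr_ge0 => m _; apply: sumr_ge0.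
rewrite /wnorm mulr_suml; apply: ler_sum => i1 _; rewrite mulr_sumr; apply: ler_sum => i2 _.
by rewrite mulr_suml; apply: ler_sum => m1 _; rewrite mulr_sumr; apply: ler_sum.
Qed.

Lemma wnorm_C (c : C) : wnorm lam cc D c%:P%:P <= cabs c.
Proof.
rewrite /wnorm; case: D => [|D']; first by rewrite big_ord0 cabs_ge0.
rewrite big_ord_recl [X in _ + X]big1 ?addr0; last first.
  by move=> i _; apply: big1 => m _; rewrite coefC /= coef0 cabs0 mul0r.
rewrite big_ord_recl [X in _ + X]big1 ?addr0; last first.
  by move=> m _; rewrite !coefC /= cabs0 mul0r.
by rewrite !coefC /= /wt !expr0 !mulr1.
Qed.

Lemma wnorm1 : wnorm lam cc D 1 <= 1.
Proof. by rewrite -[X in _ <= X](@cabs1 R) -polyC1 -polyC1; exact: wnorm_C. Qed.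

Lemma wnormX p n : wnorm lam cc D (p ^+ n) <= wnorm lam cc D p ^+ n.
Proof.
elim: n => [|n IH]; first by rewrite !expr0 wnorm1.
by rewrite !exprS; apply: le_trans (wnormM _ _) _; rewrite ler_wpM2l ?wnorm_ge0.
Qed.

Lemma wnorm_prod (I : Type) (r : seq I) (Q : pred I) (F : I -> P) (t : I -> R) :
  (forall i, wnorm lam cc D (F i) <= t i) ->
  wnorm lam cc D (\prod_(i <- r | Q i) F i) <= \prod_(i <- r | Q i) t i.
Proof.
move=> h; elim/big_rec2: _ => [|i x y _ hxy]; first exact: wnorm1.
by apply: le_trans (wnormM _ _) _; apply: ler_pM; rewrite ?wnorm_ge0.
Qed.

Lemma wnorm_eps : wnorm lam cc D 'X <= cc.
Proof.
have inner D2 (i : nat) : \sum_(m < D2) cabs (('X : P)`_i`_m) * wt lam cc i m <= if i == 1%N then cc else 0.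
  rewrite coefX; have [->|i1] := eqVneq i 1%N; last first.
    by rewrite big1 // => m _; rewrite coef0 cabs0 mul0r.
  case: D2 => [|D']; first by rewrite big_ord0.
  rewrite big_ord_recl [X in _ + X]big1 ?addr0; last first.
    by move=> m _; rewrite coefC /= cabs0 mul0r.
  by rewrite coefC /= cabs1 /wt expr0 expr1 !mul1r divr1.
rewrite /wnorm; apply: (@le_trans _ _ (\sum_(i < D) if val i == 1%N then cc else 0)).
  by apply: ler_sum => i _; exact: inner.
case: D => [|[|D']]; rewrite ?big_ord0 ?big_ord_recl ?big_ord0 /= ?addr0 //.
by rewrite add0r big1 ?addr0.
Qed.

Lemma wnorm_z : wnorm lam cc D 'X%:P <= lam.
Proof.
rewrite /wnorm; case: D => [|D']; first by rewrite big_ord0.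
rewrite big_ord_recl [X in _ + X]big1 ?addr0; last first.
  by move=> i _; apply: big1 => m _; rewrite coefC /= coef0 cabs0 mul0r.
rewrite coefC /=.
apply: (@le_trans _ _ (\sum_(m < D'.+1) if val m == 1%N then lam else 0)).
  apply: ler_sum => m _; rewrite coefX.
  have [m1|m1] := eqVneq (val m) 1%N; last by rewrite cabs0 mul0r.
  by rewrite cabs1 /wt m1 expr0 expr1 mulr1 mul1r.
case: D' => [|D']; rewrite ?big_ord_recl ?big_ord0 /= ?addr0 //.
by rewrite add0r big1 ?addr0.
Qed.
End fixed.
End norms.

(** * Orders of vanishing and of agreement *)

Section orders.
Variable R : realType.
Local Notation C := (Cx R).
Local Notation P := {poly {poly Cx R}}.
Implicit Types (p q u v : P).

(* Only e-exponents up to I matter, because the i-th equation sees the solution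
   truncated after e^i. *)
Definition vanish (I d : nat) p := forall k l, (k <= I)%N -> (k + l < d)%N -> p`_k`_l = 0.

Lemma vanish0 I d : vanish I d 0.
Proof. by move=> k l _ _; rewrite !coef0. Qed.

Lemma vanish_le I d d' p : (d <= d')%N -> vanish I d' p -> vanish I d p.
Proof. by move=> dd h k l kI kl; apply: h => //; exact: leq_trans dd. Qed.

Lemma vanishD I d p q : vanish I d p -> vanish I d q -> vanish I d (p + q).
Proof. by move=> hp hq k l kI kl; rewrite !coefD hp ?hq ?addr0. Qed.

Lemma vanishM I d e p q : vanish I d p -> vanish I e q -> vanish I (d + e) (p * q).
Proof.
move=> hp hq k l kI kl; rewrite coefM coef_sum; apply: big1 => k1 _.
rewrite coefM; apply: big1 => l1 _.
have k1k : (k1 <= k)%N by rewrite -ltnS.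
have l1l : (l1 <= l)%N by rewrite -ltnS.
have [h|h] := ltnP (k1 + l1) d; first by rewrite hp ?mul0r //; exact: leq_trans kI.
rewrite hq ?mulr0 //; first by rewrite (leq_trans _ kI) // leq_subr.
rewrite -(ltn_add2l d); apply: leq_ltn_trans kl.
apply: (@leq_trans ((k1 + l1) + (k - k1 + (l - l1)))); first by rewrite leq_add2r.
by rewrite addnACA !subnKC.
Qed.

(* The order of agreement grows with d under products: in a nonlinear term, the
   coefficients of degree K + 1 depend on those of degree at most K only. *)
Definition agree I K d u v := [/\ vanish I d u, vanish I d v & vanish I (K + d) (u - v)].

Lemma agree1 I K : agree I K 0 1 1.
Proof. by split=> //; rewrite ?subrr //; exact: vanish0. Qed.

Lemma agreeM I K d e u v u' v' : agree I K d u v -> agree I K e u' v' ->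
  agree I K (d + e) (u * u') (v * v').
Proof.
move=> [a1 a2 a3] [b1 b2 b3]; split; try exact: vanishM.
have -> : u * u' - v * v' = u * (u' - v') + (u - v) * v' by ring.
apply: vanishD; last by rewrite addnA; exact: vanishM.
by rewrite addnCA; exact: vanishM.
Qed.

Lemma agreeX I K d u v n : agree I K d u v -> agree I K (n * d) (u ^+ n) (v ^+ n).
Proof.
move=> h; elim: n => [|n IH]; first exact: agree1.
by rewrite !exprS mulSn; exact: agreeM.
Qed.

Lemma agree_prod I K N (X Y : nat -> P) (al : 'I_N -> nat) :
  (forall j, (j < N)%N -> agree I K 1 (X j) (Y j)) ->
  agree I K (\sum_j al j) (\prod_(j < N) X j ^+ al j) (\prod_(j < N) Y j ^+ al j).
Proof.
move=> h; apply: (big_ind3 (fun d u v => agree I K d u v)).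
- exact: agree1.
- by move=> *; exact: agreeM.
- by move=> j _; rewrite -[X in agree _ _ X]muln1; apply: agreeX; exact: h.
Qed.

(** A truncated power series evaluated in any commutative ring: in complex numbers with [id], in
    polynomials in [e] and [z] with [cst2]. *)
Definition Pol (T : comNzRingType) N n (cst : C -> T) (c : ('I_N -> nat) -> C) (X : nat -> T) : T :=
  \sum_(a : {ffun 'I_N -> 'I_n.+1}) cst (c (fun j => a j)) * \prod_(j < N) X j ^+ a j.

Definition cst2 (x : C) : P := x%:P%:P.

(* Entries 0 and 1 of the environment are e and z. *)
Definition weight N (a : 'I_N -> nat) : nat := \sum_(j < N) (if (j < 2)%N then (a j).*2 else a j).

(** A monomial of weight at least 2 either has at least two factors, and then agreement gains order
    2, or is [e] or [z] alone, where [X] and [Y] coincide. *)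
Lemma Pol_agree N n I K (c : ('I_N -> nat) -> C) (X Y : nat -> P) :
  (forall a, (weight a <= 1)%N -> c a = 0) ->
  (forall j, (j < 2)%N -> X j = Y j) ->
  (forall j, (j < N)%N -> agree I K 1 (X j) (Y j)) ->
  vanish I (K + 2) (Pol n cst2 c X - Pol n cst2 c Y).
Proof.
move=> hc h2 hXY; rewrite /Pol -sumrB.
apply: (@big_ind _ (vanish I (K + 2))); [exact: vanish0|by move=> *; exact: vanishD|].
move=> a _; rewrite -mulrBr.
have [w1|w1] := leqP (weight (fun j => a j)) 1.
  by rewrite hc // /cst2 mul0r; exact: vanish0.
rewrite -[(K + 2)%N]add0n; apply: vanishM => //.
have [s1|s1] := leqP (\sum_(j < N) (a j : nat)) 1; last first.
  have [_ _ h] := @agree_prod I K N X Y (fun j => a j) hXY.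
  by apply: vanish_le h; rewrite leq_add2l.
(* Total degree at most 1 with weight at least 2 excludes every [f]-entry, since such an entry would
   count only once. *)
have az (j : 'I_N) : (2 <= j)%N -> a j = 0%N :> nat.
  move=> j2; apply/eqP; rewrite -leqn0 -ltnS; apply: contraTT w1; rewrite -leqNgt => aj.
  rewrite -leqNgt; apply: (leq_trans _ s1); rewrite /weight; apply: leq_sum => i _.
  case: ifP => // i2.
  have : (a i + a j <= 1)%N.
    apply: (leq_trans _ s1); rewrite (bigD1 j) //= addnC leq_add2l (bigD1 i) ?leq_addr //.
    by apply: contraTneq i2 => ->; rewrite -leqNgt.
  rewrite -addnn; move: aj; lia.
rewrite [X in X - _](_ : _ = \prod_(j < N) Y j ^+ a j) ?subrr; first exact: vanish0.
apply: eq_bigr => j _; have [j2|j2] := ltnP j 2; first by rewrite h2.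
by rewrite az.
Qed.
End orders.

(** * The majorant estimate by induction on the total degree *)

Section majorant.
Variable R : realType.
Local Notation C := (Cx R).
Local Notation P := {poly {poly Cx R}}.

Definition Xenv (T : Type) (x0 x1 : T) (f : nat -> T) (n : nat) : T :=
  match n with 0%N => x0 | 1%N => x1 | j.+2 => f j end.

(** The truncation that the formal equation provides: solution up to [e^i], Taylor polynomials up to
    [z^n]. *)
Definition box_poly (al : nat -> nat -> nat -> C) i n j : P :=
  \poly_(k < i.+1) \poly_(l < n.+1) al k l j.

(** The truncation by total degree on which the induction runs; the square bounds [K.+1] only make
    it a polynomial. *)
Definition tri_poly (al : nat -> nat -> nat -> C) K j : P :=
  \poly_(k < K.+1) \poly_(l < K.+1) (if (k + l <= K)%N then al k l j else 0).

Lemma box_polyE al i n j k l : (box_poly al i n j)`_k`_l =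
  if (k <= i)%N && (l <= n)%N then al k l j else 0.
Proof.
rewrite coef_poly !ltnS; case: leqP => _ /=; last by rewrite coef0.
by rewrite coef_poly ltnS.
Qed.

Lemma tri_polyE al K j k l : (tri_poly al K j)`_k`_l = if (k + l <= K)%N then al k l j else 0.
Proof.
rewrite coef_poly ltnS; have [kK|kK] := leqP k K.
  rewrite coef_poly ltnS; have [//|lK] := leqP l K.
  by rewrite leqNgt (leq_trans lK) // leq_addl.
by rewrite coef0 leqNgt (leq_trans kK) // leq_addr.
Qed.

Lemma agree_Xenv al i n K j : (K <= n)%N -> (forall j, al 0%N 0%N j = 0) ->
  agree i K 1 (Xenv 'X 'X%:P (box_poly al i n) j) (Xenv 'X 'X%:P (tri_poly al K) j).
Proof.
move=> Kn al0.
have v0 : vanish i 1 ('X : P).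
  by move=> k l _; rewrite ltnS leqn0 addn_eq0 => /andP[/eqP -> _]; rewrite coefX coef0.
have v1 : vanish i 1 ('X%:P : P).
  by move=> k l _; rewrite ltnS leqn0 addn_eq0 => /andP[/eqP -> /eqP ->]; rewrite coefC coefX.
case: j => [|[|j]] /=; rewrite /agree ?subrr; split=> //; try exact: vanish0.
- move=> k l _; rewrite ltnS leqn0 addn_eq0 => /andP[/eqP -> /eqP ->].
  by rewrite box_polyE /= al0.
- move=> k l _; rewrite ltnS leqn0 addn_eq0 => /andP[/eqP -> /eqP ->].
  by rewrite tri_polyE /= al0.
- move=> k l ki kl; rewrite !coefB box_polyE tri_polyE ki /=.
  have -> : (k + l <= K)%N by lia.
  have -> : (l <= n)%N by lia.
  by rewrite subrr.
Qed.

(** Write [s^w = (2 s)^w 2^-w]. As [w >= 2], the first factor gives the small gain [(2 s)^2]; as [w]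
    is at least the degree, the second is summable over all exponents. *)
Lemma weight_gap (N : nat) (a : 'I_N -> nat) (s : R) : 0 <= s -> s <= 2^-1 -> (1 < weight a)%N ->
  s ^+ weight a <= (2 * s) ^+ 2 * \prod_j 2^-1 ^+ a j.
Proof.
move=> s0 s1 w1.
have -> : \prod_j (2^-1 : R) ^+ a j = 2^-1 ^+ (\sum_j a j) by rewrite expr_sum.
have -> : s ^+ weight a = (2 * s) ^+ weight a * 2^-1 ^+ weight a.
  by rewrite -exprMn; congr (_ ^+ _); field.
apply: ler_pM; rewrite ?exprn_ge0 ?mulr_ge0 ?invr_ge0 //.
  by apply: ler_wiXn2l => //; lra.
apply: ler_wiXn2l; rewrite ?invr_ge0 //; first by lra.
by apply: leq_sum => j _; case: ifP => // _; rewrite -addnn leq_addr.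
Qed.

(** With [e] and [z] of norm at most [r s^2] and [f] of norm at most [r s], a monomial of weight [w]
    contributes at most [M s^w]. The geometric series of ratio 1/2 gives a factor 2 for each of the
    [nu + 2] variables. *)
Lemma wnorm_Pol (nu n D : nat) (c : ('I_nu.+2 -> nat) -> C) (f : nat -> P) (r M s : R) :
  0 < r -> 0 <= M -> 0 <= s -> s <= 2^-1 ->
  (forall a, (weight a <= 1)%N -> c a = 0) ->
  (forall a, cabs (c a) <= M * \prod_j r^-1 ^+ a j) ->
  (forall j, (j < nu)%N -> wnorm (r * s ^+ 2) (r * s ^+ 2) D (f j) <= r * s) ->
  wnorm (r * s ^+ 2) (r * s ^+ 2) D (Pol n (@cst2 R) c (Xenv 'X 'X%:P f)) <=
    M * (2 * s) ^+ 2 * 2 ^+ nu.+2.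
Proof.
move=> r0 M0 s0 s1 hc hcM hf; set lam := r * s ^+ 2.
have l0 : 0 <= lam by rewrite mulr_ge0 ?exprn_ge0 // ltW.
pose tau (j : 'I_nu.+2) := if (j < 2)%N then lam else r * s.
have htau (j : 'I_nu.+2) : wnorm lam lam D (Xenv 'X 'X%:P f j) <= tau j.
  case: j => [[|[|j]]] hj; rewrite /tau /=; [exact: wnorm_eps|exact: wnorm_z|exact: hf].
have tau0 j : 0 <= tau j by apply: le_trans (htau j); exact: wnorm_ge0.
apply: le_trans (wnorm_sum _ _ _ _ _ _) _ => //.
apply: (@le_trans _ _ (\sum_(a : {ffun 'I_nu.+2 -> 'I_n.+1}) M * (2 * s) ^+ 2 * \prod_j 2^-1 ^+ a j)).
  apply: ler_sum => a _.
  apply: (@le_trans _ _ (cabs (c (fun j => a j)) * \prod_j tau j ^+ a j)).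
    apply: le_trans (wnormM _ _ _ _ _) _ => //.
    apply: ler_pM; rewrite ?wnorm_ge0 ?wnorm_C //.
    apply: (@wnorm_prod R _ _ _ _ _ _ _ _ _ (fun j : 'I_nu.+2 => tau j ^+ a j)) => // j.
    by apply: le_trans (wnormX _ _ _ _ _) _ => //; rewrite lerXn2r ?nnegrE ?wnorm_ge0.
  have p0 : 0 <= \prod_j tau j ^+ a j by apply: prodr_ge0 => j _; exact: exprn_ge0.
  have q0 : 0 <= \prod_j (2^-1 : R) ^+ a j.
    by apply: prodr_ge0 => j _; rewrite exprn_ge0 // invr_ge0.
  have [w1|w1] := leqP (weight (fun j => a j)) 1.
    by rewrite hc // cabs0 mul0r mulr_ge0 // mulr_ge0 // exprn_ge0 // mulr_ge0.
  apply: le_trans (ler_wpM2r p0 (hcM _)) _; rewrite -[leLHS]mulrA -[leRHS](mulrA M) ler_wpM2l //.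
  rewrite -big_split /=.
  apply: (le_trans _ (weight_gap s0 s1 w1)).
  rewrite /weight expr_sum le_eqVlt; apply/orP; left; apply/eqP; apply: eq_bigr => j _.
  rewrite -exprMn /tau; case: ifP => _; last by rewrite mulrA mulVf ?mul1r ?gt_eqF.
  by rewrite /lam mulrA mulVf ?mul1r ?gt_eqF // -exprM mul2n.
rewrite -mulr_sumr ler_wpM2l ?mulr_ge0 ?exprn_ge0 ?mulr_ge0 //.
rewrite -(bigA_distr_bigA (fun (j : 'I_nu.+2) (k : 'I_n.+1) => (2^-1 : R) ^+ k)) /=.
rewrite -[nu.+2 in leRHS]card_ord -prodr_const.
apply: ler_prod => j _; apply/andP; split.
  by apply: sumr_ge0 => k _; rewrite exprn_ge0 // invr_ge0.
have := subrX1 (2^-1 : R) n.+1; set S := \sum_(_ < _) _ => h.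
have : 0 <= (2^-1 : R) ^+ n.+1 by rewrite exprn_ge0 // invr_ge0.
lra.
Qed.

(** [A] is inverted in the equations of total degree at most [K + 1], whose other terms involve only
    the solution up to degree [K]; a small [s] then reproduces the bound [r s]. *)
Theorem majorant nu (al : nat -> nat -> nat -> C) (A : 'M[C]_nu)
    (c : 'I_nu -> ('I_nu.+2 -> nat) -> C) (r M : R) :
  A \in unitmx -> 0 < r -> 0 <= M -> (forall j, al 0%N 0%N j = 0) ->
  (forall k a, (weight a <= 1)%N -> c k a = 0) ->
  (forall k a, cabs (c k a) <= M * \prod_j r^-1 ^+ a j) ->
  (forall i m n (k : 'I_nu), (i + m <= n)%N ->
    (if i is i'.+1 then m%:R * al i' m k else 0) =
    \sum_(j < nu) al i m j * A j k +
      (Pol n (@cst2 R) (c k) (Xenv 'X 'X%:P (box_poly al i n)))`_i`_m) ->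
  exists del lam cc : R, [/\ 0 < lam, 0 < cc &
    forall i m (j : 'I_nu), cabs (al i m j) * wt lam cc i m <= del].
Proof.
move=> Au r0 M0 al0 hc hcM rel.
pose B : R := \sum_(j < nu) \sum_(k < nu) cabs (invmx A k j) + 1.
have B0 : 1 <= B.
  by rewrite lerDr; apply: sumr_ge0 => j _; apply: sumr_ge0 => k _; exact: cabs_ge0.
(* The new bound is [B (r^2 s^3 + 4 M s^2 2^(nu+2))]; since [s <= 1] it is at most [s (s Z)], so
   [s Z <= r] closes the induction. *)
pose Z := B * (r ^+ 2 + 4 * M * 2 ^+ nu.+2) + 1.
have T0 : 0 <= r ^+ 2 + 4 * M * 2 ^+ nu.+2.
  apply: addr_ge0; first by rewrite exprn_ge0 // ltW.
  by apply: mulr_ge0; [exact: mulr_ge0|exact: exprn_ge0].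
have Z0 : 1 <= Z by rewrite lerDr mulr_ge0 //; lra.
have [s [s0 s1 s2]] : exists s : R, [/\ 0 < s, s <= 2^-1 & s * Z <= r].
  exists (Num.min 2^-1 (r / Z)); split.
  - rewrite lt_min invr_gt0 ltr0n /= divr_gt0 //; lra.
  - by rewrite ge_min lexx.
  - by rewrite -ler_pdivlMr ?ge_min ?lexx ?orbT //; lra.
pose lam := r * s ^+ 2.
have lam0 : 0 < lam by rewrite mulr_gt0 // exprn_gt0.
have l0 := ltW lam0.
(* The norm of [tri_poly]: [K] limits the total degree and carries the induction, [D] limits each
   exponent. *)
pose S D K j : R := \sum_(k < D) \sum_(l < D)
   (if (k + l <= K)%N then cabs (al k l j) * wt lam lam k l else 0).
have SE D K j : wnorm lam lam D (tri_poly al K j) = S D K j.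
  apply: eq_bigr => k _; apply: eq_bigr => l _; rewrite tri_polyE.
  by case: ifP => // _; rewrite cabs0 mul0r.
have w0 k l : 0 <= wt lam lam k l by exact: wt_ge0.
have bound D K : forall j, (j < nu)%N -> S D K j <= r * s.
  elim: K => [|K IH] j jnu.
    rewrite /S big1 ?mulr_ge0 ?(ltW r0) ?(ltW s0) // => k _; apply: big1 => l _.
    case: ifP => //; rewrite leqn0 addn_eq0 => /andP[/eqP -> /eqP ->].
    by rewrite al0 cabs0 mul0r.
  pose G (q : 'I_nu) : P := Pol K.+1 (@cst2 R) (c q) (Xenv 'X 'X%:P (tri_poly al K)).
  have hG q : wnorm lam lam D (G q) <= M * (2 * s) ^+ 2 * 2 ^+ nu.+2.
    by apply: wnorm_Pol (r0) M0 (ltW s0) s1 (hc q) (hcM q) _ => k hk; rewrite SE IH.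
  pose lhs k l (q : nat) : C := if k is k'.+1 then l%:R * al k' l q else 0.
  have solved k l : (k + l <= K.+1)%N -> cabs (al k l j) <=
      \sum_(q < nu) cabs (invmx A q (Ordinal jnu)) * (cabs (lhs k l q) + cabs ((G q)`_k`_l)).
    move=> kl; pose v : 'rV[C]_nu := \row_q al k l q.
    have vA : v *m A = \row_q (lhs k l q - (G q)`_k`_l).
      apply/rowP => q; rewrite !mxE /lhs (rel k l K.+1 q kl).
      (* In degree at most [K + 1] the nonlinear term sees only the solution up to degree [K], so
         the box may be replaced by the triangle. *)
      have -> : (Pol K.+1 (cst2 (R:=R)) (c q) (Xenv 'X 'X%:P (box_poly al k K.+1)))`_k`_l = (G q)`_k`_l.
        apply/eqP; rewrite -subr_eq0 -!coefB; apply/eqP.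
        apply: (@Pol_agree R _ K.+1 k K) => //; last by rewrite addn2 ltnS.
        + exact: hc.
        + by case=> [|[]].
        + by move=> q' _; apply: agree_Xenv.
      by rewrite addrK; apply: eq_bigr => q' _; rewrite mxE.
    have -> : al k l j = (v *m A *m invmx A) 0 (Ordinal jnu) by rewrite mulmxK // mxE.
    rewrite vA mxE; apply: le_trans (cabs_sum _ _ _) _; apply: ler_sum => q _.
    rewrite mxE cabsM mulrC ler_wpM2l ?cabs_ge0 //; apply: le_trans (cabsD _ _) _.
    by rewrite cabsN.
  (* The operator [e z d/dz] has norm at most [lam]: raising the exponent of [e] by one costs
     [lam / max(l, 1)], which absorbs the factor [l]. *)
  have shift (q : 'I_nu) : \sum_(k < D) \sum_(l < D)
     (if (k + l <= K.+1)%N then cabs (lhs k l q) * wt lam lam k l else 0) <= lam * S D K q.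
    pose f k := \sum_(l < D) (if (k + l <= K.+1)%N then cabs (lhs k l q) * wt lam lam k l else 0).
    pose g k := \sum_(l < D) (if (k + l <= K)%N then cabs (al k l q) * wt lam lam k l else 0).
    have g0 k : 0 <= g k.
      by apply: sumr_ge0 => l _; case: ifP => // _; rewrite mulr_ge0 ?cabs_ge0.
    have f0 : f 0%N = 0.
      by apply: big1 => l _; case: ifP => // _; rewrite /lhs cabs0 mul0r.
    have fg k : f k.+1 <= lam * g k.
      rewrite mulr_sumr; apply: ler_sum => l _; rewrite addSn ltnS; case: ifP => _; last by rewrite mulr0.
      rewrite /lhs cabsM cabsn.
      have hw : l%:R * wt lam lam k.+1 l <= lam * wt lam lam k l.
        have -> : lam * wt lam lam k l = lam * wt lam lam k l * 1 by rewrite mulr1.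
        have -> : l%:R * wt lam lam k.+1 l = lam * wt lam lam k l * (l%:R / (maxn l 1)%:R).
          by rewrite /wt exprS; ring.
        apply: ler_wpM2l; first by apply: mulr_ge0.
        by rewrite ler_pdivrMr ?mul1r ?ler_nat ?leq_maxl // ltr0n leq_maxr.
      rewrite (mulrC l%:R) -mulrA (mulrCA lam).
      by rewrite ler_wpM2l ?cabs_ge0.
    change (\sum_(k < D) f k <= lam * \sum_(k < D) g k).
    case: (D) => [|D']; first by rewrite !big_ord0 mulr0.
    rewrite big_ord_recl /= f0 add0r big_ord_recr /= mulrDr mulr_sumr.
    apply: (@le_trans _ _ (\sum_(i < D') lam * g i)); first by apply: ler_sum => i _; exact: fg.
    by rewrite lerDl mulr_ge0.
  apply: (@le_trans _ _ (\sum_(q < nu) cabs (invmx A q (Ordinal jnu)) *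
     (lam * S D K q + wnorm lam lam D (G q)))).
    apply: (@le_trans _ _ (\sum_(k < D) \sum_(l < D) \sum_(q < nu) cabs (invmx A q (Ordinal jnu)) *
      ((if (k + l <= K.+1)%N then cabs (lhs k l q) * wt lam lam k l else 0) + cabs (G q)`_k`_l * wt lam lam k l))).
      apply: ler_sum => k _; apply: ler_sum => l _; case: ifP => [kl|_]; last first.
        by apply: sumr_ge0 => q _; rewrite add0r; apply: mulr_ge0; [|apply: mulr_ge0]; rewrite ?cabs_ge0.
      apply: le_trans (ler_wpM2r (w0 _ _) (solved _ _ kl)) _.
      by rewrite mulr_suml; apply: ler_sum => q _; rewrite -mulrA mulrDl.
    under eq_bigr do rewrite exchange_big /=.
    rewrite exchange_big /=; apply: ler_sum => q _.
    under eq_bigr do rewrite -mulr_sumr big_split /=.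
    rewrite -mulr_sumr big_split /= ler_wpM2l ?cabs_ge0 // lerD2r.
    exact: shift.
  apply: (@le_trans _ _ (B * (lam * (r * s) + M * (2 * s) ^+ 2 * 2 ^+ nu.+2))).
    have q0 : 0 <= lam * (r * s) + M * (2 * s) ^+ 2 * 2 ^+ nu.+2.
      apply: addr_ge0; first by rewrite !mulr_ge0 // ltW.
      by apply: mulr_ge0; [apply: mulr_ge0 => //; exact: sqr_ge0|exact: exprn_ge0].
    apply: (@le_trans _ _ (\sum_(q < nu) cabs (invmx A q (Ordinal jnu)) *
         (lam * (r * s) + M * (2 * s) ^+ 2 * 2 ^+ nu.+2))).
      apply: ler_sum => q _; rewrite ler_wpM2l ?cabs_ge0 //; apply: lerD; last exact: hG.
      by rewrite ler_wpM2l // IH.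
    rewrite -mulr_suml ler_wpM2r // /B [X in _ <= X + 1](bigD1 (Ordinal jnu)) //= -addrA lerDl.
    by rewrite addr_ge0 //; apply: sumr_ge0 => q _; apply: sumr_ge0 => q' _; exact: cabs_ge0.
  have -> : B * (lam * (r * s) + M * (2 * s) ^+ 2 * 2 ^+ nu.+2) =
     s * (s * (B * (r ^+ 2 * s + 4 * M * 2 ^+ nu.+2))) by rewrite /lam; ring.
  rewrite (mulrC r) ler_wpM2l ?(ltW s0) //; apply: le_trans s2; rewrite ler_wpM2l ?(ltW s0) //.
  apply: (@le_trans _ _ (B * (r ^+ 2 + 4 * M * 2 ^+ nu.+2))); last by rewrite /Z lerDl.
  rewrite ler_wpM2l ?(le_trans _ B0) // lerD2r ler_piMr ?sqr_ge0 //.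
  by apply: le_trans s1 _; lra.
exists (r * s), lam, lam; split=> // i m j.
(* Degree [i + m] with exponents below [i + m + 1] suffices for the term [(i, m)] to occur; the
   other terms are nonnegative. *)
apply: le_trans (bound (i + m).+1 (i + m)%N j (ltn_ord j)).
have hi : (i < (i + m).+1)%N by rewrite ltnS leq_addr.
have hm : (m < (i + m).+1)%N by rewrite ltnS leq_addl.
have nn k l : 0 <= (if (k + l <= i + m)%N then cabs (al k l j) * wt lam lam k l else 0).
  by case: ifP => // _; rewrite mulr_ge0 ?cabs_ge0.
rewrite /S (bigD1 (Ordinal hi)) //= (bigD1 (Ordinal hm)) //= leqnn -addrA lerDl.
rewrite addr_ge0 //; first by apply: sumr_ge0 => l _; exact: nn.
by apply: sumr_ge0 => k _; apply: sumr_ge0 => l _; exact: nn.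
Qed.
End majorant.

(** * The formal equation *)

Section formal.
Variable R : realType.
Local Notation C := (Cx R).
Local Notation P2 := {poly {poly Cx R}}.

Definition ev (e z : C) (p : P2) : C := (map_poly (horner_eval z) p).[e].

Lemma evD e z p q : ev e z (p + q) = ev e z p + ev e z q.
Proof. by rewrite /ev rmorphD hornerD. Qed.
Lemma evM e z p q : ev e z (p * q) = ev e z p * ev e z q.
Proof. by rewrite /ev rmorphM hornerM. Qed.
Lemma ev0 e z : ev e z 0 = 0.
Proof. by rewrite /ev rmorph0 horner0. Qed.
Lemma ev1 e z : ev e z 1 = 1.
Proof. by rewrite /ev rmorph1 hornerC. Qed.
Lemma evX e z p n : ev e z (p ^+ n) = ev e z p ^+ n.
Proof. by rewrite /ev rmorphXn horner_exp. Qed.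
Lemma ev_sum e z (I : Type) (r : seq I) (Q : pred I) (F : I -> P2) :
  ev e z (\sum_(i <- r | Q i) F i) = \sum_(i <- r | Q i) ev e z (F i).
Proof. exact: (big_morph _ (evD e z) (ev0 e z)). Qed.
Lemma ev_prod e z (I : Type) (r : seq I) (Q : pred I) (F : I -> P2) :
  ev e z (\prod_(i <- r | Q i) F i) = \prod_(i <- r | Q i) ev e z (F i).
Proof. exact: (big_morph _ (evM e z) (ev1 e z)). Qed.
Lemma ev_eps e z : ev e z 'X = e.
Proof. by rewrite /ev map_polyX hornerX. Qed.
Lemma ev_C e z (p : {poly C}) : ev e z p%:P = p.[z].
Proof. by rewrite /ev map_polyC /= hornerC. Qed.

Lemma ev_Pol e z N n (c : ('I_N -> nat) -> C) (X : nat -> P2) :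
  ev e z (Pol n (@cst2 R) c X) = Pol n id c (fun j => ev e z (X j)).
Proof.
rewrite /Pol ev_sum; apply: eq_bigr => a _; rewrite evM ev_C hornerC; congr (_ * _).
by rewrite ev_prod; apply: eq_bigr => j _; rewrite evX.
Qed.

Lemma ev_box e z al i n j : ev e z (box_poly al i n j) =
  \sum_(q < i.+1) e ^+ q * \sum_(l < n.+1) al q l j * z ^+ l.
Proof.
rewrite /box_poly poly_def ev_sum; apply: eq_bigr => q _.
by rewrite -mul_polyC evM ev_C evX ev_eps mulrC horner_poly.
Qed.

Lemma horner_bound (p : {poly C}) z : cabs z <= 1 -> cabs p.[z] <= \sum_(i < size p) cabs p`_i.
Proof.
move=> z1; rewrite horner_coef; apply: le_trans (cabs_sum _ _ _) _; apply: ler_sum => i _.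
by rewrite cabsM cabsX ler_piMr ?cabs_ge0 // exprn_ile1 ?cabs_ge0.
Qed.

Lemma small_eq0 (c : C) (K r : R) : 0 < r ->
  (forall z : C, z != 0 -> cabs z <= r -> cabs c <= K * cabs z) -> c = 0.
Proof.
move=> r0 h; apply/eqP; rewrite -cabs_eq0 eq_le cabs_ge0 andbT.
apply/ler_addgt0Pl => e e0; rewrite addr0.
have K0 : 0 < `|K| + 1 by rewrite ltr_pwDr.
pose t := Num.min r (e / (`|K| + 1)).
have t0 : 0 < t by rewrite lt_min r0 divr_gt0.
have ct : cabs (rc t) = t by rewrite cabs_rc gtr0_norm.
have := h (rc t); rewrite -cabs_gt0 ct => /(_ t0); rewrite ge_min lexx => /(_ isT) h1.
apply: le_trans h1 _; apply: (@le_trans _ _ ((`|K| + 1) * t)).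
  by rewrite ler_wpM2r ?(ltW t0) //; have := ler_norm K; lra.
by rewrite mulrC -ler_pdivlMr // ge_min lexx orbT.
Qed.

(** Letting [z] tend to 0 kills the constant term; dividing by [z], which is why [z = 0] is
    excluded, lowers [d]. *)
Lemma poly_small (p : {poly C}) (K r : R) d : 0 < r ->
  (forall z : C, z != 0 -> cabs z <= r -> cabs p.[z] <= K * cabs z ^+ d) ->
  forall m, (m < d)%N -> p`_m = 0.
Proof.
move=> r0; elim: d p => // d IH p.
have [q [c ->]] : exists q c, p = q * 'X + c%:P.
  by elim/poly_ind: p => [|q c _]; [exists 0, 0; rewrite mul0r addr0|exists q, c].
move=> h.
pose B := \sum_(i < size q) cabs q`_i.
have c0 : c = 0.
  apply: (@small_eq0 c (`|K| + B) (Num.min r 1)); first by rewrite lt_min r0 ltr01.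
  move=> z z0; rewrite le_min => /andP[zr z1].
  have := h z z0 zr; rewrite !hornerE => h1.
  have h2 : cabs (q.[z] * z) <= B * cabs z.
    by rewrite cabsM ler_wpM2r ?cabs_ge0 // horner_bound.
  have h3 : K * cabs z ^+ d.+1 <= `|K| * cabs z.
    apply: (@le_trans _ _ (`|K| * cabs z ^+ d.+1)).
      by rewrite ler_wpM2r ?exprn_ge0 ?cabs_ge0 // ler_norm.
    by rewrite ler_wpM2l // exprS ler_piMr ?cabs_ge0 // exprn_ile1 ?cabs_ge0.
  have -> : c = (q.[z] * z + c) + - (q.[z] * z) by ring.
  by apply: le_trans (cabsD _ _) _; rewrite cabsN; lra.
case=> [|m]; rewrite ltnS => md; rewrite c0 addr0 coefMX //=.
apply: IH => // z z0 zr; have := h z z0 zr; rewrite c0 addr0 !hornerE cabsM exprSr mulrA.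
by rewrite ler_pM2r ?cabs_gt0.
Qed.
End formal.

(** * Estimates near the origin in the region [|e| <= 2|z|] *)

Section bigO.
Variable R : realType.
Local Notation C := (Cx R).
Implicit Types (h g u v : C -> C -> C).

(** In this region [e] and [z] both count with order 1, and it contains the contour of size [|z|] in
    the [e]-plane used to extract the coefficient of [e^i]. *)
Definition OO (d : nat) h := exists K r : R, [/\ 0 <= K, 0 < r &
  forall e z, cabs z <= r -> cabs e <= 2 * cabs z -> cabs (h e z) <= K * cabs z ^+ d].

Lemma OO_D d h g : OO d h -> OO d g -> OO d (fun e z => h e z + g e z).
Proof.
move=> [K [r [K0 r0 hK]]] [K' [r' [K'0 r'0 hK']]]; exists (K + K'), (Num.min r r').
split; [exact: addr_ge0|by rewrite lt_min r0|].
move=> e z; rewrite le_min => /andP[zr zr'] ez.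
by apply: le_trans (cabsD _ _) _; rewrite mulrDl lerD ?hK ?hK'.
Qed.

Lemma OO_M d d' h g : OO d h -> OO d' g -> OO (d + d') (fun e z => h e z * g e z).
Proof.
move=> [K [r [K0 r0 hK]]] [K' [r' [K'0 r'0 hK']]]; exists (K * K'), (Num.min r r').
split; [exact: mulr_ge0|by rewrite lt_min r0|].
move=> e z; rewrite le_min => /andP[zr zr'] ez.
by rewrite cabsM exprD mulrACA ler_pM ?cabs_ge0 ?hK ?hK'.
Qed.

Lemma OO_cst c : OO 0 (fun _ _ => c).
Proof.
exists (cabs c), 1; split; rewrite ?cabs_ge0 // => e z _ _.
by rewrite expr0 mulr1.
Qed.

Lemma OO_zero d : OO d (fun _ _ => 0).
Proof. by exists 0, 1; split => // e z _ _; rewrite cabs0 mul0r. Qed.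

Lemma OO_N d h : OO d h -> OO d (fun e z => - h e z).
Proof. by move=> [K [r [? ? hK]]]; exists K, r; split => // e z *; rewrite cabsN hK. Qed.

Lemma OO_B d h g : OO d h -> OO d g -> OO d (fun e z => h e z - g e z).
Proof. by move=> H G; apply: OO_D => //; exact: OO_N. Qed.

Lemma OO_le d d' h : (d' <= d)%N -> OO d h -> OO d' h.
Proof.
move=> dd [K [r [K0 r0 hK]]]; exists K, (Num.min r 1); split=> //; first by rewrite lt_min r0 ltr01.
move=> e z; rewrite le_min => /andP[zr z1] ez; apply: le_trans (hK _ _ zr ez) _.
by rewrite ler_wpM2l // ler_wiXn2l ?cabs_ge0.
Qed.

Lemma OO_eps : OO 1 (fun e _ => e).
Proof. by exists 2, 1; split => // e z _ h; rewrite expr1. Qed.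

Lemma OO_z : OO 1 (fun _ z => z).
Proof. by exists 1, 1; split => // e z _ h; rewrite expr1 mul1r. Qed.

Lemma OO_sum d (I : Type) (r : seq I) (F : I -> C -> C -> C) :
  (forall i, OO d (F i)) -> OO d (fun e z => \sum_(i <- r) F i e z).
Proof.
move=> h; elim: r => [|i r IH].
  have -> : (fun e z => \sum_(i <- [::]) F i e z) = (fun _ _ => 0).
    by apply: funext => e; apply: funext => z; rewrite big_nil.
  exact: OO_zero.
have -> : (fun e z => \sum_(i <- i :: r) F i e z) = (fun e z => F i e z + \sum_(i <- r) F i e z).
  by apply: funext => e; apply: funext => z; rewrite big_cons.
exact: OO_D.
Qed.

Lemma OO_ext d h g : (forall e z, h e z = g e z) -> OO d h -> OO d g.
Proof. by move=> e; suff -> : h = g by []; apply: funext => x; apply: funext => y. Qed.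

Definition close d u v := [/\ OO 0 u, OO 0 v & OO d (fun e z => u e z - v e z)].

Lemma close_refl d u : OO 0 u -> close d u u.
Proof. by move=> h; split => //; apply: OO_ext (OO_zero d) => e z; rewrite subrr. Qed.

Lemma closeM d u v u' v' : close d u v -> close d u' v' ->
  close d (fun e z => u e z * u' e z) (fun e z => v e z * v' e z).
Proof.
move=> [a1 a2 a3] [b1 b2 b3]; split; try exact: (@OO_M 0 0).
apply: (@OO_ext _ (fun e z => u e z * (u' e z - v' e z) + (u e z - v e z) * v' e z)).
  by move=> e z; ring.
by apply: OO_D; [exact: (@OO_M 0 d)|rewrite -[d]addn0; exact: (@OO_M d 0)].
Qed.

Lemma closeX d u v n : close d u v -> close d (fun e z => u e z ^+ n) (fun e z => v e z ^+ n).
Proof.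
move=> h; elim: n => [|n IH]; first exact: close_refl (OO_cst 1).
have eX w : (fun e z => w e z ^+ n.+1) = (fun e z => w e z * w e z ^+ n) :> (C -> C -> C).
  by apply: funext => e; apply: funext => z; rewrite exprS.
by rewrite !eX; exact: closeM.
Qed.

Lemma close_prod d (I : Type) (r : seq I) (F G : I -> C -> C -> C) :
  (forall i, close d (F i) (G i)) ->
  close d (fun e z => \prod_(i <- r) F i e z) (fun e z => \prod_(i <- r) G i e z).
Proof.
move=> h; elim: r => [|i r IH].
  have eP (H : I -> C -> C -> C) : (fun e z => \prod_(i <- [::]) H i e z) = (fun _ _ => 1).
    by apply: funext => e; apply: funext => z; rewrite big_nil.
  by rewrite !eP; exact: close_refl (OO_cst 1).
have eP (H : I -> C -> C -> C) : (fun e z => \prod_(i <- i :: r) H i e z) = (fun e z => H i e z * \prod_(i <- r) H i e z).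
  by apply: funext => e; apply: funext => z; rewrite big_cons.
by rewrite !eP; exact: closeM.
Qed.

Lemma OO_Pol d N n (c : ('I_N -> nat) -> C) (X Y : C -> C -> nat -> C) :
  (forall j, (j < N)%N -> close d (fun e z => X e z j) (fun e z => Y e z j)) ->
  OO d (fun e z => Pol n id c (X e z) - Pol n id c (Y e z)).
Proof.
move=> h; rewrite /Pol.
apply: (@OO_ext _ (fun e z => \sum_(a : {ffun 'I_N -> 'I_n.+1}) c (fun j => a j) *
    (\prod_(j < N) X e z j ^+ a j - \prod_(j < N) Y e z j ^+ a j))).
  by move=> e z; rewrite -sumrB; apply: eq_bigr => a _; rewrite mulrBr.
apply: OO_sum => a; apply: (@OO_M 0 d); first exact: OO_cst.
have cX (j : 'I_N) : close d (fun e z => X e z j ^+ a j) (fun e z => Y e z j ^+ a j).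
  by apply: (@closeX d (fun e z => X e z j) (fun e z => Y e z j)); exact: h.
by case: (@close_prod d 'I_N (index_enum _) (fun j e z => X e z j ^+ a j) (fun j e z => Y e z j ^+ a j) cX).
Qed.
End bigO.

(** * From the equation between functions to relations between coefficients *)

Section relation.
Variable R : realType.
Local Notation C := (Cx R).
Local Notation env := (nat -> C).

Lemma OO_box N (X : C -> C -> env) : (forall j, (j < N)%N -> OO 1 (fun e z => X e z j)) ->
  exists K r : R, [/\ 0 <= K, 0 < r & forall e z, cabs z <= r -> cabs e <= 2 * cabs z ->
    boxN N (K * cabs z) (X e z)].
Proof.
elim: N => [|N IH] h; first by exists 0, 1.
have [|K [r [K0 r0 hK]]] := IH; first by move=> j jN; apply: h; exact: ltnW.
have [K' [r' [K'0 r'0 hK']]] := h N (ltnSn N).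
exists (K + K'), (Num.min r r'); split; [exact: addr_ge0|by rewrite lt_min r0|].
move=> e z; rewrite le_min => /andP[zr zr'] ez j; rewrite ltnS leq_eqVlt => /orP[/eqP ->|jN].
  by apply: le_trans (hK' _ _ zr' ez) _; rewrite expr1 ler_wpM2r ?cabs_ge0 // lerDr.
by apply: le_trans (hK _ _ zr ez j jN) _; rewrite ler_wpM2r ?cabs_ge0 // lerDl.
Qed.

(** An explicit radius and bound, as the Cauchy estimates require; [local_holo_near] gets the bound
    from continuity at 0. *)
Definition local_holo (f : C -> C) := exists r B : R, [/\ 0 < r,
  forall z, cabs z <= 2 * r -> differentiable f z & forall z, cabs z <= 2 * r -> cabs (f z) <= B].

Lemma OO_taylor (f : C -> C) n : local_holo f ->
  OO n.+1 (fun _ z => f z - \sum_(l < n.+1) tcoef f l * z ^+ l).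
Proof.
move=> [r [B [r0 hd hB]]].
have B0 : 0 <= B by apply: le_trans (cabs_ge0 _) (hB 0 _); rewrite cabs0; lra.
exists (4 * B * r^-1 ^+ n.+1), (r / 2); split; last 1 first.
- move=> _ z zr _; apply: le_trans (taylor_bound r0 hd hB n zr) _.
  by rewrite exprMn le_eqVlt; apply/orP; left; apply/eqP; ring.
- by rewrite mulr_ge0 ?exprn_ge0 ?invr_ge0 ?(ltW r0) // mulr_ge0.
- by rewrite divr_gt0.
Qed.

Lemma tcoef0 (f : C -> C) : tcoef f 0 = f 0.
Proof. by rewrite /tcoef derive1n0 invr1 mul1r. Qed.

Lemma OO_bounded (f : C -> C) : local_holo f -> OO 0 (fun _ z => f z).
Proof.
move=> [r [B [r0 hd hB]]].
exists B, r; split => //; last by move=> e z zr _; rewrite expr0 mulr1 hB //; have := cabs_ge0 z; lra.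
by apply: le_trans (cabs_ge0 _) (hB 0 _); rewrite cabs0; lra.
Qed.

Lemma local_holo_near (f : C -> C) : (\forall z \near (0 : C), differentiable f z) -> local_holo f.
Proof.
move=> /nbhs_cabs[d1 d10 hd].
have d0 : differentiable f 0 by apply: hd; rewrite subrr cabs0.
have /cvgrPdist_le/(_ (rc 1)) := differentiable_continuous d0; rewrite -(rc0 R) rc_lt ltr01 => /(_ isT).
rewrite rc0 => /nbhs_cabs[del del0 hdel].
pose t := Num.min (d1 / 8) (del / 4).
have t0 : 0 < t by rewrite lt_min !divr_gt0.
have tr : t <= d1 / 8 by rewrite ge_min lexx.
have td : t <= del / 4 by rewrite ge_min lexx orbT.
exists t, (cabs (f 0) + 1); split; [exact: t0| |] => z hz.
  by apply: hd; rewrite subr0; lra.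
have := hdel z; rewrite subr0 normE rc_le cabsC => h.
rewrite -(subrK (f 0) (f z)); apply: le_trans (cabsD _ _) _.
rewrite addrC lerD2l; apply: h; lra.
Qed.

Lemma derive1_local (f : C -> C) : local_holo f -> exists2 f', local_holo f' &
  (\forall z \near (0 : C), f' z = derive1 f z) /\ forall l, tcoef f' l = l.+1%:R * tcoef f l.+1.
Proof.
move=> [r [B [r0 hd hB]]].
exists (derive1 f); last first.
  split; first by apply/nbhs_cabs; exists 1.
  move=> l; have l0 : l.+1%:R != 0 :> C by rewrite pnatr_eq0.
  by rewrite /tcoef -derive1Sn factS natrM invfM mulrA (mulrA l.+1%:R) mulfV ?mul1r.
have dd := differentiable_derive1n r0 hd hB 1; rewrite derive1n1 in dd.
apply: local_holo_near; apply/nbhs_cabs; exists (r / 2); first by rewrite divr_gt0.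
by move=> z; rewrite subr0; exact: dd.
Qed.

(* F along the truncated solution and its Taylor polynomial differ by
   O(|z|^(n+1)) for |e| <= 2|z|; Cauchy's estimate for the e^i coefficient on the
   contour |e| ~ |z| loses a factor |z|^i. *)
Theorem formal_relation nu (k : nat) (s : R) (H : env -> C) (A : 'I_nu -> C)
    (c : ('I_nu.+2 -> nat) -> C) (a : nat -> nat -> C -> C) :
  0 < s ->
  (forall n, exists K : R, forall x (t : R), t <= s / 2 -> boxN nu.+2 t x -> 0 <= t ->
     cabs (H x - (\sum_(j < nu) x j.+2 * A j + Pol n id c x)) <= K * t ^+ n.+1) ->
  (exists B, forall x, boxN nu.+2 (s / 2) x -> cabs (H x) <= B) ->
  (forall i j, local_holo (a i j)) ->
  (forall j, a 0%N j 0 = 0) ->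
  let curve i e z := Xenv e z (fun j => \sum_(q < i.+1) e ^+ q * a q j z) in
  (forall i e z, boxN nu.+2 (s / 2) (curve i e z) ->
     differentiable (fun e : C => H (curve i e z)) e) ->
  (forall i, \forall z \near (0 : C), z != 0 ->
     (forall e, cabs e <= 2 * cabs z -> boxN nu.+2 (s / 2) (curve i e z)) ->
     (if i is i'.+1 then z * derive1 (a i' k) z else 0) =
     tcoef (fun e => H (curve i e z)) i) ->
  forall i m n, (i + m <= n)%N ->
    (if i is i'.+1 then m%:R * tcoef (a i' k) m else 0) =
    \sum_(j < nu) tcoef (a i j) m * A j +
    (Pol n (@cst2 R) c (Xenv 'X 'X%:P (box_poly (fun i m j => tcoef (a i j) m) i n)))`_i`_m.
Proof.
move=> s0 hT [B hB] ha a0 curve hd heq i m n imn.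
pose al i m j := tcoef (a i j) m.
pose fa j (e z : C) := \sum_(q < i.+1) e ^+ q * a q j z.
pose fb j (e z : C) := \sum_(q < i.+1) e ^+ q * \sum_(l < n.+1) al q l j * z ^+ l.
have Oeps q : OO 0 (fun e _ : C => e ^+ q).
  by case: (@closeX R 0 (fun e _ => e) (fun e _ => e) q) => //; apply: close_refl; exact: OO_le (@OO_eps R).
have Oa1 j : OO 1 (fa j).
  rewrite /fa; apply: OO_sum => q; case: q => [[|q] hq] /=.
    apply: (@OO_M R 0 1) => //; apply: OO_ext (OO_taylor 0 (ha 0%N j)) => e z.
    by rewrite big_ord1 expr0 mulr1 tcoef0 a0 subr0.
  apply: (@OO_ext R _ (fun e z => e * (e ^+ q * a q.+1 j z))).
    by move=> e z; rewrite exprS mulrA.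
  apply: (@OO_M R 1 0); first exact: OO_eps.
  by apply: (@OO_M R 0 0) => //; exact: OO_bounded.
have Oab j : OO n.+1 (fun e z => fa j e z - fb j e z).
  apply: (@OO_ext R _ (fun e z => \sum_(q < i.+1) e ^+ q * (a q j z - \sum_(l < n.+1) al q l j * z ^+ l))).
    by move=> e z; rewrite -sumrB; apply: eq_bigr => q _; rewrite mulrBr.
  by apply: OO_sum => q; apply: (@OO_M R 0 n.+1) => //; exact: OO_taylor.
have cab j : close n.+1 (fa j) (fb j).
  have h0 : OO 0 (fa j) by exact: OO_le (Oa1 j).
  split => //; apply: (@OO_ext R _ (fun e z => fa j e z - (fa j e z - fb j e z))); first by move=> e z; ring.
  by apply: OO_B => //; exact: OO_le (Oab j).
pose X e z := Xenv e z (fun j => fa j e z).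
pose Y e z := Xenv e z (fun j => fb j e z).
have cXY j : close n.+1 (fun e z => X e z j) (fun e z => Y e z j).
  case: j => [|[|j]] /=; [| |exact: cab].
  - by apply: close_refl; exact: OO_le (@OO_eps R).
  - by apply: close_refl; exact: OO_le (@OO_z R).
have OX j : OO 1 (fun e z => X e z j).
  case: j => [|[|j]] /=; [exact: OO_eps|exact: OO_z|exact: Oa1].
have [K1 [r1 [K10 r10 hK1]]] := @OO_box nu.+2 X (fun j _ => OX j).
(* The right-hand side along the Taylor polynomials of the solution, as a polynomial whose
   coefficients can be read off. *)
pose PP : {poly {poly C}} := \sum_(j < nu) box_poly al i n j * cst2 (A j) +
   Pol n (@cst2 R) c (Xenv 'X 'X%:P (box_poly al i n)).
have evY e z j : ev e z (Xenv 'X 'X%:P (box_poly al i n) j) = Y e z j.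
  by case: j => [|[|j]] /=; rewrite ?ev_eps ?ev_C ?hornerX // ev_box.
have evP e z : ev e z PP = \sum_(j < nu) Y e z j.+2 * A j + Pol n id c (Y e z).
  rewrite evD ev_Pol ev_sum; congr (_ + _).
    by apply: eq_bigr => j _; rewrite evM ev_C hornerC -evY.
  by congr (Pol n id c _); apply: funext => j; exact: evY.
have [KT hKT] := hT n.
pose r2 := Num.min r1 (s / 2 / (K1 + 1)).
have r20 : 0 < r2 by rewrite lt_min r10 !divr_gt0 //; lra.
have K1s z : cabs z <= r2 -> K1 * cabs z <= s / 2.
  rewrite le_min => /andP[_]; rewrite ler_pdivlMr; last by lra.
  by have := cabs_ge0 z; nra.
have r21 : r2 <= r1 by rewrite ge_min lexx.
clearbody r2.
(* Three errors: the Taylor remainder of [H], then the changes in the linear part and in [Pol] when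
   the solution is replaced by its Taylor polynomials. *)
have OD : OO n.+1 (fun e z => H (X e z) - ev e z PP).
  apply: (@OO_ext R _ (fun e z => (H (X e z) - (\sum_(j < nu) X e z j.+2 * A j + Pol n id c (X e z)))
     + (\sum_(j < nu) (X e z j.+2 - Y e z j.+2) * A j + (Pol n id c (X e z) - Pol n id c (Y e z))))).
    move=> e z; rewrite evP.
    have -> : \sum_(j < nu) (X e z j.+2 - Y e z j.+2) * A j =
      \sum_(j < nu) X e z j.+2 * A j - \sum_(j < nu) Y e z j.+2 * A j.
      by rewrite -sumrB; apply: eq_bigr => j _; rewrite mulrBl.
    ring.
  apply: OO_D.
    exists (`|KT| * K1 ^+ n.+1), r2; split => //; first by rewrite mulr_ge0 ?exprn_ge0.
    move=> e z zr ez; have zr1 := le_trans zr r21.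
    apply: le_trans (hKT _ _ (K1s z zr) (hK1 _ _ zr1 ez) _) _; first by rewrite mulr_ge0 ?cabs_ge0.
    by rewrite exprMn mulrA ler_wpM2r ?exprn_ge0 ?cabs_ge0 // ler_wpM2r ?exprn_ge0 // ler_norm.
  apply: OO_D; last by apply: OO_Pol => j _; exact: cXY.
  apply: OO_sum => j; rewrite -[n.+1]addn0; apply: OO_M; last exact: OO_cst.
  exact: Oab.
have [KD [rD [KD0 rD0 hKD]]] := OD.
have /nbhs_cabs[re re0 hre] := heq i.
pose r3 := Num.min (Num.min r2 rD) (re / 2).
have r30 : 0 < r3 by rewrite !lt_min r20 rD0 divr_gt0.
pose g i z := if i is i'.+1 then z * derive1 (a i' k) z else 0.
have main (z : C) : z != 0 -> cabs z <= r3 -> cabs (g i z - (PP`_i).[z]) <= 2 * KD * cabs z ^+ (n.+1 - i).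
  move=> z0; rewrite !le_min => /andP[/andP[zr2 zrD] zre].
  have z0' : 0 < cabs z by rewrite cabs_gt0.
  have hX e : cabs e <= 2 * cabs z -> boxN nu.+2 (s / 2) (X e z).
    move=> ez j jN; have zr1 := le_trans zr2 r21.
    by apply: le_trans (hK1 _ _ zr1 ez j jN) (K1s z zr2).
  have -> : g i z = tcoef (fun e => H (X e z)) i by apply: hre => //; rewrite subr0; lra.
  have hd' e : cabs e <= 2 * cabs z -> differentiable (fun e : C => H (X e z)) e.
    by move=> /hX; exact: hd.
  have hB' e : cabs e <= 2 * cabs z -> cabs (H (X e z)) <= B by move=> /hX; exact: hB.
  pose p := map_poly (horner_eval z) PP.
  have := @tcoef_poly R (cabs z) B _ z0' hd' hB' p i (KD * cabs z ^+ n.+1).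
  rewrite coef_map /= /horner_eval => h; apply: le_trans (h _) _.
    by move=> e /ann_le ez; exact: hKD.
  have i_n : (i <= n.+1)%N by apply: leq_trans (leq_addr m i) (leq_trans imn (leqnSn _)).
  by rewrite -{1}(subnK i_n) exprD; rewrite mulrA mulrA mulfK // expf_neq0 // gt_eqF.
clearbody r3.
(* A polynomial in [z] that matches the left-hand side up to order [n + 1]. *)
have [q [hq1 hq2]] : exists q : {poly C}, OO n.+1 (fun _ z => g i z - q.[z]) /\
    (forall m, (m <= n)%N -> q`_m = if i is i'.+1 then m%:R * al i' m k else 0).
  rewrite /g; case: (i) => [|i'].
    exists 0; split; last by move=> *; rewrite coef0.
    by apply: OO_ext (@OO_zero R n.+1) => e z; rewrite horner0 subrr.
  have [f' hf' [nf cf]] := derive1_local (ha i' k).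
  exists ('X * \poly_(l < n.+1) tcoef f' l); split; last first.
    move=> [|m'] hm; rewrite coefXM /=; first by rewrite mul0r.
    by rewrite coef_poly ltnS (ltnW hm) cf.
  have /nbhs_cabs[rf rf0 hrf] := nf.
  have [K [r [K0 r0 hK]]] : OO n.+2 (fun _ z => z * (f' z - \sum_(l < n.+1) tcoef f' l * z ^+ l)).
    by apply: (@OO_M R 1 n.+1); [exact: OO_z|exact: OO_taylor].
  apply: (@OO_le R n.+2) => //; exists K, (Num.min r (rf / 2)); split => //.
    by rewrite lt_min r0 divr_gt0.
  move=> e z; rewrite le_min => /andP[zr zf] ez.
  rewrite -hrf ?subr0; last by lra.
  by rewrite hornerM hornerX horner_poly -mulrBr; exact: hK zr ez.
have [Kq [rq [Kq0 rq0 hKq]]] := hq1.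
have mn : (m <= n)%N by apply: leq_trans imn; exact: leq_addl.
have small : (q - PP`_i)`_m = 0.
  (* The difference is [O(|z|^(n+1-i))], which reaches the coefficient of [z^m] because
     [i + m <= n]. *)
  apply: (@poly_small R _ (2 * KD + Kq) (Num.min r3 (Num.min rq 1)) (n.+1 - i)); last by rewrite ltn_subRL ltnS.
    by rewrite !lt_min r30 rq0 ltr01.
  move=> z z0; rewrite !le_min => /andP[zr3 /andP[zrq z1]].
  rewrite hornerD hornerN.
  have -> : q.[z] - (PP`_i).[z] = (g i z - (PP`_i).[z]) - (g i z - q.[z]) by ring.
  apply: le_trans (cabsD _ _) _; rewrite cabsN mulrDl; apply: lerD; first exact: main.
  apply: le_trans (hKq 0 z zrq _) _; first by rewrite cabs0 mulr_ge0 ?cabs_ge0.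
  by rewrite ler_wpM2l // ler_wiXn2l ?cabs_ge0 // leq_subr.
move: small; rewrite coefB hq2 // => /eqP; rewrite subr_eq0 => /eqP ->.
rewrite /PP !coefD !coef_sum; congr (_ + _).
apply: eq_bigr => j _; rewrite /cst2 coefMC coefMC box_polyE leqnn mn //.
Qed.
End relation.

(** * Power series and the theorem *)

Section series.
Variable R : realType.
Local Notation C := (Cx R).

(** As an ultralimit the sum inherits every bound that is uniform on the partial sums, without a
    separate convergence proof. *)
Definition pser (u : nat -> C) (z : C) : C := ulim (fun n => \sum_(m < n) u m * z ^+ m).

Lemma geom_half (n : nat) : \sum_(m < n) (2^-1 : R) ^+ m <= 2.
Proof.
have := subrX1 (2^-1 : R) n; set S := \sum_(_ < _) _ => h.
have : 0 <= (2^-1 : R) ^+ n by rewrite exprn_ge0 // invr_ge0.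
lra.
Qed.

(** The second order expansion of [w^m] at [z]. The factor [rho^2] avoids the exponent [m - 2], so
    that small [m] need no exception. *)
Lemma pow_quad (m : nat) (z w : C) (rho : R) : 0 <= rho -> cabs z <= rho -> cabs w <= rho ->
  rho ^+ 2 * cabs (w ^+ m - z ^+ m - m%:R * z ^+ m.-1 * (w - z)) <=
    m%:R ^+ 2 * rho ^+ m * cabs (w - z) ^+ 2.
Proof.
move=> r0 zr wr; elim: m => [|m IH].
  by rewrite !expr0 subrr !mul0r subrr cabs0 mulr0 expr0n !mul0r.
have -> : w ^+ m.+1 - z ^+ m.+1 - m.+1%:R * z ^+ m.+1.-1 * (w - z) =
  w * (w ^+ m - z ^+ m - m%:R * z ^+ m.-1 * (w - z)) + m%:R * z ^+ m.-1 * (w - z) ^+ 2.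
  rewrite -(natr1 m); case: (m) => [|m'] /=; first by rewrite !expr0 !expr1; ring.
  by rewrite !exprS; set M := _%:R; ring.
apply: le_trans (ler_wpM2l (sqr_ge0 _) (cabsD _ _)) _; rewrite mulrDr.
set E := cabs (_ - _ - _) in IH.
have -> : m.+1%:R ^+ 2 * rho ^+ m.+1 * cabs (w - z) ^+ 2 =
   rho * (m%:R ^+ 2 * rho ^+ m * cabs (w - z) ^+ 2) + (m%:R * (rho ^+ m.+1 * cabs (w - z) ^+ 2) +
    (m%:R + 1) * (rho ^+ m.+1 * cabs (w - z) ^+ 2)).
  by rewrite -(natr1 m) (exprS rho); ring.
apply: lerD.
  rewrite cabsM mulrCA; apply: ler_pM; rewrite ?cabs_ge0 ?mulr_ge0 ?sqr_ge0 //.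
  exact: cabs_ge0.
rewrite -[leLHS]addr0; apply: lerD; last first.
  by apply: mulr_ge0; [rewrite addr_ge0|rewrite mulr_ge0 ?exprn_ge0 ?cabs_ge0].
case: (m) => [|m'] /=; first by rewrite !mul0r cabs0 mulr0.
rewrite cabsM (cabsM m'.+1%:R) cabsn (cabsX z) (cabsX (w - z)).
set d := cabs (w - z); set M := m'.+1%:R.
have -> : rho ^+ 2 * (M * cabs z ^+ m' * d ^+ 2) = M * (rho ^+ 2 * d ^+ 2) * cabs z ^+ m' by ring.
have -> : M * (rho ^+ m'.+2 * d ^+ 2) = M * (rho ^+ 2 * d ^+ 2) * rho ^+ m'.
  by rewrite (exprS rho m'.+1) (exprS rho m'); ring.
apply: ler_wpM2l; last by rewrite lerXn2r ?nnegrE ?cabs_ge0.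
by apply: mulr_ge0 => //; apply: mulr_ge0; exact: sqr_ge0.
Qed.

Section fixed.
Variables (u : nat -> C) (K Q rho : R).
Hypotheses (Q0 : 0 < Q) (K0 : 0 <= K) (rhoE : rho = (8 * Q)^-1).
Hypothesis hu : forall m, cabs (u m) <= K * Q ^+ m.

Let rho0 : 0 < rho. Proof. by rewrite rhoE invr_gt0 mulr_gt0. Qed.

(** The 8 in [rho] leaves [4 rho Q = 1/2]: at radius [rho] there is a spare factor [4^m], which pays
    for the [m] and [m^2] produced by differentiation. *)
Let term_bound m (t : R) : 0 <= t -> t <= 4 * rho -> K * Q ^+ m * t ^+ m <= K * 2^-1 ^+ m.
Proof.
move=> t0 t1; rewrite -mulrA -exprMn ler_wpM2l // lerXn2r ?nnegrE ?mulr_ge0 ?invr_ge0 ?(ltW Q0) //.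
apply: (@le_trans _ _ (Q * (4 * rho))); first by rewrite ler_wpM2l ?(ltW Q0).
by rewrite le_eqVlt rhoE; apply/orP; left; apply/eqP; field; rewrite gt_eqF.
Qed.

Lemma psum_bound n (z : C) : cabs z <= 4 * rho -> cabs (\sum_(m < n) u m * z ^+ m) <= 2 * K.
Proof.
move=> zr; apply: le_trans (cabs_sum _ _ _) _.
apply: (@le_trans _ _ (\sum_(m < n) K * 2^-1 ^+ m)).
  apply: ler_sum => m _; rewrite cabsM cabsX; apply: le_trans (term_bound m (cabs_ge0 z) zr).
  by rewrite ler_wpM2r ?exprn_ge0 ?cabs_ge0.
by rewrite -mulr_sumr mulrC ler_wpM2r // geom_half.
Qed.

Lemma pser_bound (z : C) : cabs z <= 4 * rho -> cabs (pser u z) <= 2 * K.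
Proof. by move=> zr; apply: ulim_bound => n; exact: psum_bound. Qed.

(** The derivative is the ultralimit of the termwise derivatives; [pow_quad] gives the partial sums
    a quadratic error uniform in [n], which passes to the limit. *)
Lemma pser_differentiable (z : C) : cabs z < rho -> differentiable (pser u) z.
Proof.
move=> zr.
pose T n := \sum_(m < n) u m * (m%:R * z ^+ m.-1).
have bS (w : C) : cabs w <= rho -> bseq (fun n => \sum_(m < n) u m * w ^+ m).
  by move=> wr; exists (2 * K) => n; apply: psum_bound; apply: le_trans wr _; rewrite ler_peMl ?(ltW rho0) // ler1n.
have n4 m : m%:R <= 4 ^+ m :> R by rewrite -natrX ler_nat ltnW // ltn_expl.
have n2 m : m%:R <= 2 ^+ m :> R by rewrite -natrX ler_nat ltnW // ltn_expl.
have bT : bseq T.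
  exists (2 * K / rho) => n; apply: le_trans (cabs_sum _ _ _) _.
  apply: (@le_trans _ _ (\sum_(m < n) (K * 2^-1 ^+ m) / rho)); last first.
    by rewrite -mulr_suml ler_wpM2r ?invr_ge0 ?(ltW rho0) // -mulr_sumr mulrC ler_wpM2r // geom_half.
  apply: ler_sum => m _; rewrite ler_pdivlMr //; apply: le_trans (term_bound m _ (lexx _)); last by rewrite mulr_ge0 // ltW.
  rewrite cabsM -(mulrA (cabs (u m))); apply: ler_pM; rewrite ?cabs_ge0 ?hu //.
    by rewrite mulr_ge0 ?cabs_ge0 // ltW.
  rewrite exprMn cabsM cabsn cabsX; case: (val m) => [|k] /=.
    by rewrite !mul0r mulr_ge0.
  rewrite -mulrA; apply: ler_pM; rewrite ?mulr_ge0 ?exprn_ge0 ?cabs_ge0 ?(ltW rho0) //.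
  by rewrite exprSr ler_wpM2r ?(ltW rho0) // lerXn2r ?nnegrE ?cabs_ge0 ?(ltW rho0) // ltW.
have r0 : 0 < rho - cabs z by rewrite subr_gt0.
apply: (@cderiv_diff R _ _ (ulim T)).
apply: (@quad_cderiv R _ _ _ (rho - cabs z) (2 * K / rho ^+ 2) r0) => w hw.
have wr : cabs w <= rho.
  rewrite -(subrK z w); apply: le_trans (cabsD _ _) _; rewrite -lerBrDr; exact: ltW.
have -> : pser u w - pser u z - ulim T * (w - z) =
  ulim (fun n => (\sum_(m < n) u m * w ^+ m + (-1) * (\sum_(m < n) u m * z ^+ m)) + - (w - z) * T n).
  have bz := bS z (ltW zr).
  have b1 := bS w wr; have b2 := bseqZ (-1) bz; have b3 := bseqZ (- (w - z)) bT.
  rewrite (ulimD (bseqD b1 b2) b3) (ulimD b1 b2) (ulimZ _ bz) (ulimZ _ bT) -!/(pser u _).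
  by move: (pser u w) (pser u z) (ulim T) => p q d; ring.
apply: ulim_bound => n.
have -> : \sum_(m < n) u m * w ^+ m + -1 * (\sum_(m < n) u m * z ^+ m) + - (w - z) * T n =
   \sum_(m < n) u m * (w ^+ m - z ^+ m - m%:R * z ^+ m.-1 * (w - z)).
  rewrite /T !mulr_sumr -!big_split /=; apply: eq_bigr => m _; ring.
apply: le_trans (cabs_sum _ _ _) _.
apply: (@le_trans _ _ (\sum_(m < n) (K * 2^-1 ^+ m) * (cabs (w - z) ^+ 2 / rho ^+ 2))); last first.
  rewrite -mulr_suml -mulr_sumr (mulrC K).
  have -> : 2 * K / rho ^+ 2 * cabs (w - z) ^+ 2 = 2 * K * (cabs (w - z) ^+ 2 / rho ^+ 2) by ring.
  by rewrite ler_wpM2r ?divr_ge0 ?sqr_ge0 // ler_wpM2r // geom_half.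
apply: ler_sum => m _.
rewrite mulrA ler_pdivlMr ?exprn_gt0 //.
have h := @pow_quad m z w rho (ltW rho0) (ltW zr) wr.
rewrite cabsM -(mulrA (cabs (u m))) (mulrC _ (rho ^+ 2)).
apply: le_trans (ler_pM (cabs_ge0 _) _ (hu m) h) _; first by rewrite mulr_ge0 ?sqr_ge0 ?cabs_ge0.
rewrite mulrA ler_wpM2r ?sqr_ge0 //.
(* Here [m^2 rho^m <= (4 rho)^m], from [m <= 2^m]. *)
have := @term_bound m (4 * rho); rewrite mulr_ge0 ?(ltW rho0) // lexx => /(_ isT isT) h2; apply: le_trans h2.
rewrite ler_wpM2l ?mulr_ge0 ?exprn_ge0 ?(ltW Q0) // exprMn ler_wpM2r ?exprn_ge0 ?(ltW rho0) //.
have -> : (4 : R) ^+ m = 2 ^+ m ^+ 2 by rewrite -exprM mulnC exprM; congr (_ ^+ _); ring.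
by rewrite lerXn2r ?nnegrE ?exprn_ge0.
Qed.
End fixed.

Lemma pser_local (f : C -> C) : local_holo f ->
  \forall z \near (0 : C), pser (tcoef f) z = f z.
Proof.
move=> [r [B [r0 hd hB]]].
have B0 : 0 <= B by apply: le_trans (cabs_ge0 _) (hB 0 _); rewrite cabs0 mulr_ge0 // ltW.
apply/nbhs_cabs; exists (r / 2); first by rewrite divr_gt0.
move=> z; rewrite subr0 => /ltW zr; apply: ulim_cvg => e e0.
have [k hk] := @half_pow_lt R (4 * B) _ e0.
exists k.+1 => -[//|n]; rewrite ltnS => kn.
rewrite cabsC; apply: le_trans (taylor_bound r0 hd hB n zr) _; apply: le_trans (ltW hk).
apply: ler_wpM2l; first by rewrite mulr_ge0.
rewrite -exprVn; apply: (@le_trans _ _ (2^-1 ^+ n.+1)).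
  rewrite lerXn2r ?nnegrE ?invr_ge0 ?divr_ge0 ?cabs_ge0 ?(ltW r0) //.
  by rewrite ler_pdivrMr // mulrC.
by apply: ler_wiXn2l; rewrite ?invr_ge0 ?invf_le1 ?ler1n // ltnW // ltnS.
Qed.
End series.

(** * Vector-valued functions and their entries *)

Section points.
Variables (R : realType) (nu : nat).
Local Notation C := (Cx R).
Local Notation env := (nat -> C).
Local Notation V := (Cx R * Cx R * 'rV[Cx R]_nu)%type.

Definition pt3 (x : env) : V := (x 0%N, x 1%N, \row_(j < nu) x j.+2).

Lemma near_box (P : V -> Prop) : (\forall p \near ((0, 0, 0) : V), P p) ->
  exists2 r : R, 0 < r & forall x, boxN nu.+2 r x -> P (pt3 x).
Proof.
move=> /nbhs_ballP[d /= d0 dP].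
have d0' : 0 < cabs d by rewrite cabs_gt0 gt_eqF.
exists (cabs d / 2); first by rewrite divr_gt0.
move=> x hx; apply: dP.
have b j : (j < nu.+2)%N -> ball (0 : C) d (x j).
  move=> jN; rewrite -ball_normE /= sub0r normrN normE (pos_rc d0) rc_lt.
  by apply: le_lt_trans (hx j jN) _; lra.
split; first by split; apply: b.
by split => // i j; rewrite !mxE; apply: b; rewrite !ltnS.
Qed.

Lemma differentiable_entry (W : normedModType C) (f : W -> 'rV[C]_nu) (p : W) (j : 'I_nu) :
  differentiable f p -> differentiable (fun q => f q ord0 j) p.
Proof.
move=> h; apply: (@differentiable_comp _ _ _ _ f (fun M : 'rV[C]_nu => M ord0 j)) => //.
exact: differentiable_coord.
Qed.

Lemma differentiable_row (f : C -> 'rV[C]_nu) t :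
  (forall j, differentiable (fun s => f s ord0 j) t) -> differentiable f t.
Proof.
move=> h.
have -> : f = \sum_(j < nu) (fun s => f s ord0 j *: delta_mx ord0 j).
  apply: funext => s; rewrite fct_sumE.
  exact: row_sum_delta.
by apply: differentiable_sum => j; apply: differentiableZl.
Qed.

Lemma derive1_entry (f : C -> 'rV[C]_nu) t (j : 'I_nu) : differentiable f t ->
  derive1 (fun s => f s ord0 j) t = derive1 f t ord0 j.
Proof.
move=> h; rewrite !derive1E' //; last exact: differentiable_entry.
have @G : {linear 'rV[C]_nu -> C}.
  by exists (fun N : 'rV[C]_nu => N ord0 j); do 2![eexists]; do ?[constructor];
     rewrite ?mxE// => ? *; rewrite ?mxE//; move=> ?; rewrite !mxE.
have cG : continuous G by exact: coord_continuous.
have -> : (fun s => f s ord0 j) = G \o f by [].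
have dG : differentiable G (f t) by exact: linear_differentiable.
by rewrite (diff_comp h dG) /= (diff_lin _ cG).
Qed.

Lemma differentiable_pt3 (x : C -> env) t :
  (forall j, (j < nu.+2)%N -> differentiable (fun s => x s j) t) ->
  differentiable (fun s => pt3 (x s)) t.
Proof.
move=> h; apply: differentiable_pair; first by apply: differentiable_pair; exact: h.
apply: differentiable_row => j.
have -> : (fun s => (\row_(j < nu) x s j.+2) ord0 j) = (fun s => x s j.+2).
  by apply: funext => s; rewrite mxE.
by apply: h; rewrite !ltnS.
Qed.

End points.

Section vector_derivatives.
Variables (R : realType) (nu : nat).
Local Notation C := (Cx R).

Lemma near_eq_differentiable (f g : C -> C) (z : C) :
  (\forall w \near z, f w = g w) -> differentiable f z -> differentiable g z.
Proof.
move=> fg /derivable1_diffP df; apply/derivable1_diffP.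
exact: near_eq_derivable fg df.
Qed.

Lemma near_eq_derive1 (f g : C -> C) (z : C) :
  (\forall w \near z, f w = g w) -> derive1 f z = derive1 g z.
Proof. by move=> fg; rewrite !derive1E; exact: near_eq_derive. Qed.

(** The two claims are proved together: differentiability lets entries be taken in the next
    derivative, and equality near [z] carries differentiability back from the entries. *)
Lemma derive1n_entry (f : C -> 'rV[C]_nu) (s B : R) : 0 < s ->
  (forall z, cabs z <= 2 * s -> differentiable f z) ->
  (forall z j, cabs z <= 2 * s -> cabs (f z ord0 j) <= B) ->
  forall i z, cabs z < s / 2 ->
    (forall j, derive1n i f z ord0 j = derive1n i (fun e => f e ord0 j) z) /\
    differentiable (derive1n i f) z.
Proof.
move=> s0 hd hB.
have hd' j z : cabs z <= 2 * s -> differentiable (fun e => f e ord0 j) z.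
  by move=> /hd; exact: differentiable_entry.
have near_disc (z : C) : cabs z < s / 2 -> \forall w \near z, cabs w < s / 2.
  move=> zs; apply/nbhs_cabs; exists (s / 2 - cabs z); first by rewrite subr_gt0.
  by move=> w hw; have := cabsD (w - z) z; rewrite subrK; lra.
elim=> [|i IH] z zs.
  by split; [by []|rewrite derive1n0; apply: hd; lra].
have eq1 w : cabs w < s / 2 -> forall j, derive1n i.+1 f w ord0 j = derive1n i.+1 (fun e => f e ord0 j) w.
  move=> ws j; have [_ dw] := IH w ws.
  rewrite !derive1nS -(derive1_entry j dw); apply: near_eq_derive1.
  by apply: filterS (near_disc w ws) => v vs; have [h _] := IH v vs.
split; first exact: eq1.
apply: differentiable_row => j.
apply: (@near_eq_differentiable (derive1n i.+1 (fun e => f e ord0 j))).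
  by apply: filterS (near_disc z zs) => v vs; rewrite eq1.
exact: (differentiable_derive1n s0 (hd' j) (fun z => hB z j)).
Qed.
End vector_derivatives.

(** * Vanishing of the coefficients of weight at most 1 *)

Section low_order.
Variable R : realType.
Local Notation C := (Cx R).
Local Notation env := (nat -> C).

Lemma Pol_axis N (c : ('I_N -> nat) -> C) (j : 'I_N) (t : C) :
  Pol 1 id c (upd (fun=> 0) j t) = c (fun=> 0%N) + c (fun i => (i == j : nat)) * t.
Proof.
pose a0 : {ffun 'I_N -> 'I_2} := [ffun=> ord0].
pose a1 : {ffun 'I_N -> 'I_2} := [ffun i => if i == j then lift ord0 ord0 else ord0].
have a10 : a1 != a0.
  by apply/eqP => /ffunP/(_ j); rewrite !ffunE eqxx => /eqP.
rewrite /Pol (bigD1 a0) //= (bigD1 a1) //= [X in _ + (_ + X)]big1 ?addr0.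
  congr (_ + _).
    rewrite big1 ?mulr1; last by move=> i _; rewrite ffunE expr0.
    by congr c; apply: funext => i; rewrite ffunE.
  rewrite (bigD1 j) //= big1 ?mulr1; last first.
    by move=> i ij; rewrite ffunE (negbTE ij) expr0.
  rewrite ffunE eqxx /upd eqxx expr1; congr (c _ * _).
  by apply: funext => i; rewrite ffunE; case: (i == j).
move=> a /andP[na0 na1].
have [i ij ai] : exists2 i, i != j & a i != ord0.
  apply: contrapT => h.
  have z i : i != j -> a i = ord0.
    by move=> ij; apply/eqP; apply: contrapT => /negP ai; apply: h; exists i.
  have [aj|aj] := eqVneq (a j) ord0.
    move/eqP: na0; apply; apply/ffunP => i; rewrite ffunE.
    by have [->//|/z] := eqVneq i j.
  move/eqP: na1; apply; apply/ffunP => i; rewrite ffunE.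
  have [->|/z //] := eqVneq i j; apply/val_inj => /=.
  by case: (a j) aj => -[|[|]].
rewrite (bigD1 i) //= /upd (negbTE (_ : (i : nat) != j)) //.
by rewrite expr0n (negbTE (_ : (a i : nat) != 0%N)) // mul0r mulr0.
Qed.

Lemma low_weight N (a : 'I_N -> nat) : (weight a <= 1)%N ->
  a = (fun=> 0%N) \/ exists2 j : 'I_N, (2 <= j)%N & a = (fun i => (i == j : nat)).
Proof.
move=> w1; have [/forallP h|] := boolP [forall j, a j == 0%N].
  by left; apply: funext => j; apply/eqP.
rewrite negb_forall => /existsP[j aj]; right.
have j2 : (2 <= j)%N.
  rewrite leqNgt; apply/negP => j2; move: w1; rewrite /weight (bigD1 j) //= j2 -addnn.
  by move: aj; set S := (\sum_(_ < _ | _) _)%N; lia.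
have w2 : (a j + \sum_(i < N | i != j) (if (i < 2)%N then (a i).*2 else a i) <= 1)%N.
  by move: w1; rewrite /weight (bigD1 j) //= ltnNge j2.
exists j => //; apply: funext => i; have [->|ij] := eqVneq i j.
  by move: aj w2; set S := (\sum_(_ < _ | _) _)%N; lia.
move: aj w2; rewrite (bigD1 i) //=; set S := (\sum_(_ < _ | _) _)%N.
by case: ifP => _; rewrite -?addnn; lia.
Qed.

(** By [low_weight] these are the constant term and the terms linear in [f]. On the axis of an
    [f]-variable, [Phi] is [o(t)] whereas the Taylor estimate makes it the linear polynomial of
    [Pol_axis] up to [O(t^2)]. *)
Lemma low_coef N (c : ('I_N.+2 -> nat) -> C) (Phi : env -> C) (s : R) : 0 < s ->
  (exists K, forall x t, t <= s / 2 -> boxN N.+2 t x -> 0 <= t ->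
     cabs (Phi x - Pol 1 id c x) <= K * t ^+ 2) ->
  Phi (fun=> 0) = 0 ->
  (forall (j : 'I_N.+2) (e : R), (2 <= j)%N -> 0 < e -> exists2 d : R, 0 < d & forall t : C,
     cabs t <= d -> cabs (Phi (upd (fun=> 0) j t)) <= e * cabs t) ->
  forall a, (weight a <= 1)%N -> c a = 0.
Proof.
move=> s0 [K hK] P0 hs.
have upd_box (j : nat) (t : C) M : boxN M (cabs t) (upd (fun=> 0) j t).
  by move=> i _; rewrite /upd; case: ifP => _; rewrite ?cabs0 ?cabs_ge0.
have c0 : c (fun=> 0%N) = 0.
  have u0 : upd (fun=> 0 : C) (ord0 : 'I_N.+2) 0 = (fun=> 0) by apply: funext => i; rewrite /upd if_same.
  have := hK (upd (fun=> 0) (ord0 : 'I_N.+2) 0) 0; rewrite Pol_axis u0 P0 mulr0 addr0 sub0r cabsN expr0n mulr0.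
  move=> h; apply/eqP; rewrite -cabs_eq0 eq_le cabs_ge0 andbT; apply: h => //; first by rewrite divr_ge0 // ltW.
  by move=> i _; rewrite cabs0.
move=> a /low_weight[->//|[j j2 ->]].
set cj := c _.
apply/eqP; rewrite -cabs_eq0 eq_le cabs_ge0 andbT; apply/ler_addgt0Pl => e e0; rewrite addr0.
have e2 : 0 < e / 2 by rewrite divr_gt0.
have [d d0 hd] := hs j _ j2 e2.
have K0 : 0 < `|K| + 1 by rewrite ltr_pwDr.
(* Small enough for both estimates to apply and for the quadratic error [|K| t^2] to be at most
   [e t / 2]. *)
pose t := Num.min (Num.min d (s / 2)) (e / 2 / (`|K| + 1)).
have t0 : 0 < t by rewrite !lt_min d0 !divr_gt0.
have td : t <= d by rewrite !ge_min lexx.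
have ts : t <= s / 2 by rewrite !ge_min lexx orbT.
have te : t * (`|K| + 1) <= e / 2 by rewrite -ler_pdivlMr // ge_min lexx orbT.
have ct : cabs (rc t) = t by rewrite cabs_rc gtr0_norm.
have h1 := hd (rc t); rewrite ct in h1.
have h2 : cabs (Phi (upd (fun=> 0) j (rc t)) - cj * rc t) <= K * t ^+ 2.
  have := hK (upd (fun=> 0) j (rc t)) t ts _ (ltW t0); rewrite Pol_axis c0 add0r; apply.
  by rewrite -[X in boxN _ X]ct; exact: upd_box.
have h3 : cabs (cj * rc t) <= e / 2 * t + `|K| * t ^+ 2.
  have -> : cj * rc t = Phi (upd (fun=> 0) j (rc t)) - (Phi (upd (fun=> 0) j (rc t)) - cj * rc t) by ring.
  apply: le_trans (cabsD _ _) _; rewrite cabsN; apply: lerD; first exact: h1.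
  apply: le_trans h2 _.
  by rewrite ler_wpM2r ?sqr_ge0 // ler_norm.
move: h3; rewrite cabsM ct => h3.
rewrite -(ler_pM2r t0); apply: le_trans h3 _.
have : `|K| * t <= e / 2 by apply: le_trans te; rewrite mulrC ler_wpM2l ?(ltW t0) // lerDl.
by move=> h4; rewrite expr2 mulrA -mulrDl ler_wpM2r ?(ltW t0) //; lra.
Qed.
End low_order.

Section auxiliary.
Variable R : realType.
Local Notation C := (Cx R).

Lemma eucl_norm_le n (v : 'rV[C]_n) : eucl_norm v <= rc (\sum_j cabs (v ord0 j)).
Proof.
have S0 : 0 <= \sum_j cabs (v ord0 j) by apply: sumr_ge0 => j _; exact: cabs_ge0.
have S0' : 0 <= rc (\sum_j cabs (v ord0 j)) by rewrite -(rc0 R) rc_le.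
rewrite /eucl_norm -[leRHS](sqrCK S0') ler_sqrtC ?nnegrE ?exprn_ge0 //; last first.
  by apply: sumr_ge0 => j _; exact: exprn_ge0.
have -> : \sum_j `|v ord0 j| ^+ 2 = rc (\sum_j cabs (v ord0 j) ^+ 2).
  rewrite (big_morph _ (@rcD R) (rc0 R)); apply: eq_bigr => j _.
  by rewrite normE !expr2 rcM.
rewrite !expr2 -rcM rc_le mulr_sumr; apply: ler_sum => j _.
rewrite expr2 ler_wpM2r ?cabs_ge0 // (bigD1 j) //= lerDl.
by apply: sumr_ge0 => i _; exact: cabs_ge0.
Qed.

(** [m^i] is at most the falling factorial of [m + i], that is [i!] times a binomial coefficient,
    and the latter is at most [2^(i+m)]. *)
Lemma pow_le_fact (m i : nat) : (maxn m 1 ^ i <= i`! * 2 ^ (i + m))%N.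
Proof.
have [->|m0] := posnP m; first by rewrite exp1n muln_gt0 fact_gt0 expn_gt0.
rewrite (maxn_idPl m0); apply: (@leq_trans ((m + i) ^_ i)).
  elim: i => // i IH; rewrite expnS addnS ffactSS; apply: leq_mul => //.
  by rewrite leqW // leq_addr.
rewrite -bin_ffact mulnC leq_mul2l; apply/orP; right; rewrite addnC.
have -> : (2 ^ (i + m) = \sum_(k < (i + m).+1) 'C(i + m, k))%N.
  by rewrite -[2%N]/(1 + 1)%N expnDn; apply: eq_bigr => k _; rewrite !exp1n !muln1.
have hi : (i < (i + m).+1)%N by rewrite ltnS leq_addr.
by rewrite (bigD1 (Ordinal hi)) //= leq_addr.
Qed.

Lemma open_disc (r : R) : open (disc r).
Proof.
rewrite openE => z; rewrite /disc /= normE rc_lt => zr.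
apply/nbhs_cabs; exists (r - cabs z); first by rewrite subr_gt0.
move=> w hw; rewrite /= normE rc_lt; have := cabsD (w - z) z; rewrite subrK; lra.
Qed.

Lemma differentiable_upd (e : nat -> C) (j i : nat) (t : C) :
  differentiable (fun s => upd e j s i) t.
Proof.
rewrite /upd; case: (i == j); first by apply/derivable1_diffP; exact: derivable_id.
exact: differentiable_cst.
Qed.

Lemma differentiable_bigsum (I : Type) (r : seq I) (F : I -> C -> C) (t : C) :
  (forall i, differentiable (F i) t) -> differentiable (fun s => \sum_(i <- r) F i s) t.
Proof.
move=> h; elim: r => [|i r IH].
  have -> : (fun s => \sum_(i <- [::]) F i s) = cst 0 by apply: funext => s; rewrite big_nil.
  exact: differentiable_cst.
have -> : (fun s => \sum_(i <- i :: r) F i s) = F i + (fun s => \sum_(i <- r) F i s).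
  by apply: funext => s; rewrite big_cons.
exact: differentiableD (h i) IH.
Qed.
End auxiliary.

(** * The Taylor expansion of [F] at the origin *)

Section equation.
Variables (R : realType) (nu : nat).
Local Notation C := (Cx R).
Local Notation env := (nat -> C).
Local Notation V := (Cx R * Cx R * 'rV[Cx R]_nu)%type.
Variable F : V -> 'rV[C]_nu.

Lemma near_origin (U : set V) : open U -> U (0, 0, 0) -> (forall p, U p -> differentiable F p) ->
  F (0, 0, 0) = 0 ->
  exists2 r : R, 0 < r & forall x, boxN nu.+2 r x ->
    differentiable F (pt3 nu x) /\ forall k, cabs (F (pt3 nu x) ord0 k) <= 1.
Proof.
move=> oU U0 hU F0.
have nU : \forall p \near ((0, 0, 0) : V), U p by exact: open_nbhs_nbhs.
have nb : \forall p \near ((0, 0, 0) : V), forall k, `|F (0, 0, 0) ord0 k - F p ord0 k| <= rc 1.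
  apply: (@filter_forall _ _ _ (nbhs ((0, 0, 0) : V))) => k.
  have dk := differentiable_entry k (hU _ U0).
  have /cvgrPdist_le/(_ (rc 1)) := differentiable_continuous dk.
  by rewrite rc1 ltr01 => /(_ isT).
have [r r0 h] := near_box (filterI nU nb).
exists r; [exact: r0|move=> x /h[Ux hb]; split; first exact: hU].
by move=> k; have := hb k; rewrite F0 mxE sub0r normrN normE rc_le.
Qed.

Lemma pt3_axis (i : 'I_nu) (t : C) : pt3 nu (upd (fun=> 0) i.+2 t) = (0, 0, t *: delta_mx ord0 i).
Proof.
rewrite /pt3 /upd /=; congr (_, _, _); apply/rowP => q; rewrite !mxE eqxx /= !eqSS val_eqE.
by case: (q == i); rewrite ?mulr1 ?mulr0.
Qed.

(** With row vectors the [i]-th basis vector picks row [i] of the Jacobian, so entry [(i, k)] is the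
    derivative of [F_k] along [f_i]. *)
Lemma axis_derivative (i k : 'I_nu) : differentiable F (0, 0, 0) ->
  cderiv (fun t : C => F (0, 0, t *: delta_mx ord0 i) ord0 k) 0 (jacobian_f F 0 0 0 i k).
Proof.
move=> dF; pose g := fun f : 'rV[C]_nu => F (0, 0, f).
have dg : differentiable g 0.
  by apply: (@differentiable_comp _ _ _ _ (fun f : 'rV[C]_nu => ((0, 0, f) : V)) F).
pose v : 'rV[C]_nu := delta_mx ord0 i.
pose f1 (t : C) := g (t *: v).
have di : differentiable (fun t : C => t) 0 by apply/derivable1_diffP; exact: derivable_id.
have ds : differentiable (fun t : C => t *: v) 0 by exact: differentiableZl.
have dg' : differentiable g (0 *: v) by rewrite scale0r.
have df1 : differentiable f1 0 by exact: (@differentiable_comp _ _ _ _ (fun t : C => t *: v) g 0 ds dg').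
have e1 : derive1 f1 0 = v *m jacobian_f F 0 0 0.
  rewrite /jacobian_f /jacobian mul_rV_lin1 (derive1E' df1).
  have -> : f1 = g \o (fun t : C => t *: v) by [].
  rewrite (diff_comp ds dg') /= (diffZl v di) /=.
  by rewrite -(derive1E' di) derive1E derive_id scale1r scale0r.
have -> : jacobian_f F 0 0 0 i k = derive1 (fun t => f1 t ord0 k) 0.
  by rewrite (derive1_entry k df1) e1 /v -rowE [RHS]mxE.
by apply: diff_cderiv; exact: (differentiable_entry k df1).
Qed.

(** Subtracting the linear part [f A] from [F] leaves a function with zero derivative along the
    [f]-axes, to which [low_coef] applies. *)
Lemma taylor_system (r : R) : 0 < r -> F (0, 0, 0) = 0 ->
  (forall x, boxN nu.+2 r x ->
    differentiable F (pt3 nu x) /\ forall k, cabs (F (pt3 nu x) ord0 k) <= 1) ->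
  exists (c : 'I_nu -> ('I_nu.+2 -> nat) -> C) (M : R), [/\ 0 <= M,
    forall k a, (weight a <= 1)%N -> c k a = 0,
    forall k a, cabs (c k a) <= M * \prod_j (r / 2)^-1 ^+ a j &
    forall k n, exists K : R, forall x (t : R), t <= r / 2 / 2 -> boxN nu.+2 t x -> 0 <= t ->
      cabs (F (pt3 nu x) ord0 k -
         (\sum_(j < nu) x j.+2 * jacobian_f F 0 0 0 j k + Pol n id (c k) x)) <= K * t ^+ n.+1].
Proof.
move=> r0 F0 hF; set A := jacobian_f F 0 0 0.
pose s := r / 2; have s0 : 0 < s by rewrite divr_gt0.
have s2 : 2 * s = r by rewrite /s; field.
have sr : s / 2 <= r by rewrite /s; lra.
pose G k (x : env) := F (pt3 nu x) ord0 k - \sum_(j < nu) x j.+2 * A j k.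
(* [F] contributes 1 and the linear part at most the double sum; summing over all [k] makes one
   bound serve every entry. *)
pose B : R := 1 + \sum_k \sum_(j < nu) r * cabs (A j k).
have r_ge0 := ltW r0.
have hG k : sep_holo nu.+2 s B (G k).
  split.
  - move=> x y xy; rewrite /G; congr (F _ _ _ - _).
      by rewrite /pt3 !xy //; congr (_, _, _); apply/rowP => q; rewrite !mxE xy // !ltnS.
    by apply: eq_bigr => j _; rewrite xy // !ltnS.
  - move=> x; rewrite s2 => hx; apply: le_trans (cabsD _ _) _; rewrite cabsN; apply: lerD.
      by have [_] := hF x hx.
    rewrite [leRHS](bigD1 k) //= -[leLHS]addr0; apply: lerD; last first.
      by apply: sumr_ge0 => k' _; apply: sumr_ge0 => j _; rewrite mulr_ge0 ?cabs_ge0.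
    apply: le_trans (cabs_sum _ _ _) _; apply: ler_sum => j _.
    by rewrite cabsM ler_wpM2r ?cabs_ge0 // hx // !ltnS.
  - move=> x j; rewrite s2 => hx jN; rewrite /G; apply: differentiableB.
      have ux : upd x j (x j) = x.
        by apply: funext => n; rewrite /upd; case: eqP => // ->.
      apply: (@differentiable_entry _ _ _ (fun t : C => F (pt3 nu (upd x j t)))).
      apply: (@differentiable_comp _ _ _ _ (fun t : C => pt3 nu (upd x j t)) F).
        by apply: differentiable_pt3 => i _; exact: differentiable_upd.
      by rewrite ux; have [] := hF x hx.
    apply: differentiable_bigsum => i; apply: differentiableM; first exact: differentiable_upd.
    exact: differentiable_cst.
have [c hc] := choice (fun k => taylor_several s0 (hG k)).
have Gtay k n : exists K : R, forall x (t : R), t <= s / 2 -> boxN nu.+2 t x -> 0 <= t ->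
    cabs (G k x - Pol n id (c k) x) <= K * t ^+ n.+1 by have [_] := hc k; apply.
have pt0 : pt3 nu (fun=> 0 : C) = ((0, 0, 0) : V).
  by rewrite /pt3; congr (_, _, _); apply/rowP => q; rewrite !mxE.
have dF0 : differentiable F (0, 0, 0).
  have b0 : boxN nu.+2 r (fun=> 0) by move=> j _; rewrite cabs0.
  by rewrite -pt0; have [h _] := hF _ b0.
exists c, (2 ^+ nu.+2 * B); split.
- apply: mulr_ge0; first exact: exprn_ge0.
  by apply: addr_ge0 => //; apply: sumr_ge0 => k _; apply: sumr_ge0 => j _; rewrite mulr_ge0 ?cabs_ge0.
- move=> k; apply: (low_coef s0 (Gtay k 1%N)).
    rewrite /G pt0 F0 mxE sub0r; apply/eqP; rewrite oppr_eq0; apply/eqP.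
    by apply: big1 => j _; rewrite mul0r.
  move=> [[|[|i]] hi] e //= _ e0; have iN : (i < nu)%N by rewrite !ltnS in hi.
  have [d d0 hd] := axis_derivative (Ordinal iN) k dF0 e0.
  exists (d / 2); first by rewrite divr_gt0.
  move=> t td; have := hd t; rewrite subr0 => hd'.
  have -> : G k (upd (fun=> 0) i.+2 t) =
     F (0, 0, t *: delta_mx ord0 (Ordinal iN)) ord0 k -
     F (0, 0, 0 *: delta_mx ord0 (Ordinal iN)) ord0 k - A (Ordinal iN) k * t.
    rewrite /G (pt3_axis (Ordinal iN)) scale0r F0 [in X in _ - X - _]mxE subr0; congr (_ - _).
    rewrite (bigD1 (Ordinal iN)) //= /upd eqxx big1 ?addr0 1?mulrC // => q qi.
    by rewrite !eqSS (negbTE (_ : (q : nat) != i)) ?mul0r.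
  by apply: hd'; lra.
- by move=> k a; have [h _] := hc k; exact: h.
- move=> k n; have [K hK] := Gtay k n; exists K => x t ts hx t0.
  by rewrite opprD addrA; exact: hK.
Qed.
End equation.

(** * Bounds on the coefficients of the solution, and the theorem *)

Section gevrey.
Variables (R : realType) (nu : nat).
Local Notation C := (Cx R).
Local Notation env := (nat -> C).
Local Notation V := (Cx R * Cx R * 'rV[Cx R]_nu)%type.

(** Extension by 0 to all natural indices, as required by functions on sequences. *)
Definition nth_entry (v : 'rV[C]_nu) (j : nat) : C :=
  if insub j is Some k then v ord0 k else 0.

Lemma nth_entry_ord v (k : 'I_nu) : nth_entry v k = v ord0 k.
Proof. by rewrite /nth_entry valK. Qed.

Lemma coefficient_bound (F : V -> 'rV[C]_nu) (a : nat -> C -> 'rV[C]_nu) (r : R) :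
  0 < r -> F (0, 0, 0) = 0 ->
  (forall x, boxN nu.+2 r x ->
    differentiable F (pt3 nu x) /\ forall k, cabs (F (pt3 nu x) ord0 k) <= 1) ->
  jacobian_f F 0 0 0 \in unitmx ->
  (forall i, \forall z \near (0 : C), differentiable (a i) z) ->
  a 0%N 0 = 0 -> formal_solution F a ->
  exists del lam cc : R, [/\ 0 < lam, 0 < cc &
    forall i m (j : 'I_nu), cabs (tcoef (fun z => nth_entry (a i z) j) m) * wt lam cc i m <= del].
Proof.
move=> r0 F0 hF Au ha a00 sol.
have [c [M [M0 hc hcM hT]]] := taylor_system r0 F0 hF.
pose s := r / 2; have s0 : 0 < s by rewrite divr_gt0.
have s2r x : boxN nu.+2 (s / 2) x -> boxN nu.+2 r x.
  by move=> hx j jN; apply: le_trans (hx j jN) _; rewrite /s; lra.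
pose ca i j z := nth_entry (a i z) j.
have lha i j : local_holo (ca i j).
  rewrite /ca /nth_entry; case: (insub j) => [k|].
    apply: local_holo_near; apply: filterS (ha i) => z dz; exact: differentiable_entry.
  apply: local_holo_near; apply/nbhs_cabs; exists 1; first exact: ltr01.
  by move=> z _; exact: differentiable_cst.
have ca0 j : ca 0%N j 0 = 0 by rewrite /ca /nth_entry a00; case: insub => // k; rewrite mxE.
have al0 j : tcoef (ca 0%N j) 0 = 0 by rewrite tcoef0.
have curveE i e z : pt3 nu (Xenv e z (fun j => \sum_(q < i.+1) e ^+ q * ca q j z)) =
    (e, z, \sum_(q < i.+1) e ^+ q *: a q z).
  rewrite /pt3 /=; congr (_, _, _); apply/rowP => k; rewrite mxE summxE.
  by apply: eq_bigr => q _; rewrite mxE /ca nth_entry_ord.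
pose curve i (e z : C) := pt3 nu (Xenv e z (fun j => \sum_(q < i.+1) e ^+ q * ca q j z)).
have dcurve i e z : boxN nu.+2 r (Xenv e z (fun j => \sum_(q < i.+1) e ^+ q * ca q j z)) ->
    differentiable (fun e => F (curve i e z)) e.
  move=> hbox; apply: (@differentiable_comp _ _ _ _ (fun e => curve i e z) F).
    apply: differentiable_pt3 => -[|[|j]] _ /=.
    + by apply/derivable1_diffP; exact: derivable_id.
    + exact: differentiable_cst.
    + apply: differentiable_bigsum => q; apply: differentiableM; last exact: differentiable_cst.
      by apply/derivable1_diffP; exact: exprn_derivable.
  by have [h _] := hF _ hbox; exact: h.
apply: (@majorant R nu (fun i m j => tcoef (ca i j) m) _ c s M Au s0 M0 al0 hc hcM).
move=> i m n k imn.
apply: (@formal_relation R nu k s (fun x => F (pt3 nu x) ord0 k) (fun j => jacobian_f F 0 0 0 j k)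
   (c k) ca s0 (hT k) _ lha ca0 _ _ i m n imn).
- by exists 1 => x /s2r/hF[_].
- move=> i' e z /s2r hbox.
  exact: (@differentiable_entry _ _ _ (fun e => F (curve i' e z)) _ k (dcurve i' e z hbox)).
- move=> i'.
  (* The [i]-th equation involves the derivative of the preceding coefficient only, and none at all
     when [i = 0]. *)
  have near_da : \forall z \near (0 : C), if i' is l.+1 then differentiable (a l) z else True.
    by case: i' => [|l]; [apply/nbhs_cabs; exists 1|exact: ha].
  apply: filterS (filterI (sol i') near_da) => z [eqz dz] z0 hbox.
  (* For fixed [z] different from 0 the curve stays in the domain for [|e| <= 2|z|], so [|z|] serves
     as the radius for taking the [e]-derivatives entrywise. *)
  have z0' : 0 < cabs z by rewrite cabs_gt0.
  have fE : (fun e => F (e, z, \sum_(q < i'.+1) e ^+ q *: a q z)) = (fun e => F (curve i' e z)).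
    by apply: funext => e; rewrite /curve curveE.
  have df e : cabs e <= 2 * cabs z -> differentiable (fun e => F (curve i' e z)) e.
    by move=> ez; apply: dcurve; apply: s2r; exact: hbox.
  have bf e j : cabs e <= 2 * cabs z -> cabs (F (curve i' e z) ord0 j) <= 1.
    by move=> ez; have [_] := hF _ (s2r _ (hbox e ez)); apply.
  have zz : cabs (0 : C) < cabs z / 2 by rewrite cabs0 divr_gt0.
  have [h _] := derive1n_entry z0' df bf i' zz.
  rewrite /tcoef -(h k).
  have := congr1 (fun v : 'rV[C]_nu => v ord0 k) eqz.
  rewrite /coef_comp fE mxE => <-.
  rewrite /coef_lhs; case: i' near_da {eqz hbox fE df bf h} dz => [|l] _ dz; first by rewrite mxE.
  rewrite mxE; congr (_ * _).
  rewrite -(derive1_entry k dz); congr (derive1 _ z).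
  by apply: funext => w; rewrite /ca nth_entry_ord.
Qed.

(** Dividing by the weight leaves [max(m, 1)^i]; [pow_le_fact] trades it for [i!] and geometric
    factors, separating [i] from [m]. *)
Lemma wt_bound (lam cc del x : R) i m : 0 < lam -> 0 < cc -> 0 <= x ->
  x * wt lam cc i m <= del -> x <= `|del| * (2 / cc) ^+ i * i`!%:R * (2 / lam) ^+ m.
Proof.
move=> l0 c0 x0 h.
have w0 : 0 < wt lam cc i m.
  by rewrite mulr_gt0 ?exprn_gt0 // divr_gt0 // ltr0n leq_maxr.
have {}h : x <= `|del| / wt lam cc i m.
  by rewrite ler_pdivlMr //; apply: le_trans h (ler_norm _).
apply: le_trans h _; rewrite -!mulrA ler_wpM2l //.
have -> : (wt lam cc i m)^-1 = (maxn m 1 ^ i)%:R * (cc^-1 ^+ i * lam^-1 ^+ m).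
  rewrite /wt natrX invfM exprMn invfM -!exprVn invrK; ring.
have -> : (2 / cc) ^+ i * (i`!%:R * (2 / lam) ^+ m) =
    (i`! * 2 ^ (i + m))%:R * (cc^-1 ^+ i * lam^-1 ^+ m).
  by rewrite natrM natrX exprD !exprMn; ring.
rewrite ler_wpM2r ?ler_nat ?pow_le_fact //.
by rewrite mulr_ge0 ?exprn_ge0 ?invr_ge0 // ltW.
Qed.
End gevrey.

Theorem proposition2 (R : realType) (nu : nat) (rho rho1 : R)
    (F : Cx R * Cx R * 'rV[Cx R]_nu -> 'rV[Cx R]_nu)
    (theta gamma : R) (a : nat -> Cx R -> 'rV[Cx R]_nu)
    (nu_ge1 : (1 <= nu)%N) (rho_gt0 : 0 < rho) (rho_lt_rho1 : rho < rho1)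
    (F_holo : holomorphic_near (closed_polydisc (n := nu) rho rho1) F)
    (F_00 : forall e : Cx R, closed_disc rho e -> F (e, 0, 0) = 0)
    (A01_inv : jacobian_f F 0 0 0 \in unitmx)
    (gamma_gt0 : 0 < gamma)
    (eig_arg : forall lambda : Cx R, eigenvalue (jacobian_f F 0 0 0) lambda ->
       forall phi : R, is_arg_around theta lambda phi ->
         gamma / 2 < `|phi - theta|)
    (a_holo : forall i, \forall z \near (0 : Cx R), differentiable (a i) z)
    (a00 : a 0%N 0 = 0)
    (a_sol : formal_solution F a) :
  (* b i is the analytic continuation to the disc of radius kappa of the germ
     of a i at 0 *)
  exists sigma kappa : R, [/\ 0 < sigma, sigma < kappa, kappa < rho &
    exists b : nat -> Cx R -> 'rV[Cx R]_nu,
      [/\ forall i, \forall z \near (0 : Cx R), b i z = a i z,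
          forall i, holomorphic_on (disc kappa) (b i),
          exists C mu : R, [/\ 0 < C, 0 < mu &
            forall (i : nat) (z : Cx R), closed_disc sigma z ->
              eucl_norm (b i z) <= rc (C * i`!%:R * mu ^+ i)]
        & gevrey1_series sigma b]].
Proof.
have [U [KU [oU hU]]] := F_holo.
have rho1_gt0 := lt_trans rho_gt0 rho_lt_rho1.
have U0 : U (0, 0, 0).
  by apply: KU; split => [||j] /=; rewrite /closed_disc /= ?mxE normr0 -(rc0 R) rc_le ltW.
have F0 : F (0, 0, 0) = 0.
  by apply: F_00; rewrite /closed_disc /= normr0 -(rc0 R) rc_le ltW.
have [r r0 hF] := near_origin oU U0 hU F0.
have [del [lam [cc [lam0 cc0 hal]]]] := coefficient_bound r0 F0 hF A01_inv a_holo a00 a_sol.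
pose al i j m : Cx R := tcoef (fun z => nth_entry (a i z) j) m.
pose Kc i : R := `|del| * (2 / cc) ^+ i * i`!%:R.
pose Q : R := 2 / lam.
have Q0 : 0 < Q by rewrite divr_gt0.
have Kc0 i : 0 <= Kc i by rewrite /Kc !mulr_ge0 ?exprn_ge0 ?divr_ge0 ?(ltW cc0).
have hK i (j : 'I_nu) m : cabs (al i j m) <= Kc i * Q ^+ m.
  exact: wt_bound lam0 cc0 (cabs_ge0 _) (hal i m j).
pose rad : R := (8 * Q)^-1.
have rad0 : 0 < rad by rewrite invr_gt0 mulr_gt0.
(* [rad] comes from [pser_differentiable] and depends on [lam] alone, hence not on [i]; [rho / 2]
   ensures [kappa < rho]. *)
pose kappa := Num.min rad (rho / 2).
have kappa0 : 0 < kappa by rewrite lt_min rad0 divr_gt0.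
have kr : kappa <= rad by rewrite ge_min lexx.
have krho : kappa <= rho / 2 by rewrite ge_min lexx orbT.
pose sigma := kappa / 2.
have sigma0 : 0 < sigma by rewrite divr_gt0.
have sk : sigma < kappa by rewrite /sigma; lra.
clearbody kappa.
pose b i z : 'rV[Cx R]_nu := \row_j pser (al i j) z.
have b_diff i z : cabs z < kappa -> differentiable (b i) z.
  move=> zk; apply: differentiable_row => j.
  have -> : (fun z => b i z ord0 j) = pser (al i j) by apply: funext => w; rewrite mxE.
  exact: (pser_differentiable Q0 (Kc0 i) (erefl rad) (hK i j) (lt_le_trans zk kr)).
have b_holo i s : s <= kappa -> holomorphic_on (disc s) (b i).
  move=> hs; split; first exact: open_disc.
  by move=> z; rewrite /disc /= normE rc_lt => zs; apply: b_diff; apply: lt_le_trans hs.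
have b_near i : \forall z \near (0 : Cx R), b i z = a i z.
  have h : \forall z \near (0 : Cx R), forall j : 'I_nu, pser (al i j) z = a i z ord0 j.
    apply: (@filter_forall _ _ _ (nbhs (0 : Cx R))) => j.
    have lh : local_holo (fun z => nth_entry (a i z) j).
      apply: local_holo_near; apply: filterS (a_holo i) => z dz.
      have -> : (fun z => nth_entry (a i z) j) = (fun z => a i z ord0 j).
        by apply: funext => w; rewrite nth_entry_ord.
      exact: differentiable_entry.
    by apply: filterS (pser_local lh) => z; rewrite nth_entry_ord.
  by apply: filterS h => z hz; apply/rowP => j; rewrite mxE.
have b_bound : gevrey1_bound sigma b.
  (* Each of the [nu] entries is at most [2 Kc i], and the Euclidean norm is at most the sum of the
     moduli; the 1 keeps the constant positive. *)
  exists (nu%:R * (2 * `|del|) + 1), (2 / cc); split.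
  - by rewrite ltr_pwDr // !mulr_ge0.
  - by rewrite divr_gt0.
  move=> i z; rewrite /closed_disc /= normE rc_le => zs.
  apply: le_trans (eucl_norm_le _) _; rewrite rc_le.
  apply: (@le_trans _ _ (\sum_(j < nu) 2 * Kc i)).
    apply: ler_sum => j _; rewrite mxE.
    by apply: (pser_bound Q0 (Kc0 i) (erefl rad) (hK i j)); lra.
  rewrite sumr_const card_ord -(mulr_natr (2 * Kc i)).
  have -> : 2 * Kc i * nu%:R = nu%:R * (2 * `|del|) * (i`!%:R * (2 / cc) ^+ i) by rewrite /Kc; ring.
  rewrite -[leRHS]mulrA ler_wpM2r ?lerDl //.
  by rewrite mulr_ge0 ?exprn_ge0 ?divr_ge0 ?(ltW cc0).
exists sigma, kappa; split; [exact: sigma0|exact: sk|lra|].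
exists b; split; [exact: b_near|by move=> i; exact: b_holo|exact: b_bound|].
split; last exact: b_bound.
move=> i; split; first by apply: b_holo; exact: ltW.
apply: continuous_in_subspaceT => z; rewrite inE /closed_disc /= normE rc_le => zs.
by apply: differentiable_continuous; apply: b_diff; lra.
Qed.
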